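(* Let $Z$ be a fat point scheme in $\mathbb{P}^1\times\mathbb{P}^1$ with Hilbert function $H_Z$. The following are equivalent: (i) $Z$ is arithmetically Cohen–Macaulay; (ii) $\Delta H_Z$ is the Hilbert function of a bigraded artinian quotient of $\mathbf{k}[x_1,y_1]$ (bigraded by $\deg x_1=(1,0)$, $\deg y_1=(0,1)$); (iii) $\alpha_Z^*=\beta_Z$; (iv) the set $\mathcal{S}_Z$ is totally ordered under the componentwise order on $\mathbb{N}^t$.
   Context: $\mathbf{k}$ algebraically closed, $R=\mathbf{k}[x_0,x_1,y_0,y_1]$ bigraded with $\deg x_i=(1,0)$, $\deg y_i=(0,1)$; a point $[a_0:a_1]\times[b_0:b_1]$ has ideal $(a_1x_0-a_0x_1,b_1y_0-b_0y_1)$; a fat point scheme $Z$ (distinct points $P_k$ with positive multiplicities $m_k$) has ideal $I_Z=\bigcap\wp_{P_k}^{m_k}$, Hilbert function $H_Z(i,j)=\dim_{\mathbf{k}}(R/I_Z)_{(i,j)}$, and is ACM if $R/I_Z$ is Cohen–Macaulay. $\Delta H_Z(i,j)=H_Z(i,j)-H_Z(i-1,j)-H_Z(i,j-1)+H_Z(i-1,j-1)$ with $H_Z=0$ outside $\mathbb{N}^2$. With $\pi_1(\mathrm{Supp}\,Z)=\{R_1,\dots,R_r\}$, $\pi_2(\mathrm{Supp}\,Z)=\{Q_1,\dots,Q_t\}$ and $m_{ij}$ the multiplicity of $R_i\times Q_j$ ($0$ if absent), $(n)_+=\max\{0,n\}$: $l_i=\max_j m_{ij}$, $a_{i,k}=\sum_j(m_{ij}-k)_+$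 ($0\le k\le l_i-1$), $\alpha_Z$ = all $a_{i,k}$ in non-increasing order; $l'_j=\max_i m_{ij}$, $b_{j,k}=\sum_i(m_{ij}-k)_+$ ($0\le k\le l'_j-1$), $\beta_Z$ = all $b_{j,k}$ in non-increasing order. The conjugate of a partition $\lambda$ is $\lambda^*$ with $\lambda^*_i=\#\{j:\lambda_j\ge i\}$, $i=1,\dots,\lambda_1$. With $t_{ij}(h)=(m_{ij}-h)_+$, $\mathcal{S}_Z=\{(t_{i1}(h),\dots,t_{it}(h)) : 1\le i\le r,\ h\in\mathbb{N}\}\subseteq\mathbb{N}^t$. *)

(* Defs.v *)
From HB Require Import structures.
From mathcomp Require Import all_boot all_order all_algebra.
From mathcomp Require Import mpoly.
Set Implicit Arguments. Unset Strict Implicit. Unset Printing Implicit Defensive.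
Import Order.TTheory GRing.Theory.
Local Open Scope ring_scope.

Section Alg.
Variables (F : fieldType) (n : nat).
Local Notation P := {mpoly F[n]}.

Definition is_ideal (I : P -> Prop) :=
  [/\ I 0, (forall f g, I f -> I g -> I (f + g)) & (forall r f, I f -> I (r * f))].

Definition is_prime_ideal (I : P -> Prop) :=
  [/\ is_ideal I, ~ I 1 & forall f g, I (f * g) -> I f \/ I g].

Definition ideal_sum_gen (I : P -> Prop) (fs : seq P) (f : P) :=
  exists h, I h /\ exists gs : seq P,
    size gs = size fs /\ f = h + \sum_(a < size fs) gs`_a * fs`_a.

(* a chain P_0 < P_1 < ... < P_d of prime ideals of P containing I,
   i.e. a chain of primes of length d in P/I *)
Definition prime_chain (I : P -> Prop) (d : nat) :=
  exists C : nat -> P -> Prop,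
    (forall l, (l <= d)%N -> is_prime_ideal (C l) /\ (forall f, I f -> C l f)) /\
    (forall l, (l < d)%N ->
       (forall f, C l f -> C l.+1 f) /\ exists f, C l.+1 f /\ ~ C l f).

Definition krull_dim_quot (I : P -> Prop) (d : nat) :=
  prime_chain I d /\ forall d', prime_chain I d' -> (d' <= d)%N.

(* the homogeneous maximal ideal (X_0, ..., X_{n-1}) *)
Definition irrelevant (f : P) := f@_0%MM = 0.

Definition quot_regular_seq (I : P -> Prop) (fs : seq P) :=
  [/\ (forall l, (l < size fs)%N -> irrelevant fs`_l),
      ~ ideal_sum_gen I fs 1 &
      forall l, (l < size fs)%N -> forall g,
        ideal_sum_gen I (take l fs) (g * fs`_l) -> ideal_sum_gen I (take l fs) g].

Definition depth_quot (I : P -> Prop) (d : nat) :=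
  (exists fs, size fs = d /\ quot_regular_seq I fs) /\
  forall fs, quot_regular_seq I fs -> (size fs <= d)%N.

Definition cohen_macaulay_quot (I : P -> Prop) :=
  exists d, krull_dim_quot I d /\ depth_quot I d.

(* artinian quotient: DCC on ideals of P/I (= ideals of P containing I) *)
Definition artinian_quot (I : P -> Prop) :=
  forall C : nat -> P -> Prop,
    (forall l, is_ideal (C l) /\ (forall f, I f -> C l f)) ->
    (forall l f, C l.+1 f -> C l f) ->
    exists N, forall l, (N <= l)%N -> forall f, C l f <-> C N f.

Variable bideg : 'X_{1..n} -> nat * nat.

Definition bihomog (i j : nat) (f : P) :=
  forall m, m \in msupp f -> bideg m = (i, j).

Definition bicomp (i j : nat) (f : P) : P :=
  \sum_(m <- msupp f | bideg m == (i, j)) f@_m *: 'X_[m].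

Definition bigraded_ideal (I : P -> Prop) :=
  is_ideal I /\ forall f i j, I f -> I (bicomp i j f).

Definition indep_mod (I : P -> Prop) (ps : seq P) :=
  forall c : seq F, size c = size ps ->
    I (\sum_(l < size ps) c`_l *: ps`_l) ->
    forall l, (l < size c)%N -> c`_l = 0.

Definition quot_dim (I : P -> Prop) (i j d : nat) :=
  (exists ps : seq P, [/\ size ps = d,
      (forall l, (l < size ps)%N -> bihomog i j ps`_l) & indep_mod I ps]) /\
  forall ps : seq P, (forall l, (l < size ps)%N -> bihomog i j ps`_l) ->
    indep_mod I ps -> (size ps <= d)%N.

End Alg.

(* R = F[x0,x1,y0,y1] = {mpoly F[4]} with x0,x1,y0,y1 = X_0,X_1,X_2,X_3 *)
Definition bideg4 (m : 'X_{1..4}) : nat * nat :=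
  ((m (inord 0) + m (inord 1))%N, (m (inord 2) + m (inord 3))%N).
(* S = F[x1,y1] = {mpoly F[2]} with x1,y1 = X_0,X_1 *)
Definition bideg2 (m : 'X_{1..2}) : nat * nat := (m (inord 0), m (inord 1)).

(* a point [a0:a1] x [b0:b1] with multiplicity fmult *)
Record fatpt (F : Type) := FatPt { fa0 : F; fa1 : F; fb0 : F; fb1 : F; fmult : nat }.

Section Fat.
Variable F : fieldType.
Implicit Types (Z : seq (fatpt F)).

Definition peq (a0 a1 c0 c1 : F) : bool := a0 * c1 == a1 * c0.

Definition same_P (P Q : fatpt F) : bool :=
  peq (fa0 P) (fa1 P) (fa0 Q) (fa1 Q) && peq (fb0 P) (fb1 P) (fb0 Q) (fb1 Q).

Definition fat_point_scheme Z :=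
  [/\ (0 < size Z)%N,
      all (fun P => [&& (fa0 P != 0) || (fa1 P != 0),
                        (fb0 P != 0) || (fb1 P != 0) & (0 < fmult P)%N]) Z &
      pairwise (fun P Q => ~~ same_P P Q) Z].

Definition x0 : {mpoly F[4]} := 'X_(inord 0).
Definition x1 : {mpoly F[4]} := 'X_(inord 1).
Definition y0 : {mpoly F[4]} := 'X_(inord 2).
Definition y1 : {mpoly F[4]} := 'X_(inord 3).

Definition lin1 (P : fatpt F) : {mpoly F[4]} := fa1 P *: x0 - fa0 P *: x1.
Definition lin2 (P : fatpt F) : {mpoly F[4]} := fb1 P *: y0 - fb0 P *: y1.

(* f \in wp_P^m, where wp_P = (lin1 P, lin2 P) *)
Definition in_pt_pow (P : fatpt F) (m : nat) (f : {mpoly F[4]}) :=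
  exists g : nat -> {mpoly F[4]},
    f = \sum_(a < m.+1) g a * lin1 P ^+ a * lin2 P ^+ (m - a).

Definition dfltP : fatpt F := FatPt 0 0 0 0 0.
Definition ptZ Z k := nth dfltP Z k.

Definition IZ Z (f : {mpoly F[4]}) :=
  forall k, (k < size Z)%N -> in_pt_pow (ptZ Z k) (fmult (ptZ Z k)) f.

Definition peq1 Z k k' := peq (fa0 (ptZ Z k)) (fa1 (ptZ Z k)) (fa0 (ptZ Z k')) (fa1 (ptZ Z k')).
Definition peq2 Z k k' := peq (fb0 (ptZ Z k)) (fb1 (ptZ Z k)) (fb0 (ptZ Z k')) (fb1 (ptZ Z k')).

(* indices of representatives of R_1..R_r (resp. Q_1..Q_t) *)
Definition Rs Z := [seq k <- iota 0 (size Z) | all (fun k' => ~~ peq1 Z k' k) (iota 0 k)].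
Definition Qs Z := [seq k <- iota 0 (size Z) | all (fun k' => ~~ peq2 Z k' k) (iota 0 k)].

(* m_{ij}: multiplicity of R_i x Q_j (0 if absent); i, j given by indices *)
Definition mZ Z i j : nat :=
  sumn [seq fmult (ptZ Z k) | k <- iota 0 (size Z) & peq1 Z k i && peq2 Z k j].

Definition lZ Z i := (\max_(j <- Qs Z) mZ Z i j)%N.
Definition aZ Z i k := (\sum_(j <- Qs Z) (mZ Z i j - k))%N.
Definition lZ' Z j := (\max_(i <- Rs Z) mZ Z i j)%N.
Definition bZ Z j k := (\sum_(i <- Rs Z) (mZ Z i j - k))%N.

Definition alphaZ Z : seq nat :=
  sort geq (flatten [seq [seq aZ Z i k | k <- iota 0 (lZ Z i)] | i <- Rs Z]).
Definition betaZ Z : seq nat :=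
  sort geq (flatten [seq [seq bZ Z j k | k <- iota 0 (lZ' Z j)] | j <- Qs Z]).

Definition SZ_totally_ordered Z :=
  forall i i' h h', i \in Rs Z -> i' \in Rs Z ->
    (forall j, j \in Qs Z -> (mZ Z i j - h <= mZ Z i' j - h')%N) \/
    (forall j, j \in Qs Z -> (mZ Z i' j - h' <= mZ Z i j - h)%N).

End Fat.

Definition conj_part (lam : seq nat) : seq nat :=
  [seq count (fun x => i <= x)%N lam | i <- iota 1 (\max_(x <- lam) x)%N].

(* Delta H, with H = 0 outside N^2 *)
Definition DeltaH (H : nat -> nat -> nat) (i j : nat) : int :=
  (H i j)%:Z - (if (0 < i)%N then (H i.-1 j)%:Z else 0)
  - (if (0 < j)%N then (H i j.-1)%:Z else 0)
  + (if (0 < i)%N && (0 < j)%N then (H i.-1 j.-1)%:Z else 0).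

(* Main.v *)
(* Let l, l' be linear forms in x and in y avoiding the points of Z.  Any three
   elements of R/I_Z are algebraically dependent, because dim (R/I_Z)_(i,j) is
   bounded; hence R/I_Z has Krull dimension 2 and depth at most 2.  A depth 2
   ring R/I_Z has no socle modulo l, which forces (l, l') to be regular, and then
   R/(I_Z, l, l') is an artinian quotient of k[x1,y1] with Hilbert function
   Delta H.  Conversely a Hilbert function of such a quotient is the indicator
   of a staircase; its row and column lengths are alpha^* and beta^*, read off
   from H for large degrees by removing the lines through the support one at a
   time, so alpha^* = beta.  This equality says that the 0-1 matrix with entries
   [h + k < m_ij], rows (i,h) and columns (j,k), has nested rows, i.e. that S_Z
   is totally ordered.  Finally, if S_Z is totally ordered, let L be the line of
   the largest row and D the product of the M_j^(m_ij) on it: I_Z : L is the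
   ideal of the scheme with this row lowered by one, and I_Z + (L) = (L, D), so
   regularity of (l, l') follows by induction. *)
Require Import Defs.
From HB Require Import structures.
From mathcomp Require Import all_boot all_order all_algebra.
From mathcomp Require Import mpoly.
From mathcomp Require Import ring zify.
From Stdlib Require Import Classical FunctionalExtensionality PropExtensionality.
Set Implicit Arguments. Unset Strict Implicit. Unset Printing Implicit Defensive.
Import Order.TTheory GRing.Theory.
Local Open Scope ring_scope.

(** * Dimensions of quotients of Prop-valued subspaces *)

(** Two devices replace primary decomposition. The scheme becomes a matrix of multiplicities on
    fixed finite sets of rows and columns, with zero entries allowed: lowering a row is an operation
    on the matrix alone, and the induction never changes the points. Membership in a power of a
    point ideal becomes divisibility by a power of ['X] after a substitution ([phi]), and congruence
    modulo one line becomes equality after another ([psix], [psiy]); both land in domains, where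
    factors cancel. The generic forms are l = x0 - c x1 and l' = y0 - d y1, so that dividing by them
    eliminates x0 and y0; algebraic closedness supplies c and d outside a finite set. The delicate
    direction goes from depth 2 to these particular forms, since a regular sequence of the
    definition is merely a list of polynomials without constant term, not necessarily bihomogeneous.
    For the same reason the bound on regular sequences and on prime chains counts dimensions of
    finite sums of bigraded components instead of assuming graded elements. *)

Definition subsp (F : fieldType) (V : lmodType F) (I : V -> Prop) :=
  I 0 /\ forall c u v, I u -> I v -> I (c *: u + v).

Section Subsp.
Variables (F : fieldType) (V : lmodType F) (I : V -> Prop) (sI : subsp I).

Lemma subsp0 : I 0. Proof. by case: sI. Qed.

Lemma subspD u v : I u -> I v -> I (u + v).
Proof. by move=> Iu Iv; rewrite -[u]scale1r; apply: sI.2. Qed.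

Lemma subspZ c u : I u -> I (c *: u).
Proof. by move=> Iu; rewrite -[_ *: _]addr0; apply: sI.2 => //; apply: subsp0. Qed.

Lemma subspN u : I u -> I (- u).
Proof. by move=> Iu; rewrite -scaleN1r; apply: subspZ. Qed.

Lemma subspB u v : I u -> I v -> I (u - v).
Proof. by move=> Iu Iv; apply: subspD => //; apply: subspN. Qed.

Lemma subsp_sum (T : Type) (s : seq T) (P : pred T) (f : T -> V) :
  (forall t, P t -> I (f t)) -> I (\sum_(t <- s | P t) f t).
Proof. by move=> If; apply: big_ind => //; [exact: subsp0 | exact: subspD]. Qed.

End Subsp.

Section QDim.
Variables (F : fieldType).

Section OneSpace.
Variable V : lmodType F.
Implicit Types (W I : V -> Prop).

Definition indep I (T : finType) (p : T -> V) :=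
  forall c : T -> F, I (\sum_t c t *: p t) -> forall t, c t = 0.

Definition spans W I (T : finType) (p : T -> V) :=
  forall f, W f -> exists c : T -> F, I (f - \sum_t c t *: p t).

(** The dimension of W/(W ∩ I): [I] need not lie in [W], so [W] can be one bigraded component while
    [I] is a whole ideal. *)
Definition qdim W I d := exists p : 'I_d -> V,
  [/\ forall t, W (p t), indep I p & spans W I p].

(** The coordinates modulo [I] form a matrix with more rows than columns; a nonzero row of its left
    kernel gives the combination. *)
Lemma span_dep I (S T : finType) (p : T -> V) (v : S -> V) : subsp I ->
  (forall s, exists c : T -> F, I (v s - \sum_t c t *: p t)) ->
  (#|T| < #|S|)%N ->
  exists c : S -> F, (exists s, c s != 0) /\ I (\sum_s c s *: v s).
Proof.
move=> sI /fin_all_exists [A HA] ltTS.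
pose M := \matrix_(i < #|S|, j < #|T|) A (enum_val i) (enum_val j).
have : kermx M != 0.
  rewrite -mxrank_eq0 mxrank_ker -lt0n subn_gt0.
  by apply: leq_ltn_trans ltTS; apply: rank_leq_col.
case/rowV0Pn => u uM nzu.
have {}uM : u *m M = 0 by apply/sub_kermxP.
exists (fun s => u 0 (enum_rank s)); split.
  have /existsP [j nzj] : [exists j, u 0 j != 0].
    apply: contraNT nzu => /existsPn z; apply/eqP/rowP => j; rewrite mxE.
    by apply/eqP; rewrite -[_ == _]negbK z.
  by exists (enum_val j); rewrite enum_valK.
have -> : \sum_s u 0 (enum_rank s) *: v s =
   \sum_s u 0 (enum_rank s) *: (v s - \sum_t A s t *: p t).
  rewrite [RHS](eq_bigr _ (fun s _ => scalerBr _ _ _)) sumrB [X in _ - X](_ : _ = 0) ?subr0 //.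
  rewrite (eq_bigr (fun s => \sum_t (u 0 (enum_rank s) * A s t) *: p t)); last first.
    by move=> s _; rewrite scaler_sumr; apply: eq_bigr => t _; rewrite scalerA.
  rewrite exchange_big big1 //= => t _; rewrite -scaler_suml.
  suff -> : \sum_s u 0 (enum_rank s) * A s t = (u *m M) 0 (enum_rank t).
    by rewrite uM mxE scale0r.
  rewrite mxE (reindex (@enum_val _ (mem S))) /=; last first.
    by exists enum_rank => i _; [exact: enum_valK | exact: enum_rankK].
  by apply: eq_bigr => i _; rewrite !mxE enum_valK enum_rankK.
by apply: subsp_sum => // s _; apply: subspZ.
Qed.

Lemma indep_le_span W I (S T : finType) (p : T -> V) (v : S -> V) : subsp I ->
  spans W I p -> (forall s, W (v s)) -> indep I v -> (#|S| <= #|T|)%N.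
Proof.
move=> sI sp Wv iv; rewrite leqNgt; apply/negP => lt.
have [s|c [[s nz]] /iv z] := span_dep (p := p) (v := v) sI _ lt; first exact: sp.
by rewrite z eqxx in nz.
Qed.

Lemma qdim_uniq W I d d' : subsp I -> qdim W I d -> qdim W I d' -> d = d'.
Proof.
move=> sI [p [Wp ip sp]] [q [Wq iq sq]]; apply/eqP; rewrite eqn_leq.
have := indep_le_span sI sq Wp ip; have := indep_le_span sI sp Wq iq.
by rewrite !card_ord => -> ->.
Qed.

(** A vector outside the span can be put in front of [p] without losing independence: a nonzero
    coefficient on it could be divided out and would express it through [p]. *)
Lemma max_indep_spans W I d (p : 'I_d -> V) : subsp I ->
  (forall t, W (p t)) -> indep I p ->
  (forall q : 'I_d.+1 -> V, (forall t, W (q t)) -> ~ indep I q) -> spans W I p.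
Proof.
move=> sI Wp ip mx f Wf.
apply: NNPP => nf.
pose q (i : 'I_d.+1) := oapp p f (unlift ord0 i).
apply: (mx q); first by move=> t; rewrite /q; case: unliftP => [j _|_] /=.
move=> c; rewrite big_ord_recl {1}/q unlift_none /=.
under eq_bigr do rewrite /q liftK /=.
move=> Ic.
have c0 : c ord0 = 0.
  apply/eqP/negPn/negP => nz; apply: nf.
  exists (fun t => - (c ord0)^-1 * c (lift ord0 t)).
  have := subspZ sI (c ord0)^-1 Ic; rewrite scalerDr scalerA mulVf // scale1r.
  rewrite scaler_sumr -sumrN; congr (I (_ + _)); apply: eq_bigr => i _.
  by rewrite scalerA mulNr scaleNr opprK.
rewrite c0 scale0r add0r in Ic.
move=> t; case: (unliftP ord0 t) => [j|] -> //.
exact: (ip (fun j => c (lift ord0 j)) Ic).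
Qed.

Lemma qdim_max W I d : subsp I ->
  (exists p : 'I_d -> V, (forall t, W (p t)) /\ indep I p) ->
  (forall n (q : 'I_n -> V), (forall t, W (q t)) -> indep I q -> (n <= d)%N) ->
  qdim W I d.
Proof.
move=> sI [p [Wp ip]] mx; exists p; split=> //; apply: max_indep_spans => // q Wq iq.
by have := mx _ q Wq iq; rewrite ltnn.
Qed.

Lemma bounded_max (P : nat -> Prop) N : P 0%N -> (forall n, P n -> (n <= N)%N) ->
  exists2 d, P d & forall n, P n -> (n <= d)%N.
Proof.
elim: N => [|N IH] P0 bd; first by exists 0%N.
have [PN|nPN] := classic (P N.+1); first by exists N.+1.
apply: IH => // n Pn; have := bd _ Pn; rewrite leq_eqVlt => /orP [/eqP En|//].
by rewrite En in Pn.
Qed.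

Lemma qdim_bounded W I N : subsp I ->
  (forall n (q : 'I_n -> V), (forall t, W (q t)) -> indep I q -> (n <= N)%N) ->
  exists2 d, qdim W I d & (d <= N)%N.
Proof.
move=> sI bd.
pose P n := exists p : 'I_n -> V, (forall t, W (p t)) /\ indep I p.
have [| n [p [Wp ip]]|d [p [Wp ip]] mx] := @bounded_max P N.
- by exists (fun _ => 0); split=> [[]|c _ []].
- exact: bd ip.
exists d; last exact: bd ip.
by apply: qdim_max => //; [exists p | move=> n q Wq iq; apply: mx; exists q].
Qed.

Lemma qdim_sub W I J d : subsp I -> subsp J -> (forall f, I f -> J f) ->
  qdim W I d -> exists2 d', qdim W J d' & (d' <= d)%N.
Proof.
move=> sI sJ IJ [p [Wp ip sp]]; apply: qdim_bounded => // n q Wq iq.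
have sp' : spans W J p by move=> f /sp [c /IJ Hc]; exists c.
by have := indep_le_span sJ sp' Wq iq; rewrite !card_ord.
Qed.

Lemma qdim_ext W W' I J d : (forall f, W f <-> W' f) ->
  (forall f, W f -> I f <-> J f) -> subsp W -> qdim W I d -> qdim W' J d.
Proof.
move=> eW eIJ sW [p [Wp ip sp]]; exists p; split.
- by move=> t; apply/eW.
- move=> c Jc; apply: ip; apply/eIJ => //.
  by apply: subsp_sum => // t _; apply: subspZ.
move=> f /eW Wf; have [c Ic] := sp f Wf; exists c; apply/eIJ => //.
by apply: subspB => //; apply: subsp_sum => // t _; apply: subspZ.
Qed.

Lemma qdim0 W I : (forall f, W f -> I f) -> qdim W I 0.
Proof.
move=> WI; exists (fun _ => 0); split=> [[]//|c _ []//|f /WI If].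
by exists (fun _ => 0); rewrite big_ord0 subr0.
Qed.

Lemma qdim1 W I v : W v -> subsp I -> ~ I v ->
  (forall f, W f -> exists c, I (f - c *: v)) -> qdim W I 1.
Proof.
move=> Wv sI nIv sp; exists (fun _ => v); split=> //.
- move=> c; rewrite big_ord1 => Ic t; rewrite ord1; apply/eqP/negPn/negP => nz.
  by apply: nIv; rewrite -[v](scalerK nz); apply: subspZ.
- by move=> f /sp [c Hc]; exists (fun _ => c); rewrite big_ord1.
Qed.

End OneSpace.

(** Additivity of dimension along 0 -> W'/I' -> W/I -> W/J -> 0, where [mu] induces the first map. A
    basis of the middle term is the image of a basis on the left followed by lifts of a basis on the
    right. *)
Lemma qdim_exact (V V' : lmodType F) (mu : {linear V' -> V})
  (W I J : V -> Prop) (W' I' : V' -> Prop) d d' :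
  subsp I -> subsp J -> subsp W' ->
  (forall g, W' g -> W (mu g)) -> (forall g, W' g -> I (mu g) <-> I' g) ->
  (forall f, W f -> I f -> J f) -> (forall g, W' g -> J (mu g)) ->
  (forall f, W f -> J f -> exists2 g, W' g & I (f - mu g)) ->
  subsp W ->
  qdim W' I' d' -> qdim W J d -> qdim W I (d' + d).
Proof.
move=> sI sJ sW' muW muI IJ muJ Jmu sW [p [Wp ip sp]] [q [Wq iq sq]].
pose r (i : 'I_(d' + d)) := match split i with inl i => mu (p i) | inr j => q j end.
have sumr (c : 'I_(d' + d) -> F) : \sum_i c i *: r i =
   mu (\sum_i c (lshift d i) *: p i) + \sum_j c (rshift d' j) *: q j.
  rewrite big_split_ord /= linear_sum; congr (_ + _); apply: eq_bigr => i _.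
    by rewrite /r (unsplitK (inl i)) linearZ.
  by rewrite /r (unsplitK (inr i)).
have Wc (c : 'I_d' -> F) : W' (\sum_i c i *: p i).
  by apply: subsp_sum => // i _; apply: subspZ.
have Wd (c : 'I_d -> F) : W (\sum_i c i *: q i).
  by apply: subsp_sum => // i _; apply: subspZ.
exists r; split.
- by move=> t; rewrite /r; case: split => [i|j] //; apply: muW.
- move=> c; rewrite sumr => Ic.
  have cq : forall j, c (rshift d' j) = 0.
    apply: iq; rewrite -[X in J X](addKr (mu (\sum_i c (lshift d i) *: p i))).
    apply: subspD => //; first by apply: subspN => //; apply: muJ.
    by apply: IJ => //; apply: subspD => //; apply: muW.
  move: Ic; rewrite [X in _ + X]big1 => [|j _]; last by rewrite cq scale0r.
  rewrite addr0 => /muI - /(_ (Wc _)) /ip cp t.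
  by rewrite -(splitK t); case: (split t) => [i|j] /=; [exact: cp | exact: cq].
move=> f Wf; have [c Hc] := sq f Wf.
have [|g Wg Ig] := Jmu _ _ Hc; first by apply: subspB.
have [e He] := sp g Wg.
exists (fun i => match split i with inl i => e i | inr j => c j end).
rewrite sumr.
under eq_bigr do rewrite (unsplitK (inl _)).
under [X in _ - (_ + X)]eq_bigr do rewrite (unsplitK (inr _)).
have -> : f - (mu (\sum_i e i *: p i) + \sum_j c j *: q j) =
  (f - \sum_j c j *: q j - mu g) + mu (g - \sum_i e i *: p i).
  by rewrite linearB [RHS]addrA subrK opprD addrA addrAC.
by apply: subspD => //; apply/muI => //; apply: subspB.
Qed.

Lemma qdim_iso (V V' : lmodType F) (mu : {linear V' -> V})
  (W I : V -> Prop) (W' I' : V' -> Prop) d :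
  subsp I -> subsp W -> subsp W' ->
  (forall g, W' g -> W (mu g)) -> (forall g, W' g -> I (mu g) <-> I' g) ->
  (forall f, W f -> exists2 g, W' g & I (f - mu g)) ->
  qdim W' I' d -> qdim W I d.
Proof.
move=> sI sW sW' muW muI onto qd; rewrite -[d]addn0.
apply: (qdim_exact (J := fun _ => True) sI _ sW' muW muI) qd _ => //.
  by move=> f Wf _; apply: onto.
exact: qdim0.
Qed.

End QDim.

Lemma quot_dimP (F : fieldType) n (bd : 'X_{1..n} -> nat * nat)
    (I : {mpoly F[n]} -> Prop) i j d : subsp I ->
  quot_dim bd I i j d <-> qdim (bihomog bd i j) I d.
Proof.
move=> sI.
have toseq N (p : 'I_N -> {mpoly F[n]}) : indep I p ->
    indep_mod I [seq p i | i <- enum 'I_N].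
  have nthE (l : 'I_N) : [seq p i | i <- enum 'I_N]`_l = p l.
    by rewrite (nth_map l) ?size_enum_ord // nth_ord_enum.
  have sz : size [seq p i | i <- enum 'I_N] = N by rewrite size_map size_enum_ord.
  move=> ip c; rewrite sz => sc Ic l ltl.
  rewrite sc in ltl.
  apply: (ip (fun i => c`_i) _ (Ordinal ltl)).
  by move: Ic; under eq_bigr do rewrite nthE.
have ofseq (ps : seq {mpoly F[n]}) : indep_mod I ps ->
    indep I (fun l : 'I_(size ps) => ps`_l).
  move=> ip c Ic t.
  have nthE (l : 'I_(size ps)) : [seq c i | i <- enum 'I_(size ps)]`_l = c l.
    by rewrite (nth_map l) ?size_enum_ord // nth_ord_enum.
  have sz : size [seq c i | i <- enum 'I_(size ps)] = size ps.
    by rewrite size_map size_enum_ord.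
  rewrite -nthE; apply: (ip _ sz); last by rewrite sz.
  by rewrite (eq_bigr (fun l => c l *: ps`_l)) // => l _; rewrite nthE.
have Wseq N (p : 'I_N -> {mpoly F[n]}) : (forall t, bihomog bd i j (p t)) ->
    forall l, (l < size [seq p i | i <- enum 'I_N])%N ->
      bihomog bd i j [seq p i | i <- enum 'I_N]`_l.
  move=> Wp l; rewrite size_map size_enum_ord => ltl.
  by rewrite (nth_map (Ordinal ltl)) ?size_enum_ord.
split.
  case=> [[ps [<- Wps ips]] mx]; apply: qdim_max => //.
    exists (fun l : 'I_(size ps) => ps`_l); split; last exact: ofseq.
    by move=> t; apply: Wps.
  move=> N q Wq iq.
  have := mx _ (Wseq _ _ Wq) (toseq _ _ iq).
  by rewrite size_map size_enum_ord.
case=> p [Wp ip sp]; split.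
  exists [seq p i | i <- enum 'I_d]; rewrite size_map size_enum_ord; split=> //.
    by move=> l ltl; apply: Wseq; rewrite // size_map size_enum_ord.
  exact: toseq.
move=> ps Wps /ofseq ips.
have := indep_le_span sI sp _ ips; rewrite !card_ord; apply.
by move=> t; apply: Wps.
Qed.

(** * Partitions *)

Lemma sum_iota_leq n M : (n <= M)%N -> (\sum_(i <- iota 1 M) (i <= n : nat) = n)%N.
Proof.
elim: M n => [|M IH] n; first by rewrite leqn0 => /eqP ->; rewrite big_nil.
rewrite -addn1 iotaD big_cat /= big_cons big_nil addn0 leq_eqVlt addn1 add1n.
case/orP => [/eqP ->|ltn]; last by rewrite IH // ltnNge -ltnS ltn addn0.
rewrite leqnn -[in RHS](IH M) // addn1; congr (_.+1).
apply: eq_big_seq => i; rewrite mem_iota add1n ltnS => /andP [_ iM].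
by rewrite iM (leq_trans iM).
Qed.

Lemma sum_ord_ltn n K : (n <= K)%N -> (\sum_(k < K) (k < n : nat) = n)%N.
Proof.
elim: K n => [|K IH] n; first by rewrite leqn0 => /eqP ->; rewrite big_ord0.
rewrite big_ord_recl; case: n => [|n] nK; first by rewrite big1.
by rewrite -[in RHS](IH n) //= add1n.
Qed.

(** The square of the i-th conjugate part counts the pairs of parts (x, y) with i <= min(x, y);
    summing over i counts each pair min(x, y) times. *)
Lemma conj_part_sqr_sum s :
  (\sum_(x <- conj_part s) x ^ 2 = \sum_(x <- s) \sum_(y <- s) minn x y)%N.
Proof.
rewrite /conj_part big_map; set M := (\max_(x <- s) x)%N.
have leM x : x \in s -> (x <= M)%N by move=> xs; apply: (@leq_bigmax_seq _ s xpredT id x xs).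
transitivity (\sum_(i <- iota 1 M) \sum_(x <- s) \sum_(y <- s) (i <= minn x y))%N.
  apply: eq_bigr => i _; rewrite -sum1_count -mulnn big_distrlr /=.
  rewrite big_mkcond; apply: eq_bigr => x _; rewrite big_mkcond /=.
  case: (i <= x)%N (leq_min i x) => le_ix; last first.
    by rewrite big1 // => y _; rewrite le_ix.
  by apply: eq_bigr => y _; rewrite le_ix /=; case: (i <= y)%N.
rewrite exchange_big; apply: eq_big_seq => x xs.
rewrite exchange_big; apply: eq_big_seq => y ys.
by apply: sum_iota_leq; rewrite geq_min leM.
Qed.

Lemma nth_geq_sorted s k i : (0 < k)%N -> sorted geq s ->
  (k <= nth 0 s i)%N = (i < count (leq k) s)%N.
Proof.
move=> k0; elim: s i => [|x s IH] [|i] /=; rewrite ?leqn0 ?ltn0 ?eqn0Ngt ?k0 //.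
  move=> pth; have /allP H : all (geq x) s.
    by apply: order_path_min pth => a b c /= ba cb; apply: leq_trans cb ba.
  case: (leqP k x) => //= ltxk; apply/esym; rewrite ?add0n; apply: negbTE.
  rewrite -has_count; apply/hasPn => y /H /= yx; rewrite -ltnNge.
  exact: leq_ltn_trans ltxk.
move=> pth; rewrite IH ?(path_sorted pth) //.
case: (leqP k x) => [//|ltxk] /=; rewrite ?add0n.
suff -> : count (leq k) s = 0%N by [].
apply/eqP; rewrite -leqn0 leqNgt -has_count; apply/hasPn => y ys.
have /allP H : all (geq x) s.
  by apply: order_path_min pth => a b c /= ba cb; apply: leq_trans cb ba.
by rewrite -ltnNge; apply: leq_ltn_trans ltxk; apply: H.
Qed.

(** The hypothesis says that the counts in [beta] and in [alpha] are the column and row lengths of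
    one Young diagram. Positivity of the parts of [beta] identifies its length with
    [count (leq 1) beta], hence with the largest part of [alpha]. *)
Lemma eq_conj_part alpha beta :
  sorted geq beta -> all (leq 1) beta ->
  (forall i j, (0 < i)%N -> (0 < j)%N ->
     (j <= count (leq i) beta)%N = (i <= count (leq j) alpha)%N) ->
  conj_part alpha = beta.
Proof.
move=> sb pb H; set M := (\max_(x <- alpha) x)%N.
have szb : count (leq 1) beta = size beta by apply/eqP; rewrite -all_count.
have leM i : (0 < i)%N -> (i <= M)%N = (0 < count (leq i) alpha)%N.
  move=> i0; rewrite -has_count; apply/idP/hasP => [|[x xs ix]]; last first.
    by apply: leq_trans ix (@leq_bigmax_seq _ alpha xpredT id x xs isT).
  rewrite /M; elim: alpha {H M} => [|x s IH]; first by rewrite big_nil leqNgt i0.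
  rewrite big_cons leq_max => /orP [ix|/IH [y ys iy]].
    by exists x; rewrite ?mem_head.
  by exists y; rewrite // in_cons ys orbT.
have sz : size beta = M.
  apply/eqP; rewrite eqn_leq -szb; apply/andP; split.
    (* An inequality u <= v is proved by writing u as n + 1, the case u = 0 being trivial, so that
       the equivalences for positive numbers apply. *)
    case E: (count _ _) => [|n] //; rewrite leM // -H // E //.
  by case E: M => [|n] //; rewrite H // -leM // E.
apply: (@eq_from_nth _ 0%N); rewrite size_map size_iota ?sz // => i iM.
rewrite (nth_map 0%N) ?size_iota // nth_iota // add1n.
apply/eqP; rewrite eqn_leq; apply/andP; split.
  by case E: (count _ _) => [|n] //; rewrite nth_geq_sorted // H // E.
by case E: (nth _ _ _) => [|n] //; rewrite -H // -nth_geq_sorted // E.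
Qed.

(* Only test functions with [f 0 = 0] are used, so zero parts are ignored and
   the upper bound [K] for [k] is immaterial. *)
Definition row_parts (I J : finType) (m : I -> J -> nat) (alpha : seq nat) :=
  exists K0, forall K (f : nat -> nat), (K0 <= K)%N -> f 0%N = 0%N ->
    (\sum_(x <- alpha) f x = \sum_i \sum_(k < K) f (\sum_j (m i j - k)))%N.

(** The common part of two rows is at most the smaller row sum, so equality of the totals is
    equality for every pair; a row whose common part with another is its full sum lies below that
    other row. *)
Lemma sum_minn_nested (T J : finType) (u : T -> J -> nat) :
  (\sum_t \sum_t' \sum_j minn (u t j) (u t' j) =
   \sum_t \sum_t' minn (\sum_j u t j) (\sum_j u t' j))%N ->
  forall t t', (forall j, (u t j <= u t' j)%N) \/ (forall j, (u t' j <= u t j)%N).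
Proof.
move=> E.
have le1 t t' : (\sum_j minn (u t j) (u t' j) <= minn (\sum_j u t j) (\sum_j u t' j))%N.
  by rewrite leq_min; apply/andP; split; apply: leq_sum => j _;
     rewrite ?geq_minl ?geq_minr.
have eq1 t t' : (\sum_j minn (u t j) (u t' j) = minn (\sum_j u t j) (\sum_j u t' j))%N.
  have eqs (S : finType) (f g : S -> nat) : (forall s, f s <= g s)%N ->
      (\sum_s f s = \sum_s g s)%N -> forall s, f s = g s.
    move=> le /eqP; rewrite (leqif_sum (fun s _ => leqif_eq (le s))).
    by move/forallP => H s; apply/eqP; have := H s.
  have {}E := eqs _ _ _ (fun t => leq_sum _ (fun t' _ => le1 t t')) E t.
  exact: eqs _ _ _ (le1 t) E t'.
have half t t' : (\sum_j minn (u t j) (u t' j) = \sum_j u t j)%N ->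
    forall j, (u t j <= u t' j)%N.
  move=> /eqP.
  rewrite (leqif_sum (fun s _ => leqif_eq (geq_minl (u t s) (u t' s)))).
  by move=> /forallP H j; rewrite -(eqP (H j)) geq_minr.
move=> t t'; have := eq1 t t'.
case: (leqP (\sum_j u t j) (\sum_j u t' j))%N => [le|/ltnW le] E'; [left|right].
  by apply: half; rewrite E'.
by apply: half; under eq_bigr do rewrite minnC; rewrite E'.
Qed.

(* Rows (i, h) and columns (j, k) index the 0-1 matrix [h + k < m i j], whose
   row sums are alpha and column sums are beta.  The sum of the squares of the
   column sums counts the common entries of pairs of rows; for alpha^* it is
   the largest possible one, attained only when the rows are nested. *)
Lemma conj_part_nested (I J : finType) (m : I -> J -> nat) alpha beta :
  row_parts m alpha -> row_parts (fun j i => m i j) beta ->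
  conj_part alpha = beta ->
  forall i i' h h', (forall j, (m i j - h <= m i' j - h')%N) \/
                    (forall j, (m i' j - h' <= m i j - h)%N).
Proof.
move=> [K1 Ha] [K2 Hb] ab i i' h h'.
(* [K] exceeds both thresholds, both levels [h] and [h'] and every entry of [m]: all nonzero
   truncated rows, and the two rows in question, are indexed by ['I_K]. *)
pose K := (K1 + K2 + h + h' + \sum_i \sum_j m i j).+1.
have mK a b : (m a b <= K)%N.
  rewrite /K (bigD1 a) //= (bigD1 b) //=; lia.
have hK : (h < K)%N by rewrite /K; lia.
have hK' : (h' < K)%N by rewrite /K; lia.
pose u (t : I * 'I_K) j := (m t.1 j - t.2)%N.
apply: (@sum_minn_nested _ _ u _ (i, Ordinal hK) (i', Ordinal hK')).
have sumab : (\sum_(x <- beta) x ^ 2 = \sum_(x <- alpha) \sum_(y <- alpha) minn x y)%N.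
  by rewrite -ab conj_part_sqr_sum.
rewrite (Hb K) in sumab; [|by rewrite /K; lia|by []].
rewrite (Ha K) in sumab; [|by rewrite /K; lia|by apply: big1 => y _; rewrite min0n].
transitivity (\sum_j \sum_(k < K) (\sum_i (m i j - k)) ^ 2)%N.
  (* Both sides count the triples (s, s', k) with s + k < a and s' + k < b. *)
  have H1 a b : (a <= K)%N -> (b <= K)%N ->
     (\sum_(s < K) \sum_(s' < K) minn (a - s) (b - s') = \sum_(k < K) (a - k) * (b - k))%N.
    move=> aK bK.
    transitivity (\sum_(s < K) \sum_(s' < K) \sum_(k < K) (k < a - s) * (k < b - s'))%N.
      apply: eq_bigr => s _; apply: eq_bigr => s' _.
      rewrite -[LHS](@sum_ord_ltn _ K); last by rewrite geq_min; lia.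
      by apply: eq_bigr => k _; rewrite leq_min mulnb.
    transitivity (\sum_(s < K) \sum_(k < K) (k < a - s) * (b - k))%N.
      apply: eq_bigr => s _; rewrite exchange_big; apply: eq_bigr => k _ /=.
      rewrite -big_distrr /=; congr (_ * _)%N.
      rewrite -[RHS](@sum_ord_ltn _ K); last lia.
      by apply: eq_bigr => s' _; congr nat_of_bool; lia.
    rewrite exchange_big; apply: eq_bigr => k _ /=; rewrite -big_distrl /=.
    congr (_ * _)%N; rewrite -[RHS](@sum_ord_ltn _ K); last lia.
    by apply: eq_bigr => s' _; congr nat_of_bool; lia.
  transitivity (\sum_a \sum_a' \sum_j \sum_(s < K) \sum_(s' < K)
                   minn (m a j - s) (m a' j - s'))%N.
    rewrite -(pair_bigA _ (fun a (s : 'I_K) => \sum_t' \sum_j minn (u (a, s) j) (u t' j)))%N /=.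
    apply: eq_bigr => a _.
    under eq_bigr => s _.
      rewrite -(pair_bigA _ (fun a' (s' : 'I_K) => \sum_j minn (u (a, s) j) (u (a', s') j)))%N /=.
      over.
    rewrite exchange_big; apply: eq_bigr => a' _ /=.
    under eq_bigr => s _ do rewrite exchange_big /=.
    by rewrite exchange_big.
  rewrite [RHS](eq_bigr (fun j => \sum_(k < K) \sum_a \sum_a' (m a j - k) * (m a' j - k)))%N; last first.
    by move=> j _; apply: eq_bigr => k _; rewrite -mulnn big_distrlr.
  rewrite [RHS](eq_bigr (fun j => \sum_a \sum_a' \sum_(k < K) (m a j - k) * (m a' j - k)))%N; last first.
    by move=> j _; rewrite exchange_big; apply: eq_bigr => a _; rewrite exchange_big.
  rewrite [RHS]exchange_big; apply: eq_bigr => a _ /=.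
  rewrite [RHS]exchange_big; apply: eq_bigr => a' _ /=.
  by apply: eq_bigr => j _; apply: H1.
rewrite sumab pair_bigA; apply: eq_bigr => -[a s] _ /=.
rewrite (Ha K); [|by rewrite /K; lia|by rewrite minn0].
by rewrite pair_bigA; apply: eq_bigr => -[a' s'] _.
Qed.

(** * Substitutions, linear forms and vanishing orders *)

Lemma mpoly_var_ind (F : fieldType) n (K : {mpoly F[n]} -> Prop) :
  (forall c, K c%:MP) -> (forall f g, K f -> K g -> K (f + g)) ->
  (forall i f, K f -> K ('X_i * f)) -> forall f, K f.
Proof.
move=> KC KD KX; apply: mpolyind => [|c m f _ _ Kf]; first by rewrite -mpolyC0.
apply: KD => //; rewrite -mul_mpolyC mulrC mpolyXE_id.
elim/big_rec: _ => [|i p _ Kp]; first by rewrite mul1r.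
by rewrite -mulrA; elim: (m i) => [|k IH]; rewrite ?expr0 ?mul1r // exprS -mulrA; apply: KX.
Qed.

Lemma ord4_ind (P : 'I_4 -> Prop) :
  P (inord 0) -> P (inord 1) -> P (inord 2) -> P (inord 3) -> forall i, P i.
Proof.
move=> P0 P1 P2 P3 [[|[|[|[|//]]]] lti].
- by rewrite [Ordinal _](_ : _ = inord 0) //; apply: val_inj; rewrite /= inordK.
- by rewrite [Ordinal _](_ : _ = inord 1) //; apply: val_inj; rewrite /= inordK.
- by rewrite [Ordinal _](_ : _ = inord 2) //; apply: val_inj; rewrite /= inordK.
- by rewrite [Ordinal _](_ : _ = inord 3) //; apply: val_inj; rewrite /= inordK.
Qed.

Lemma ideal_subsp (F : fieldType) n (I : {mpoly F[n]} -> Prop) : is_ideal I -> subsp I.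
Proof.
by case=> I0 ID IM; split=> // c u v Iu Iv; apply: ID => //; rewrite -mul_mpolyC; apply: IM.
Qed.

Lemma scale_monomial (A : comNzRingType) (g u v t : A) m k : (k <= m)%N ->
  g * (u * t) ^+ k * (v * t) ^+ (m - k) = t ^+ m * (g * u ^+ k * v ^+ (m - k)).
Proof. by move=> km; rewrite !exprMn -{3}(subnKC km) exprD; ring. Qed.

Section Subst.
Variables (F : fieldType).
Local Notation R := {mpoly F[4]}.
Local Notation x0 := (x0 F). Local Notation x1 := (x1 F).
Local Notation y0 := (y0 F). Local Notation y1 := (y1 F).
Local Notation pt := (F * F)%type.

Lemma mpoly4_ind (K : R -> Prop) :
  (forall c, K c%:MP) -> (forall f g, K f -> K g -> K (f + g)) ->
  (forall f, K f -> K (x0 * f)) -> (forall f, K f -> K (x1 * f)) ->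
  (forall f, K f -> K (y0 * f)) -> (forall f, K f -> K (y1 * f)) -> forall f, K f.
Proof.
move=> KC KD K0 K1 K2 K3; apply: mpoly_var_ind => //.
by apply: ord4_ind => f; [apply: K0|apply: K1|apply: K2|apply: K3].
Qed.

Definition sub4 (S : comNzRingType) (h : {rmorphism F -> S}) (p0 p1 p2 p3 : S)
  : R -> S := mmap h (fun i : 'I_4 => [:: p0; p1; p2; p3]`_i).

HB.instance Definition _ S h p0 p1 p2 p3 :=
  GRing.RMorphism.copy (@sub4 S h p0 p1 p2 p3)
    (mmap h (fun i : 'I_4 => [:: p0; p1; p2; p3]`_i)).

Section SubE.
Variables (S : comNzRingType) (h : {rmorphism F -> S}) (p0 p1 p2 p3 : S).
Local Notation sub := (sub4 h p0 p1 p2 p3).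

Lemma sub4C c : sub c%:MP = h c. Proof. exact: mmapC. Qed.
Lemma sub4Z c f : sub (c *: f) = h c * sub f. Proof. exact: mmapZ. Qed.
Lemma sub4x0 : sub x0 = p0. Proof. by rewrite /sub4 mmapX mmap1U inordK. Qed.
Lemma sub4x1 : sub x1 = p1. Proof. by rewrite /sub4 mmapX mmap1U inordK. Qed.
Lemma sub4y0 : sub y0 = p2. Proof. by rewrite /sub4 mmapX mmap1U inordK. Qed.
Lemma sub4y1 : sub y1 = p3. Proof. by rewrite /sub4 mmapX mmap1U inordK. Qed.

End SubE.

Definition sub4E := (sub4C, sub4Z, sub4x0, sub4x1, sub4y0, sub4y1).

Definition subR (p0 p1 p2 p3 : R) : R -> R := sub4 (@mpolyC 4 F) p0 p1 p2 p3.
HB.instance Definition _ p0 p1 p2 p3 :=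
  GRing.RMorphism.copy (subR p0 p1 p2 p3) (sub4 (@mpolyC 4 F) p0 p1 p2 p3).

Lemma subRZ p0 p1 p2 p3 c f : subR p0 p1 p2 p3 (c *: f) = c *: subR p0 p1 p2 p3 f.
Proof. by rewrite /subR sub4Z mul_mpolyC. Qed.

Lemma subRC p0 p1 p2 p3 c : subR p0 p1 p2 p3 c%:MP = c%:MP.
Proof. by rewrite /subR sub4C. Qed.

Lemma subRvar p0 p1 p2 p3 (f := subR p0 p1 p2 p3) :
  (f x0 = p0) * (f x1 = p1) * (f y0 = p2) * (f y1 = p3).
Proof. by rewrite /f /subR !sub4E. Qed.

Definition subRE := (subRC, subRZ, subRvar).

Lemma mor_congr (phi psi : {rmorphism R -> R}) (K : R -> Prop) : is_ideal K ->
  (forall c, phi c%:MP = psi c%:MP) -> K (phi x0 - psi x0) -> K (phi x1 - psi x1) ->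
  K (phi y0 - psi y0) -> K (phi y1 - psi y1) -> forall f, K (phi f - psi f).
Proof.
move=> [K0 KD KM] eC k0 k1 k2 k3.
have step z f : K (phi z - psi z) -> K (phi f - psi f) ->
    K (phi (z * f) - psi (z * f)).
  move=> Kz Kf; rewrite !rmorphM.
  have -> : phi z * phi f - psi z * psi f =
    phi f * (phi z - psi z) + psi z * (phi f - psi f) by ring.
  by apply: KD; apply: KM.
apply: mpoly4_ind => [c|f g Kf Kg|f|f|f|f]; try exact: step.
  by rewrite eC subrr.
by rewrite !rmorphD opprD addrACA; apply: KD.
Qed.

Definition nzpt (a : pt) := (a.1 != 0) || (a.2 != 0).
Definition dpeq (a a' : pt) := peq a.1 a.2 a'.1 a'.2.
Definition Lx (a : pt) : R := a.2 *: x0 - a.1 *: x1.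
Definition My (b : pt) : R := b.2 *: y0 - b.1 *: y1.

(* [dual a] is a linear form equal to 1 at [a], and [compl a] a vector on which
   the form vanishing at [a] is 1; the identity of the plane is
   [dual a * a + form a * compl a]. *)
Definition dual (a : pt) : pt := if a.2 != 0 then (0, a.2^-1) else (a.1^-1, 0).
Definition compl (a : pt) : pt := if a.2 != 0 then (a.2^-1, 0) else (0, - a.1^-1).

Lemma dualP a : nzpt a ->
  [/\ (dual a).1 * a.1 + (dual a).2 * a.2 = 1,
      a.1 * (dual a).1 + (compl a).1 * a.2 = 1,
      a.1 * (dual a).2 = (compl a).1 * a.1,
      a.2 * (dual a).1 = - ((compl a).2 * a.2) &
      a.2 * (dual a).2 - (compl a).2 * a.1 = 1] /\
  a.2 * (compl a).1 - a.1 * (compl a).2 = 1.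
Proof.
case: a => a1 a2; rewrite /nzpt /dual /compl /=.
by case: (eqVneq a2 0) => [->|nz _] /=; rewrite ?orbF => *; do !split; field.
Qed.

Definition lform (u : pt) (p q : R) := u.1 *: p + u.2 *: q.
Definition lamx a := lform (dual a) x0 x1.
Definition muy b := lform (dual b) y0 y1.

Lemma plane_decomp a (p q : R) : nzpt a ->
  p = a.1 *: lform (dual a) p q + (compl a).1 *: (a.2 *: p - a.1 *: q) /\
  q = a.2 *: lform (dual a) p q + (compl a).2 *: (a.2 *: p - a.1 *: q).
Proof.
move=> /dualP [[_ e1 e2 e3 e4] _].
have E u v w z : u *: lform (dual a) p q + v *: (w *: p - z *: q) =
   (u * (dual a).1 + v * w) *: p + (u * (dual a).2 - v * z) *: q.
  by rewrite /lform scalerDr scalerBr !scalerA addrACA -scalerDl -scalerBl.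
by split; rewrite E; [rewrite e1 e2|rewrite e3 e4]; rewrite ?subrr ?addNr scale1r scale0r ?addr0 ?add0r.
Qed.

Definition evpt (a b : pt) : R -> F := sub4 idfun a.1 a.2 b.1 b.2.
HB.instance Definition _ a b :=
  GRing.RMorphism.copy (evpt a b) (sub4 idfun a.1 a.2 b.1 b.2).

Lemma evptE a b : (forall c, evpt a b c%:MP = c) * (forall c f, evpt a b (c *: f) = c * evpt a b f)
  * (evpt a b x0 = a.1) * (evpt a b x1 = a.2) * (evpt a b y0 = b.1) * (evpt a b y1 = b.2).
Proof. by rewrite /evpt; do !split; move=> *; rewrite !sub4E. Qed.

Lemma evpt_neq0 a b f : evpt a b f != 0 -> f != 0.
Proof. by apply: contraNneq => ->; rewrite rmorph0. Qed.

Lemma Lx_neq0 a : nzpt a -> Lx a != 0.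
Proof.
move=> /dualP [_ e]; apply: (@evpt_neq0 (compl a) (0, 0)).
by rewrite /Lx rmorphB /= !evptE e oner_neq0.
Qed.

Lemma lamx_neq0 a : nzpt a -> lamx a != 0.
Proof.
move=> /dualP [[e _ _ _ _] _]; apply: (@evpt_neq0 a (0, 0)).
by rewrite /lamx rmorphD /= !evptE e oner_neq0.
Qed.

Lemma muy_neq0 b : nzpt b -> muy b != 0.
Proof.
move=> /dualP [[e _ _ _ _] _]; apply: (@evpt_neq0 (0, 0) b).
by rewrite /muy rmorphD /= !evptE e oner_neq0.
Qed.

(** Projection of the plane of x0, x1 onto the line spanned by [a]. For nonzero [a] it realises
    R/(L_a) inside the domain R, with kernel (L_a); [psiy] does the same for the y variables. *)
Definition psix a := subR (a.1 *: lamx a) (a.2 *: lamx a) y0 y1.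
Definition psiy b := subR x0 x1 (b.1 *: muy b) (b.2 *: muy b).
HB.instance Definition _ a := GRing.RMorphism.copy (psix a) (subR (a.1 *: lamx a) (a.2 *: lamx a) y0 y1).
HB.instance Definition _ b := GRing.RMorphism.copy (psiy b) (subR x0 x1 (b.1 *: muy b) (b.2 *: muy b)).

Definition dvdR (D f : R) := exists g, f = D * g.

Lemma dvdR_ideal D : is_ideal (dvdR D).
Proof.
split=> [|_ _ [g ->] [h ->]|r _ [g ->]]; first by exists 0; rewrite mulr0.
  by exists (g + h); rewrite mulrDr.
by exists (r * g); rewrite mulrCA.
Qed.

Lemma dvdR_scale D c : dvdR D (c *: D).
Proof. by exists c%:MP; rewrite mulrC mul_mpolyC. Qed.

Lemma psix_congr a f : nzpt a -> dvdR (Lx a) (f - psix a f).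
Proof.
move=> nz; have [e0 e1] := plane_decomp x0 x1 nz.
rewrite -/(lamx a) -/(Lx a) in e0 e1.
have [d0 dD dM] := dvdR_ideal (Lx a).
apply: (mor_congr (phi := idfun) (psi := psix a)) => //= [c||||];
  rewrite /psix ?subRE ?subrr //.
  by rewrite {1}e0 addrAC subrr add0r; apply: dvdR_scale.
by rewrite {1}e1 addrAC subrr add0r; apply: dvdR_scale.
Qed.

Lemma psiy_congr b f : nzpt b -> dvdR (My b) (f - psiy b f).
Proof.
move=> nz; have [e0 e1] := plane_decomp y0 y1 nz.
rewrite -/(muy b) -/(My b) in e0 e1.
have [d0 dD dM] := dvdR_ideal (My b).
apply: (mor_congr (phi := idfun) (psi := psiy b)) => //= [c||||];
  rewrite /psiy ?subRE ?subrr //.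
  by rewrite {1}e0 addrAC subrr add0r; apply: dvdR_scale.
by rewrite {1}e1 addrAC subrr add0r; apply: dvdR_scale.
Qed.

Lemma psix_Lx a a' : psix a (Lx a') = (a'.2 * a.1 - a'.1 * a.2) *: lamx a.
Proof. by rewrite /psix /Lx rmorphB /= !subRE !scalerA -scalerBl. Qed.

Lemma psix_My a b : psix a (My b) = My b.
Proof. by rewrite /psix /My rmorphB /= !subRE. Qed.

Lemma psiy_My b b' : psiy b (My b') = (b'.2 * b.1 - b'.1 * b.2) *: muy b.
Proof. by rewrite /psiy /My rmorphB /= !subRE !scalerA -scalerBl. Qed.

Lemma psiy_My_id b : psiy b (My b) = 0.
Proof. by rewrite psiy_My [b.2 * _]mulrC subrr scale0r. Qed.

Lemma psix_Lx_id a : psix a (Lx a) = 0.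
Proof. by rewrite psix_Lx [a.2 * _]mulrC subrr scale0r. Qed.

Lemma psiy_lformx b u : psiy b (lform u x0 x1) = lform u x0 x1.
Proof. by rewrite /psiy /lform rmorphD /= !subRE. Qed.

Lemma dvd_My b f : nzpt b -> dvdR (My b) f <-> psiy b f = 0.
Proof.
move=> nz; split=> [[g ->]|f0]; last by have := psiy_congr f nz; rewrite f0 subr0.
by rewrite rmorphM /= psiy_My_id mul0r.
Qed.

Lemma My_prime b c f : nzpt b -> psiy b c != 0 -> dvdR (My b) (c * f) -> dvdR (My b) f.
Proof.
move=> nz nzc /(dvd_My _ nz); rewrite rmorphM /= => /eqP; rewrite mulf_eq0 (negbTE nzc).
by move/eqP => /(dvd_My _ nz).
Qed.

Definition prodMy (s : seq pt) : R := \prod_(t <- s) My t.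

Lemma My_neq0 b : nzpt b -> My b != 0.
Proof.
move=> /dualP [_ e]; apply: (@evpt_neq0 (0, 0) (compl b)).
by rewrite /My rmorphB /= !evptE e oner_neq0.
Qed.

(** Each M_b is prime, because R/(M_b) embeds in R through [psiy b], and [c] is not in (M_b); the
    factors are split off one at a time, repetitions included. *)
Lemma prodMy_coprime s c f : (forall b, b \in s -> nzpt b /\ psiy b c != 0) ->
  dvdR (prodMy s) (c * f) -> dvdR (prodMy s) f.
Proof.
elim: s f => [|b s IH] f Hs; first by exists f; rewrite /prodMy big_nil mul1r.
rewrite /prodMy big_cons -/(prodMy s) => -[g Eg].
have [nzb nzc] := Hs b (mem_head _ _).
have [|h Eh] := My_prime (f := f) nzb nzc; first by exists (prodMy s * g); rewrite mulrA.
have Hs' b' : b' \in s -> nzpt b' /\ psiy b' c != 0.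
  by move=> b's; apply: Hs; rewrite in_cons b's orbT.
have [|k Ek] := IH h Hs'; last by exists k; rewrite Eh Ek mulrA.
by exists g; apply: (mulfI (My_neq0 nzb)); rewrite mulrCA -Eh Eg mulrA.
Qed.

Lemma dpeq_sym a b : dpeq a b = dpeq b a.
Proof. by rewrite /dpeq /peq eq_sym mulrC [X in _ == X]mulrC. Qed.

Lemma psiy_My_neq0 b b' : nzpt b -> ~~ dpeq b b' -> psiy b (My b') != 0.
Proof.
move=> nz; rewrite psiy_My /dpeq /peq -mul_mpolyC mulf_eq0 negb_or muy_neq0 // andbT.
by rewrite mpolyC_eq0 subr_eq0 mulrC [X in _ == X]mulrC.
Qed.

Lemma psix_Lx_neq0 a a' : nzpt a -> ~~ dpeq a a' -> psix a (Lx a') != 0.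
Proof.
move=> nz; rewrite psix_Lx /dpeq /peq -mul_mpolyC mulf_eq0 negb_or lamx_neq0 // andbT.
by rewrite mpolyC_eq0 subr_eq0 mulrC [X in _ == X]mulrC.
Qed.

Definition inpow (a b : pt) m (f : R) :=
  exists g : nat -> R, f = \sum_(k < m.+1) g k * Lx a ^+ k * My b ^+ (m - k).

Section Pow.
Variables a b : pt.
Local Notation inpow := (inpow a b).

Lemma inpow_ideal m : is_ideal (inpow m).
Proof.
split=> [|_ _ [g ->] [h ->]|r _ [g ->]].
- by exists (fun _ => 0); rewrite big1 // => k _; rewrite !mul0r.
- exists (fun k => g k + h k); rewrite -big_split; apply: eq_bigr => k _ /=.
  by rewrite !mulrDl.
exists (fun k => r * g k); rewrite mulr_sumr; apply: eq_bigr => k _.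
by rewrite !mulrA.
Qed.

Lemma inpow0 f : inpow 0 f.
Proof. by exists (fun _ => f); rewrite big_ord1 !expr0 !mulr1. Qed.

Lemma inpowL m f : inpow m f -> inpow m.+1 (Lx a * f).
Proof.
case=> g ->; exists (fun k => if k is k'.+1 then g k' else 0).
rewrite [RHS]big_ord_recl !mul0r add0r mulr_sumr; apply: eq_bigr => k _ /=.
by rewrite exprS subSS; ring.
Qed.

Lemma inpowM m f : inpow m f -> inpow m.+1 (My b * f).
Proof.
case=> g ->; exists (fun k => if (k <= m)%N then g k else 0).
rewrite [RHS]big_ord_recr /= ltnn !mul0r addr0 mulr_sumr; apply: eq_bigr => k _ /=.
by rewrite -ltnS ltn_ord subSn -1?ltnS // exprS; ring.
Qed.

Lemma inpow_mon k l f : inpow (k + l) (f * Lx a ^+ k * My b ^+ l).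
Proof.
elim: k => [|k IH].
  elim: l => [|l IH]; first exact: inpow0.
  by move/inpowM: IH; rewrite add0n exprS; congr inpow; ring.
by move/inpowL: IH; rewrite addSn exprS; congr inpow; ring.
Qed.

Lemma inpowS m f : inpow m.+1 f -> inpow m f.
Proof.
case=> g ->; have sI := ideal_subsp (inpow_ideal m).
apply: subsp_sum => // -[[|k] /= ltk] _.
  rewrite subn0 exprS; have := inpow_mon 0 m (g 0%N * My b).
  by rewrite add0n; congr inpow; ring.
rewrite subSS exprS; have := inpow_mon k (m - k) (g k.+1 * Lx a).
by rewrite subnKC //; congr inpow; ring.
Qed.

Lemma inpow_le m n f : (m <= n)%N -> inpow n f -> inpow m f.
Proof.
by move/subnK <-; elim: (n - m)%N => // k IH /inpowS.
Qed.

(* Scaling the coordinates transversal to the point by ['X] turns the order of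
   vanishing into an ['X]-adic valuation. *)
Definition phi : R -> {poly R} := sub4 (polyC \o @mpolyC 4 F)
  ((a.1 *: lamx a)%:P + ((compl a).1 *: Lx a)%:P * 'X)
  ((a.2 *: lamx a)%:P + ((compl a).2 *: Lx a)%:P * 'X)
  ((b.1 *: muy b)%:P + ((compl b).1 *: My b)%:P * 'X)
  ((b.2 *: muy b)%:P + ((compl b).2 *: My b)%:P * 'X).
HB.instance Definition _ := GRing.RMorphism.copy phi (sub4 (polyC \o @mpolyC 4 F)
  ((a.1 *: lamx a)%:P + ((compl a).1 *: Lx a)%:P * 'X)
  ((a.2 *: lamx a)%:P + ((compl a).2 *: Lx a)%:P * 'X)
  ((b.1 *: muy b)%:P + ((compl b).1 *: My b)%:P * 'X)
  ((b.2 *: muy b)%:P + ((compl b).2 *: My b)%:P * 'X)).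

Lemma phiD f g : phi (f + g) = phi f + phi g. Proof. exact: rmorphD. Qed.
Lemma phiM f g : phi (f * g) = phi f * phi g. Proof. exact: rmorphM. Qed.
Lemma phiC c : phi c%:MP = c%:MP%:P. Proof. exact: sub4C. Qed.
Lemma phix0 : phi x0 = (a.1 *: lamx a)%:P + ((compl a).1 *: Lx a)%:P * 'X.
Proof. exact: sub4x0. Qed.
Lemma phix1 : phi x1 = (a.2 *: lamx a)%:P + ((compl a).2 *: Lx a)%:P * 'X.
Proof. exact: sub4x1. Qed.
Lemma phiy0 : phi y0 = (b.1 *: muy b)%:P + ((compl b).1 *: My b)%:P * 'X.
Proof. exact: sub4y0. Qed.
Lemma phiy1 : phi y1 = (b.2 *: muy b)%:P + ((compl b).2 *: My b)%:P * 'X.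
Proof. exact: sub4y1. Qed.
Lemma phiXn f n : phi (f ^+ n) = phi f ^+ n. Proof. exact: rmorphXn. Qed.
Lemma phi_sum n (h : 'I_n -> R) : phi (\sum_k h k) = \sum_k phi (h k).
Proof. exact: rmorph_sum. Qed.
Lemma phiB f g : phi (f - g) = phi f - phi g. Proof. exact: rmorphB. Qed.
Lemma phiZ c f : phi (c *: f) = c%:MP%:P * phi f. Proof. exact: sub4Z. Qed.

(** Under [phi] a variable acquires ['X] only together with a factor L_a or M_b, so each power of
    ['X] is accompanied by a power of the point ideal. *)
Lemma phi_coef f k : inpow k (phi f)`_k.
Proof.
have stepx c d g : (forall k, inpow k (phi g)`_k) ->
    forall k, inpow k ((c%:P + (d *: Lx a)%:P * 'X) * phi g)`_k.
  move=> Hg n; case: (inpow_ideal n) => _ ID IM.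
  rewrite mulrDl coefD -mulrA !coefCM coefXM; apply: ID; first exact: IM.
  case: n {IM} => [|n] /=; first exact: inpow0.
  by rewrite -mul_mpolyC -mulrA; case: (inpow_ideal n.+1) => _ _; apply; apply: inpowL.
have stepy c d g : (forall k, inpow k (phi g)`_k) ->
    forall k, inpow k ((c%:P + (d *: My b)%:P * 'X) * phi g)`_k.
  move=> Hg n; case: (inpow_ideal n) => _ ID IM.
  rewrite mulrDl coefD -mulrA !coefCM coefXM; apply: ID; first exact: IM.
  case: n {IM} => [|n] /=; first exact: inpow0.
  by rewrite -mul_mpolyC -mulrA; case: (inpow_ideal n.+1) => _ _; apply; apply: inpowM.
move: f k; apply: mpoly4_ind => [c k|f g Hf Hg k|f Hf|f Hf|f Hf|f Hf].
- rewrite phiC coefC; case: k => [|k]; first exact: inpow0.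
  by case: (inpow_ideal k.+1).
- rewrite phiD coefD; case: (inpow_ideal k) => _ ID _.
  exact: ID (Hf k) (Hg k).
- by rewrite phiM phix0; apply: stepx.
- by rewrite phiM phix1; apply: stepx.
- by rewrite phiM phiy0; apply: stepy.
- by rewrite phiM phiy1; apply: stepy.
Qed.

Hypotheses (nza : nzpt a) (nzb : nzpt b).

Lemma phi_at1 f : (phi f).[1] = f.
Proof.
have K0 : is_ideal (fun f : R => f = 0).
  by split=> // [_ _ -> ->|r _ ->]; rewrite ?addr0 ?mulr0.
apply/eqP; rewrite -subr_eq0; apply/eqP.
have [e0 e1] := plane_decomp x0 x1 nza; have [e2 e3] := plane_decomp y0 y1 nzb.
apply: (mor_congr (phi := horner_eval (1 : R) \o phi) (psi := idfun) K0) => [c||||] /=.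
- by rewrite phiC /horner_eval hornerC.
- by rewrite phix0 /horner_eval !hornerE -e0 subrr.
- by rewrite phix1 /horner_eval !hornerE -e1 subrr.
- by rewrite phiy0 /horner_eval !hornerE -e2 subrr.
- by rewrite phiy1 /horner_eval !hornerE -e3 subrr.
Qed.

Lemma phi_Lx : phi (Lx a) = (Lx a)%:P * 'X.
Proof.
have [_ e] := dualP nza.
rewrite {1}/Lx phiB !phiZ phix0 phix1 -!mul_mpolyC !polyCM.
rewrite -[RHS]mul1r -[in RHS]polyC1 -[in RHS]mpolyC1 -[in RHS]e.
by rewrite !(polyCB, mpolyCB, mpolyCM, polyCM); ring.
Qed.

Lemma phi_My : phi (My b) = (My b)%:P * 'X.
Proof.
have [_ e] := dualP nzb.
rewrite {1}/My phiB !phiZ phiy0 phiy1 -!mul_mpolyC !polyCM.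
rewrite -[RHS]mul1r -[in RHS]polyC1 -[in RHS]mpolyC1 -[in RHS]e.
by rewrite !(polyCB, mpolyCB, mpolyCM, polyCM); ring.
Qed.

(** If ['X^m] divides [phi f], evaluation at 1 writes f as a sum of coefficients of index at least
    m, all in the m-th power. Conversely [phi] multiplies both L_a and M_b by ['X]. *)
Lemma inpow_phi m f : inpow m f <-> exists g, phi f = 'X^m * g.
Proof.
split=> [[g ->]|[g Eg]].
  exists (\sum_(k < m.+1) phi (g k) * (Lx a)%:P ^+ k * (My b)%:P ^+ (m - k)).
  rewrite phi_sum mulr_sumr; apply: eq_bigr => -[k lek] _ /=.
  rewrite 2!phiM 2!phiXn phi_Lx phi_My.
  exact: scale_monomial.
rewrite -[f]phi_at1 horner_coef; apply: (subsp_sum (ideal_subsp (inpow_ideal m))).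
move=> k _; rewrite expr1n mulr1; move: (nat_of_ord k) => {}k.
case: (leqP m k) => [lemk|ltkm]; first by apply: inpow_le (phi_coef f k).
by rewrite Eg coefXnM ltkm; case: (inpow_ideal m).
Qed.

Lemma Xn_dvd_cancel (A : idomainType) (p q g : {poly A}) m : p`_0 != 0 ->
  p * q = 'X^m * g -> exists g', q = 'X^m * g'.
Proof.
move=> nz; elim: m q => [|m IH] q E; first by exists q; rewrite expr0 mul1r.
have q0 : root q 0.
  have := congr1 (fun r : {poly A} => r`_0) E.
  rewrite coef0M coefXnM /= => /eqP; rewrite mulf_eq0 (negbTE nz) /=.
  by rewrite /root horner_coef0.
have [r Er] := factor_theorem _ _ q0; rewrite subr0 in Er.
have [|g' Eg'] := IH r.
  by apply: (mulIf (negbT (polyX_eq0 A))); rewrite -mulrA -Er E exprS; ring.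
by exists g'; rewrite Er Eg' exprS; ring.
Qed.

(** The powers of a point ideal are primary: a factor [c] with nonzero constant coefficient has
    ['X]-adic order 0 and can be cancelled. *)
Lemma inpow_cancel m c f : (phi c)`_0 != 0 -> inpow m (c * f) -> inpow m f.
Proof.
move=> nz /inpow_phi [g]; rewrite phiM => /(Xn_dvd_cancel nz) Eg.
exact/inpow_phi.
Qed.

(** L_a has order exactly one. For m = 0 the predecessor is again 0 and there is no condition. *)
Lemma inpow_colonL m f : inpow m (Lx a * f) -> inpow m.-1 f.
Proof.
case: m => [_|m]; first exact: inpow0.
move=> /inpow_phi [g]; rewrite phiM phi_Lx exprS => E.
apply/inpow_phi; apply: (@Xn_dvd_cancel _ (Lx a)%:P _ g).
  by rewrite coefC Lx_neq0.
by apply: (mulIf (negbT (polyX_eq0 _))); rewrite mulrAC E; ring.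
Qed.

Lemma phi_coef0 f : (phi f)`_0 =
  subR (a.1 *: lamx a) (a.2 *: lamx a) (b.1 *: muy b) (b.2 *: muy b) f.
Proof.
have K0 : is_ideal (fun f : R => f = 0).
  by split=> // [_ _ -> ->|r _ ->]; rewrite ?addr0 ?mulr0.
rewrite -horner_coef0; apply/eqP; rewrite -subr_eq0; apply/eqP.
apply: (mor_congr (phi := horner_eval (0 : R) \o phi)
  (psi := subR (a.1 *: lamx a) (a.2 *: lamx a) (b.1 *: muy b) (b.2 *: muy b)) K0)
  => [c||||] /=; rewrite ?phiC ?phix0 ?phix1 ?phiy0 ?phiy1 subRE /horner_eval ?hornerE ?mulr0 ?addr0 ?subrr //.
Qed.

Lemma phi_Lx_coef0 a' : ~~ dpeq a a' -> (phi (Lx a'))`_0 != 0.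
Proof.
move=> ne; rewrite phi_coef0 {1}/Lx rmorphB /= !subRE !scalerA -scalerBl.
by have := psix_Lx_neq0 nza ne; rewrite psix_Lx.
Qed.

Lemma inpow_cancelL m a' f : ~~ dpeq a a' -> inpow m (Lx a' * f) -> inpow m f.
Proof. by move=> ne; apply: inpow_cancel; apply: phi_Lx_coef0. Qed.

Lemma inpow_psix m f : inpow m f -> dvdR (My b ^+ m) (psix a f).
Proof.
case=> g ->; exists (psix a (g 0%N)).
rewrite big_ord_recl rmorphD rmorph_sum big1 => [|k _]; last first.
  by rewrite !rmorphM !rmorphXn /= psix_Lx_id expr0n mulr0 mul0r.
by rewrite subn0 expr0 mulr1 addr0 rmorphM rmorphXn /= psix_My mulrC.
Qed.

End Pow.

End Subst.

(** * Fat point ideals and removal of a line *)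

Section Ideals.
Variables (F : fieldType).
Local Notation R := {mpoly F[4]}.
Local Notation pt := (F * F)%type.

Definition ideal_add (K : R -> Prop) (p f : R) := exists h u, K h /\ f = h + p * u.

Lemma ideal_addP (K : R -> Prop) p : is_ideal K -> is_ideal (ideal_add K p).
Proof.
move=> [K0 KD KM]; split=> [|_ _ [h [u [Kh ->]]] [h' [u' [Kh' ->]]]|r _ [h [u [Kh ->]]]].
- by exists 0, 0; rewrite mulr0 addr0.
- by exists (h + h'), (u + u'); rewrite mulrDr addrACA; split=> //; apply: KD.
by exists (r * h), (r * u); rewrite mulrDr mulrCA; split=> //; apply: KM.
Qed.

Lemma ideal_add_sub (K : R -> Prop) p f : K f -> ideal_add K p f.
Proof. by move=> Kf; exists f, 0; rewrite mulr0 addr0. Qed.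

Lemma ideal_add_gen (K : R -> Prop) p f : is_ideal K -> ideal_add K p (p * f).
Proof. by case=> K0 _ _; exists 0, f; rewrite add0r. Qed.

Definition ideal2 (p q : R) := ideal_add (dvdR p) q.

Lemma ideal2_ideal p q : is_ideal (ideal2 p q).
Proof. exact: ideal_addP (dvdR_ideal p). Qed.

Lemma ideal2l p q f : ideal2 p q (p * f).
Proof. by apply: ideal_add_sub; exists f. Qed.

Lemma ideal2r p q f : ideal2 p q (q * f).
Proof. exact: ideal_add_gen (dvdR_ideal p). Qed.

Lemma psix_prodMy (a : pt) s : psix a (prodMy s) = prodMy s.
Proof. by rewrite /prodMy rmorph_prod; apply: eq_bigr => t _; apply: psix_My. Qed.

Lemma psiy_prodMy_neq0 (b : pt) s : nzpt b -> (forall t, t \in s -> ~~ dpeq b t) ->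
  psiy b (prodMy s) != 0.
Proof.
move=> nz Hs; rewrite /prodMy rmorph_prod /=.
by rewrite prodf_seq_neq0; apply/allP => t ts /=; apply: psiy_My_neq0 => //; apply: Hs.
Qed.

Lemma ideal2_psix (a : pt) s f : nzpt a ->
  ideal2 (Lx a) (prodMy s) f <-> dvdR (prodMy s) (psix a f).
Proof.
move=> nz; split=> [[_ [v [[u ->] ->]]]|[g E]].
  by exists (psix a v); rewrite rmorphD !rmorphM /= psix_Lx_id mul0r add0r psix_prodMy.
have [u Eu] := psix_congr f nz.
by exists (Lx a * u), g; split; [exists u | rewrite -Eu -E subrK].
Qed.

(** * Regularity modulo a complete intersection (L_a, D) *)

Section CompleteIntersection.
Variables (a c d : pt) (s : seq pt).
Hypotheses (nza : nzpt a) (ac : ~~ dpeq a c).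
Hypotheses (nzs : forall t, t \in s -> nzpt t) (sd : forall t, t \in s -> ~~ dpeq t d).

(** On the line L_a = 0 the form L_c restricts to a nonzero multiple of [lamx a], which involves no
    y and so shares no factor with D. *)
Lemma ideal2_cancelL f :
  ideal2 (Lx a) (prodMy s) (Lx c * f) -> ideal2 (Lx a) (prodMy s) f.
Proof.
move=> /ideal2_psix - /(_ nza); rewrite rmorphM /= => H.
apply/ideal2_psix => //; apply: prodMy_coprime H => t ts; split; first exact: nzs.
have := psix_Lx_neq0 nza ac; rewrite psix_Lx /psiy subRZ -/(psiy t) /lamx.
by rewrite -/(psiy t _) psiy_lformx.
Qed.

(** Since a and c are different points, (L_a, L_c) = (x0, x1) and the quotient is k[y0,y1]/(D),
    where M_d is coprime to D. The substitution [psi0] is the passage to k[y0,y1]. *)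
Lemma ideal3_cancelM g :
  ideal_add (ideal2 (Lx a) (prodMy s)) (Lx c) (My d * g) ->
  ideal_add (ideal2 (Lx a) (prodMy s)) (Lx c) g.
Proof.
move=> [_ [w [[_ [v [[u ->] ->]]] E]]].
pose psi0 : {rmorphism R -> R} := subR (0 : R) 0 (y0 F) (y1 F).
have p0E : psi0 =1 subR (0 : R) 0 (y0 F) (y1 F) by [].
have p0L e : psi0 (Lx e) = 0 by rewrite /Lx rmorphB !p0E !subRE !scaler0 subrr.
have p0M e : psi0 (My e) = My e by rewrite /My rmorphB !p0E !subRE.
have p0D : psi0 (prodMy s) = prodMy s.
  by rewrite /prodMy rmorph_prod; apply: eq_bigr => t _; apply: p0M.
have K2 := ideal2_ideal (Lx a) (prodMy s).
have [K0 KD KM] := ideal_addP (Lx c) K2.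
have [k Ek] : dvdR (prodMy s) (psi0 g).
  apply: (@prodMy_coprime _ s (My d)).
    by move=> t ts; split; [exact: nzs | apply: psiy_My_neq0; [exact: nzs | exact: sd]].
  exists (psi0 v); have := congr1 psi0 E.
  by rewrite !rmorphD !rmorphM !p0L p0M p0D !mul0r add0r addr0.
rewrite -(subrK (psi0 g) g); apply: KD; last first.
  by rewrite Ek; apply: ideal_add_sub; apply: ideal2r.
set K := ideal_add _ _ in K0 KM *.
have KL : K (Lx a) by rewrite -[Lx a]mulr1; apply: ideal_add_sub; apply: ideal2l.
have sK := ideal_subsp (ideal_addP (Lx c) K2).
have Klam : K (lamx a).
  have nz : c.2 * a.1 - c.1 * a.2 != 0.
    by move: ac; rewrite /dpeq /peq subr_eq0 mulrC [X in _ == X]mulrC.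
  rewrite -[lamx a](scalerK nz); apply: subspZ => //; rewrite -psix_Lx.
  have [u' Eu] := psix_congr (Lx c) nza.
  rewrite -[psix _ _](subKr (Lx c)) Eu mulrC; apply: subspB; [by []| |exact: KM].
  by rewrite -[Lx c]mulr1; apply: ideal_add_gen.
have [e0 e1] := plane_decomp (x0 F) (x1 F) nza.
apply: (mor_congr (phi := idfun) (psi := psi0) (ideal_addP (Lx c) K2)) => [e||||] /=;
  rewrite ?subRE ?subrr // subr0.
- by rewrite e0; apply: subspD => //; apply: subspZ.
- by rewrite e1; apply: subspD => //; apply: subspZ.
Qed.

End CompleteIntersection.

Section Scheme.
Variables (I J : finType) (a : I -> pt) (b : J -> pt).
Hypotheses (nza : forall i, nzpt (a i)) (nzb : forall j, nzpt (b j)).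
Hypotheses (da : forall i i', i != i' -> ~~ dpeq (a i) (a i')).
Hypotheses (db : forall j j', j != j' -> ~~ dpeq (b j) (b j')).
Implicit Type m : I -> J -> nat.

Definition Im m f := forall i j, inpow (a i) (b j) (m i j) f.

Lemma Im_ideal m : is_ideal (Im m).
Proof.
split=> [i j|f g Hf Hg i j|r f Hf i j]; case: (inpow_ideal (a i) (b j) (m i j)) => H0 HD HM.
- exact: H0.
- exact: HD.
exact: HM.
Qed.

(** The divisor D of the row, kept as a list with repetitions: inductions remove one linear factor
    at a time, and [size] is the degree of D. *)
Definition rowseq m i : seq pt := flatten [seq nseq (m i j) (b j) | j <- enum J].
Definition decr m i0 i j := if i == i0 then (m i j).-1 else m i j.

(** L_i has order one at the points of its own row and order zero at all others, where it
    cancels. *)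
Lemma Im_colon m i f : Im m (Lx (a i) * f) <-> Im (decr m i) f.
Proof.
split=> H i' j; have {}H := H i' j.
  rewrite /decr; case: eqVneq H => [->|ne]; first exact: inpow_colonL.
  by apply: inpow_cancelL => //; apply: da.
move: H; rewrite /decr; case: eqVneq => [->|ne] H.
  case: (m i j) H => [|k] H; [exact: inpow0 | exact: inpowL].
by case: (inpow_ideal (a i') (b j) (m i' j)) => _ _; apply.
Qed.

Lemma Im_cancel m c f : (forall i, ~~ dpeq (a i) c) -> Im m (Lx c * f) -> Im m f.
Proof. by move=> ac H i j; apply: inpow_cancelL (H i j). Qed.

Lemma mem_rowseq m i t : t \in rowseq m i -> exists j, t = b j.
Proof.
case/flatten_mapP => j _; rewrite mem_nseq => /andP [_ /eqP ->].
by exists j.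
Qed.

Lemma size_rowseq m i : size (rowseq m i) = (\sum_j m i j)%N.
Proof.
rewrite size_flatten sumnE /shape -map_comp big_map big_enum /=.
by apply: eq_bigr => j _; rewrite size_nseq.
Qed.

Lemma prodMy_nseq n t : prodMy (nseq n t) = (My t : R) ^+ n.
Proof. by rewrite /prodMy big_nseq iter_mulr_1. Qed.

Lemma prodMy_cat s s' : prodMy (s ++ s') = prodMy s * prodMy s' :> R.
Proof. by rewrite /prodMy big_cat. Qed.

(** On the line of row i, f is divisible by M_j^(m_ij) for each j; these powers are pairwise coprime
    because the columns are distinct, so their product divides. *)
Lemma Im_row m i f : Im m f -> dvdR (prodMy (rowseq m i)) (psix (a i) f).
Proof.
move=> Hf; rewrite /rowseq; have := enum_uniq J.
elim: (enum J) => [|j js IH] /=; first by exists (psix (a i) f); rewrite /prodMy big_nil mul1r.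
case/andP => jjs /IH {IH} [h Eh].
have := inpow_psix (Hf i j); rewrite -prodMy_nseq Eh => /prodMy_coprime.
case=> [t|g Eg]; last by exists g; rewrite Eg prodMy_cat mulrA [prodMy (nseq _ _) * _]mulrC.
rewrite mem_nseq => /andP [_ /eqP ->]; split=> //; apply: psiy_prodMy_neq0 => // t'.
case/flatten_mapP => j' j'js; rewrite mem_nseq => /andP [_ /eqP ->].
by apply: db; apply: contraNneq jjs => ->.
Qed.

Lemma Im_sub_row m i f : Im m f -> ideal2 (Lx (a i)) (prodMy (rowseq m i)) f.
Proof. by move=> /(@Im_row _ i) H; apply/ideal2_psix. Qed.

Lemma prodMy_rowseq m i : prodMy (rowseq m i) = \prod_j My (b j) ^+ m i j :> R.
Proof.
rewrite /prodMy big_flatten big_map big_enum; apply: eq_bigr => j _.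
exact: prodMy_nseq.
Qed.

Lemma dvd_rowseq m i j : dvdR (My (b j) ^+ m i j) (prodMy (rowseq m i)).
Proof. by rewrite prodMy_rowseq (bigD1 j) //=; eexists. Qed.

Lemma inpow_dvdM i j k l f : (k <= l)%N -> dvdR (My (b j) ^+ l) f ->
  inpow (a i) (b j) k f.
Proof.
move=> kl [g ->]; apply: (inpow_le kl).
by have := inpow_mon (a i) (b j) 0 l g; rewrite expr0 mulr1 mulrC.
Qed.

Lemma sum_decr m i : (exists j, m i j != 0%N) ->
  (\sum_i' \sum_j decr m i i' j < \sum_i' \sum_j m i' j)%N.
Proof.
move=> [j nz].
have le i' j' : (decr m i i' j' <= m i' j')%N.
  by rewrite /decr; case: ifP => // _; apply: leq_pred.
rewrite (bigD1 i) // [X in (_ < X)%N](bigD1 i) //= -addSn; apply: leq_add; last first.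
  by apply: leq_sum => i' _; apply: leq_sum => j' _; apply: le.
rewrite (bigD1 j) // [X in (_ < X)%N](bigD1 j) //= -addSn; apply: leq_add; last first.
  by apply: leq_sum => j' _; apply: le.
by rewrite /decr eqxx prednK // lt0n.
Qed.

Definition nested m := forall i i' h h',
  (forall j, (m i j - h <= m i' j - h')%N) \/ (forall j, (m i' j - h' <= m i j - h)%N).

(** Lowering row i shifts its levels: level h of the new row is level h + 1 of the old one. The
    family of truncated rows gains no new member. *)
Lemma nested_decr m i : nested m -> nested (decr m i).
Proof.
have E i' j h : (decr m i i' j - h = m i' j - (h + (i' == i)))%N.
  by rewrite /decr; case: ifP => _ /=; lia.
by move=> N i1 i2 h h'; case: (N i1 i2 (h + (i1 == i)) (h' + (i2 == i)))%N => H;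
  [left|right] => j; rewrite !E.
Qed.

Lemma nested_max_row m (i0 : I) : nested m -> exists i, forall i' j, (m i' j <= m i j)%N.
Proof.
move=> N; case: (@arg_maxnP _ i0 xpredT (fun i => \sum_j m i j)%N isT) => i _ mx.
exists i => i' j; case: (N i i' 0 0)%N => H; last by have := H j; rewrite !subn0.
have {}H j' : (m i j' <= m i' j')%N by have := H j'; rewrite !subn0.
have E : (\sum_j m i j = \sum_j m i' j)%N.
  by apply/eqP; rewrite eqn_leq leq_sum //=; apply: (mx i').
move/eqP: E; rewrite (leqif_sum (fun j _ => leqif_eq (H j))) => /forallP /(_ j).
by move=> /eqP ->.
Qed.

Variables (c d : pt).
Hypotheses (ac : forall i, ~~ dpeq (a i) c) (bd : forall j, ~~ dpeq (b j) d).

(** Second half of the regularity of (l, l') on R/I_m, with l = [Lx c] and l' = [My d]; the first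
    half, for l alone, is [Im_cancel]. *)
Definition regular2 m :=
  forall g, ideal_add (Im m) (Lx c) (My d * g) -> ideal_add (Im m) (Lx c) g.

Lemma nested_regular2 m : nested m -> regular2 m.
Proof.
have [n] := ubnP (\sum_i \sum_j m i j)%N; elim: n m => // n IH m ltn Nm g Hg.
have [all0|] := boolP [forall i, forall j, m i j == 0%N].
  exists g, 0; rewrite mulr0 addr0; split=> // i j.
  by have /forallP /(_ i) /forallP /(_ j) /eqP -> := all0; apply: inpow0.
case/forallPn => i1 /forallPn [j1 nz1].
have [i mxi] := nested_max_row i1 Nm.
have nzi : exists j, m i j != 0%N.
  by exists j1; rewrite -lt0n; apply: leq_trans (mxi i1 j1); rewrite lt0n.
set L := Lx (a i); set D := prodMy (rowseq m i).
have [I0 ID IM] := Im_ideal m; have sI := ideal_subsp (Im_ideal m).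
(* Maximality of row i enters here: D vanishes to order m_ij along all of column j, which is enough
   at the points of every row. *)
have DIm : Im m D by move=> i' j; apply: inpow_dvdM (mxi i' j) (dvd_rowseq m i j).
have nzs t : t \in rowseq m i -> nzpt t by move=> /mem_rowseq [j ->].
have sd t : t \in rowseq m i -> ~~ dpeq t d by move=> /mem_rowseq [j ->].
have [h [u [Ih E]]] := Hg.
(* This writes g = L g2 + D v + l g1, because l' cancels modulo (L, D, l). *)
have [|h1 [g1 [[_ [v [[g2 ->] ->]]] Eg]]] :=
    @ideal3_cancelM (a i) c d (rowseq m i) (nza i) (ac i) nzs sd g.
  by exists h, u; split=> //; apply: Im_sub_row.
rewrite -/L -/D in Eg.
(* Substituting this into l' g = h + l u puts l (u - l' g1) in (L, D), as I_m is contained in (L,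
   D); then l cancels. *)
have [|_ [v2 [[h2 ->] E2]]] :=
    @ideal2_cancelL (a i) c (rowseq m i) (nza i) (ac i) nzs (u - My d * g1).
  have -> : Lx c * (u - My d * g1) = L * (My d * g2) + D * (My d * v) - h.
    by rewrite mulrBr -[Lx c * u](addKr h) -E Eg; ring.
  have s2 := ideal_subsp (ideal2_ideal L D).
  by apply: subspB => //; [apply: subspD => //; [apply: ideal2l|apply: ideal2r] | apply: Im_sub_row].
rewrite -/L -/D in E2.
(* Eliminating g and u leaves a multiple of L that lies in I_m, because h and D do. Dividing by L
   gives l' g2 in the ideal of the lowered scheme plus (l), so the induction hypothesis applies to
   [g2]. *)
have : Im m (L * (My d * g2 - Lx c * h2)).
  have -> : L * (My d * g2 - Lx c * h2) = h + (Lx c * v2 - My d * v) * D.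
    have -> : L * (My d * g2 - Lx c * h2) = My d * (L * g2) - Lx c * (L * h2) by ring.
    have -> : L * g2 = g - D * v - Lx c * g1 by rewrite Eg; ring.
    have -> : L * h2 = u - My d * g1 - D * v2 by rewrite E2; ring.
    by rewrite !mulrBr E; ring.
  by apply: ID => //; apply: IM.
move/Im_colon => H'.
have lt' : (\sum_i' \sum_j decr m i i' j < n)%N.
  have := sum_decr nzi; lia.
have [|h3 [w [Ih3 E3]]] := IH _ lt' (nested_decr i Nm) g2.
  by exists (My d * g2 - Lx c * h2), h2; rewrite subrK.
exists (L * h3 + v * D), (g1 + L * w); split.
  by apply: ID; [apply/Im_colon | apply: IM].
by rewrite Eg E3; ring.
Qed.

End Scheme.
End Ideals.

(** * Bigraded components and Hilbert functions *)

Section Bigrading.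
Variables (F : fieldType) (n : nat) (bd : 'X_{1..n} -> nat * nat).
Hypothesis bdD : forall m m', bd (m + m')%MM = ((bd m).1 + (bd m').1, (bd m).2 + (bd m').2)%N.
Local Notation P := {mpoly F[n]}.
Implicit Types (f g h : P).

Lemma mcoeff_bicomp i j f m : (bicomp bd i j f)@_m = if bd m == (i, j) then f@_m else 0.
Proof.
rewrite /bicomp big_mkcond raddf_sum /=.
have [mf|nmf] := boolP (m \in msupp f).
  rewrite (bigD1_seq m) ?msupp_uniq //= big1 ?addr0 => [|k ne].
    by case: ifP => _; rewrite ?mcoeff0 // mcoeffZ mcoeffX eqxx mulr1.
  by case: ifP => _; rewrite ?mcoeff0 // mcoeffZ mcoeffX (negbTE ne) mulr0.
rewrite big_seq big1 => [|k kf].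
  by move: nmf; rewrite -mcoeff_eq0 => /eqP ->; case: ifP.
have ne : k != m by apply: contraNneq nmf => <-.
by case: ifP => _; rewrite ?mcoeff0 // mcoeffZ mcoeffX (negbTE ne) mulr0.
Qed.

Lemma bicompP i j c f g : bicomp bd i j (c *: f + g) = c *: bicomp bd i j f + bicomp bd i j g.
Proof.
apply/mpolyP => m; rewrite mcoeffD mcoeffZ !mcoeff_bicomp.
by case: ifP => _; rewrite ?mcoeffD ?mcoeffZ // mulr0 addr0.
Qed.

Lemma bicomp0 i j : bicomp bd i j (0 : P) = 0.
Proof. by apply/mpolyP => m; rewrite mcoeff_bicomp mcoeff0; case: ifP. Qed.

Lemma bicompD i j f g : bicomp bd i j (f + g) = bicomp bd i j f + bicomp bd i j g.
Proof. by rewrite -[f]scale1r bicompP !scale1r. Qed.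

Lemma bicomp_sum i j (T : Type) (s : seq T) (f : T -> P) :
  bicomp bd i j (\sum_(t <- s) f t) = \sum_(t <- s) bicomp bd i j (f t).
Proof.
by elim: s => [|t s IH]; rewrite ?big_nil ?bicomp0 // !big_cons bicompD IH.
Qed.

Lemma bihomogP i j f : bihomog bd i j f <-> bicomp bd i j f = f.
Proof.
split=> [H|E m].
  apply/mpolyP => m; rewrite mcoeff_bicomp; case: eqP => // ne.
  apply/esym/eqP; rewrite mcoeff_eq0; apply/negP => /H; exact: ne.
by rewrite mcoeff_msupp -E mcoeff_bicomp; case: (bd m =P _) => //; rewrite eqxx.
Qed.

Lemma bihomog_subsp i j : subsp (bihomog bd i j : P -> Prop).
Proof.
split=> [|c u v /bihomogP Hu /bihomogP Hv]; apply/bihomogP; first exact: bicomp0.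
by rewrite bicompP Hu Hv.
Qed.

Lemma bicomp_bihomog i j f : bihomog bd i j (bicomp bd i j f).
Proof.
by move=> m; rewrite mcoeff_msupp mcoeff_bicomp; case: (bd m =P _) => //; rewrite eqxx.
Qed.

Lemma bicomp_of_bihomog i j i' j' f : bihomog bd i' j' f ->
  bicomp bd i j f = if (i', j') == (i, j) then f else 0.
Proof.
move=> H; apply/mpolyP => m; rewrite mcoeff_bicomp.
have [mf|] := boolP (m \in msupp f).
  by rewrite (H m mf); case: ifP; rewrite ?mcoeff0.
by rewrite -mcoeff_eq0 => /eqP E; rewrite E; do 2!case: ifP; rewrite ?mcoeff0 ?E.
Qed.

Lemma bihomogM i j i' j' f g : bihomog bd i j f -> bihomog bd i' j' g ->
  bihomog bd (i + i') (j + j') (f * g).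
Proof.
move=> Hf Hg m /msuppM_le /allpairsP [[k l] /= [/Hf kf /Hg lg ->]].
by rewrite bdD kf lg.
Qed.

Lemma bihomogX m : bihomog bd (bd m).1 (bd m).2 ('X_[m] : P).
Proof. by move=> k; rewrite msuppX inE => /eqP ->; case: (bd m). Qed.

Lemma bihomog1 : bihomog bd 0 0 (1 : P).
Proof.
move=> m; rewrite -mpolyC1 msupp1 inE => /eqP ->.
by have := bdD 0 0; rewrite addm0; case: (bd 0%MM) => u v /= [Eu Ev]; congr pair; lia.
Qed.

Lemma bihomogXn i j f k : bihomog bd i j f -> bihomog bd (k * i) (k * j) (f ^+ k).
Proof.
move=> H; elim: k => [|k IH]; first by rewrite !mul0n expr0; apply: bihomog1.
by rewrite exprS !mulSn; apply: bihomogM.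
Qed.

Lemma bicompM p q i j h f : bihomog bd p q h ->
  bicomp bd i j (h * f) =
    if (p <= i)%N && (q <= j)%N then h * bicomp bd (i - p) (j - q) f else 0.
Proof.
move=> Hh; elim/mpolyind: f => [|c m f _ _ IH].
  by rewrite mulr0 !bicomp0 mulr0 if_same.
rewrite mulrDr -scalerAr !bicompP IH (bicomp_of_bihomog _ _ (bihomogM Hh (@bihomogX m))).
rewrite (bicomp_of_bihomog _ _ (@bihomogX m)) !xpair_eqE.
have [/andP [pi qj]|] := boolP ((p <= i)%N && (q <= j)%N); last first.
  rewrite negb_and -!ltnNge => H; rewrite addr0 ifN ?scaler0 //.
  by apply/negP => /andP [/eqP E1 /eqP E2]; move: H; rewrite -E1 -E2; lia.
rewrite mulrDr -scalerAr; congr (_ *: _ + _).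
have -> : (p + (bd m).1 == i)%N && (q + (bd m).2 == j)%N =
          ((bd m).1 == i - p)%N && ((bd m).2 == j - q)%N by lia.
by case: ifP; rewrite ?mulr0.
Qed.

Lemma sum_bicomp N f : (forall m, m \in msupp f -> ((bd m).1 < N)%N && ((bd m).2 < N)%N) ->
  f = \sum_(i < N) \sum_(j < N) bicomp bd i j f.
Proof.
move=> H; apply/mpolyP => m; rewrite pair_bigA raddf_sum /=.
have [mf|] := boolP (m \in msupp f); last first.
  rewrite -mcoeff_eq0 => /eqP E; rewrite big1 // => p _.
  by rewrite mcoeff_bicomp E if_same.
have /andP [l1 l2] := H m mf.
rewrite (bigD1 (Ordinal l1, Ordinal l2)) //= big1 => [|[i j] /= ne].
  by rewrite mcoeff_bicomp -surjective_pairing eqxx addr0.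
rewrite mcoeff_bicomp ifN //; apply: contra ne => /eqP E.
by rewrite xpair_eqE -!val_eqE /= E /= !eqxx.
Qed.

(** The degree (i,j) part of the polynomial ring shifted by (p,q). The zero case is explicit because
    truncated subtraction would otherwise return an actual component out of range. *)
Definition shifted p q i j f :=
  if (p <= i)%N && (q <= j)%N then bihomog bd (i - p) (j - q) f else f = 0.

Lemma shifted_subsp p q i j : subsp (shifted p q i j).
Proof.
rewrite /shifted; case: ((p <= i)%N && (q <= j)%N); first exact: bihomog_subsp.
by split=> // c u v -> ->; rewrite scaler0 addr0.
Qed.

Definition mulR (h f : P) : P := h * f.
Fact mulR_is_linear h : linear (mulR h).
Proof. by move=> c u v; rewrite /mulR mulrDr scalerAr. Qed.
HB.instance Definition _ h := GRing.isLinear.Build F P P _ (mulR h) (mulR_is_linear h).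

Lemma shifted_mul p q i j h f : bihomog bd p q h -> shifted p q i j f -> bihomog bd i j (h * f).
Proof.
rewrite /shifted => Hh; case: ifP => [/andP [pi qj] /(bihomogM Hh)|_ ->].
  by rewrite !subnKC.
by rewrite mulr0; apply: (subsp0 (bihomog_subsp i j)).
Qed.

End Bigrading.

(** * Hilbert functions in large x-degree *)

Section Dims.
Variables (F : fieldType).
Local Notation R := {mpoly F[4]}.
Local Notation pt := (F * F)%type.
Local Notation bih := (bihomog bideg4).
Local Notation bic := (bicomp bideg4).
Local Notation shifted := (@shifted F 4 bideg4).
Implicit Types (f g h : R) (K : R -> Prop).

Lemma bideg4D m m' : bideg4 (m + m')%MM =
  ((bideg4 m).1 + (bideg4 m').1, (bideg4 m).2 + (bideg4 m').2)%N.
Proof. by rewrite /bideg4 !mnmDE /=; congr pair; lia. Qed.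

Lemma shifted_bicomp p q i j h f : bih p q h ->
  exists2 g, shifted p q i j g & bic i j (h * f) = h * g.
Proof.
move=> Hh; rewrite (bicompM bideg4D _ _ _ Hh) /shifted; case: ifP => _.
  by exists (bic (i - p) (j - q) f) => //; apply: bicomp_bihomog.
by exists 0; rewrite ?mulr0.
Qed.

Lemma ideal_add_homog p q i j h K f : bih p q h -> bigraded_ideal bideg4 K ->
  bih i j f -> ideal_add K h f -> exists2 g, shifted p q i j g & K (f - h * g).
Proof.
move=> Hh [_ KG] /bihomogP Hf [k [u [Kk E]]].
have [g Wg Eg] := shifted_bicomp i j u Hh; exists g => //.
by rewrite -Hf E bicompD Eg addrK; apply: KG.
Qed.

Lemma ideal_add_bigraded p q h K : bih p q h -> bigraded_ideal bideg4 K ->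
  bigraded_ideal bideg4 (ideal_add K h).
Proof.
move=> Hh [KI KG]; split=> [|_ i j [k [u [Kk ->]]]]; first exact: ideal_addP.
have [g _ Eg] := shifted_bicomp i j u Hh.
by exists (bic i j k), g; rewrite bicompD Eg; split=> //; apply: KG.
Qed.

Lemma dvdR_bigraded p q h : bih p q h -> bigraded_ideal bideg4 (dvdR h).
Proof.
move=> Hh; split=> [|_ i j [u ->]]; first exact: dvdR_ideal.
by have [g _ ->] := shifted_bicomp i j u Hh; exists g.
Qed.

(** The exact sequence 0 -> (R/(K : h))(-p,-q) -> R/K -> R/(K + (h)) -> 0 in degree (i,j). *)
Lemma qdim_mul p q i j h K K' d d' : bih p q h -> bigraded_ideal bideg4 K ->
  (forall g, K (h * g) <-> K' g) ->
  qdim (shifted p q i j) K' d' -> qdim (bih i j) (ideal_add K h) d ->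
  qdim (bih i j) K (d' + d).
Proof.
move=> Hh KG KK'; have KI := KG.1.
apply: (@qdim_exact _ _ _ (mulR h : {linear R -> R})).
- exact: ideal_subsp.
- exact: ideal_subsp (ideal_addP h KI).
- exact: shifted_subsp.
- by move=> g; apply: (shifted_mul bideg4D Hh).
- by move=> g _; apply: KK'.
- by move=> f _; apply: ideal_add_sub.
- by move=> g _; apply: ideal_add_gen.
- by move=> f Wf /(ideal_add_homog Hh KG Wf).
exact: bihomog_subsp.
Qed.

Lemma bih_var (i : 'I_4) : bih (i < 2)%N (2 <= i)%N ('X_i : R).
Proof.
move=> m; rewrite msuppX inE => /eqP ->; rewrite /bideg4 !mnm1E.
by move: i; apply: ord4_ind; rewrite -!val_eqE /= !inordK.
Qed.

Lemma bih_x0 : bih 1 0 (x0 F). Proof. by have := @bih_var (inord 0); rewrite inordK. Qed.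
Lemma bih_x1 : bih 1 0 (x1 F). Proof. by have := @bih_var (inord 1); rewrite inordK. Qed.
Lemma bih_y0 : bih 0 1 (y0 F). Proof. by have := @bih_var (inord 2); rewrite inordK. Qed.
Lemma bih_y1 : bih 0 1 (y1 F). Proof. by have := @bih_var (inord 3); rewrite inordK. Qed.

Lemma bih_lformx u : bih 1 0 (lform u (x0 F) (x1 F)).
Proof.
have s := bihomog_subsp F bideg4 1 0.
by apply: (subspD s); apply: (subspZ s); [apply: bih_x0|apply: bih_x1].
Qed.

Lemma bih_lformy u : bih 0 1 (lform u (y0 F) (y1 F)).
Proof.
have s := bihomog_subsp F bideg4 0 1.
by apply: (subspD s); apply: (subspZ s); [apply: bih_y0|apply: bih_y1].
Qed.

Lemma bih_Lx (a : pt) : bih 1 0 (Lx a).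
Proof.
have s := bihomog_subsp F bideg4 1 0.
by apply: (subspB s); apply: (subspZ s); [apply: bih_x0|apply: bih_x1].
Qed.

Lemma bih_My (b : pt) : bih 0 1 (My b).
Proof.
have s := bihomog_subsp F bideg4 0 1.
by apply: (subspB s); apply: (subspZ s); [apply: bih_y0|apply: bih_y1].
Qed.

Lemma bih_prodMy (s : seq pt) : bih 0 (size s) (prodMy s).
Proof.
elim: s => [|t s IH]; first by rewrite /prodMy big_nil; apply: bihomog1 bideg4D.
rewrite /prodMy big_cons -/(prodMy s).
exact: (bihomogM bideg4D (@bih_My t) IH).
Qed.

Lemma ideal2_bigraded p q p' q' h h' : bih p q h -> bih p' q' h' ->
  bigraded_ideal bideg4 (ideal2 h h').
Proof. by move=> Hh Hh'; apply: ideal_add_bigraded Hh' (dvdR_bigraded Hh). Qed.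

Lemma inpow_bigraded (a b : pt) m : bigraded_ideal bideg4 (inpow a b m).
Proof.
have KI := inpow_ideal a b m; split=> // _ i j [g ->].
rewrite bicomp_sum; apply: (subsp_sum (ideal_subsp KI)) => k _.
have HL := bihomogXn bideg4D (k := k) (@bih_Lx a).
have HM := bihomogXn bideg4D (k := m - k) (@bih_My b).
have [u _ Eu] := shifted_bicomp i j (g k) (bihomogM bideg4D HL HM).
rewrite -mulrA mulrC Eu mulrC mulrA.
by have := inpow_mon a b k (m - k) u; rewrite subnKC // -ltnS.
Qed.

Lemma mono4E (m : 'X_{1..4}) : 'X_[m] =
  x0 F ^+ m (inord 0) * x1 F ^+ m (inord 1) * (y0 F ^+ m (inord 2) * y1 F ^+ m (inord 3)).
Proof.
rewrite mpolyXE_id !big_ord_recl big_ord0 mulr1 !mulrA.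
do !congr (_ * _); congr ('X_ _ ^+ m _); apply: val_inj; by rewrite /= inordK.
Qed.

Lemma psix_mono (a : pt) (m : 'X_{1..4}) : psix a 'X_[m] =
  (a.1 ^+ m (inord 0) * a.2 ^+ m (inord 1)) *:
  (lamx a ^+ (bideg4 m).1 * (y0 F ^+ m (inord 2) * y1 F ^+ m (inord 3))).
Proof.
rewrite mono4E !rmorphM !rmorphXn /= /psix !subRE !exprZn -scalerAl -scalerAr.
by rewrite scalerA -exprD -scalerAl mulrC.
Qed.

Lemma psix_bihomog a i j f : bih i j f -> dvdR (lamx a ^+ i) (psix a f).
Proof.
move=> Hf; rewrite (mpolyE f) raddf_sum /= big_seq.
have sD := ideal_subsp (dvdR_ideal (lamx a ^+ i)).
apply: (subsp_sum sD) => m /Hf mf.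
rewrite /psix subRZ -/(psix a _) psix_mono mf.
by do 2!apply: (subspZ sD); exists (y0 F ^+ m (inord 2) * y1 F ^+ m (inord 3)).
Qed.

Lemma psixy_bihomog a b i j f : bih i j f ->
  psiy b (psix a f) = evpt a b f *: (lamx a ^+ i * muy b ^+ j).
Proof.
move=> Hf; rewrite {1}(mpolyE f) (rmorph_sum (psix a)) (rmorph_sum (psiy b)).
rewrite [in RHS](mpolyE f) (rmorph_sum (evpt a b)) scaler_suml /=.
apply: eq_big_seq => m /Hf mf.
rewrite /psix subRZ -/(psix a _) psix_mono mf /psiy !subRZ -/(psiy b _) /= evptE.
rewrite -[in RHS]scalerA; congr (_ *: _).
rewrite mono4E !rmorphM !rmorphXn /= !evptE psiy_lformx /psiy !subRE !exprZn.
rewrite -scalerAr -scalerAl -!scalerAr !scalerA -exprD.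
by congr (_ *: (_ * _)); [ring | case: mf => _ ->].
Qed.

Lemma qdim_point (a b : pt) i j : nzpt a -> nzpt b -> qdim (bih i j) (ideal2 (Lx a) (My b)) 1.
Proof.
move=> nza nzb; have KI := ideal2_ideal (Lx a) (My b); have sK := ideal_subsp KI.
apply: (@qdim1 _ _ _ _ (lamx a ^+ i * muy b ^+ j)) => //.
- have := bihomogM bideg4D (bihomogXn bideg4D (k := i) (@bih_lformx (dual a)))
                           (bihomogXn bideg4D (k := j) (@bih_lformy (dual b))).
  by rewrite !muln0 !muln1 addn0 add0n.
- case=> _ [v [[u ->] /(congr1 (evpt a b))]].
  have [[e _ _ _ _] _] := dualP nza; have [[e' _ _ _ _] _] := dualP nzb.
  rewrite rmorphD !rmorphM !rmorphXn /= /Lx /My !rmorphB !rmorphD /= !evptE e e'.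
  rewrite [a.2 * _]mulrC [b.2 * _]mulrC !subrr !mul0r addr0 !expr1n mulr1.
  by move/eqP; rewrite oner_eq0.
move=> f Hf; exists (evpt a b f); rewrite -(psixy_bihomog a b Hf).
have [u Eu] := psix_congr f nza; have [v Ev] := psiy_congr (psix a f) nzb.
have -> : f - psiy b (psix a f) = Lx a * u + My b * v by rewrite -Eu -Ev addrA subrK.
by apply: (subspD sK); [apply: ideal2l | apply: ideal2r].
Qed.

(** One factor M_t of D is divided out at a time: the colon by M_t is the ideal of the remaining
    factors, taken in y-degree j - 1, and adding M_t leaves a reduced point, of dimension one. *)
Lemma qdim_row (a : pt) s i j : nzpt a -> (forall t, t \in s -> nzpt t) ->
  qdim (bih i j) (ideal2 (Lx a) (prodMy s)) (minn j.+1 (size s)).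
Proof.
move=> nza; elim: s j => [|t s IH] j Hs.
  rewrite minn0; apply: qdim0 => f _; rewrite /prodMy big_nil -[f]mul1r.
  exact: ideal2r.
have nzt := Hs t (mem_head _ _).
have Hs' t' : t' \in s -> nzpt t' by move=> t's; apply: Hs; rewrite in_cons t's orbT.
have Es : prodMy (t :: s) = My t * prodMy s by rewrite /prodMy big_cons.
have -> : minn j.+1 (size (t :: s)) = (minn j (size s) + 1)%N.
  by rewrite /= minnSS addn1.
apply: (@qdim_mul 0 1 i j (My t) _ (ideal2 (Lx a) (prodMy s))).
- exact: bih_My.
- exact: ideal2_bigraded (@bih_Lx a) (@bih_prodMy _).
- move=> g; split=> [/ideal2_psix - /(_ nza)|/ideal2_psix - /(_ nza) [k Ek]];
    [case=> k Ek; apply/ideal2_psix => //|apply/ideal2_psix => //]; exists k.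
    apply: (mulfI (My_neq0 nzt)); rewrite mulrA -Es -Ek.
    by rewrite rmorphM /= psix_My.
  by rewrite rmorphM /= psix_My Ek Es mulrA.
- rewrite /shifted /= subn0; case: j => [|j] /=.
    rewrite min0n; apply: qdim0 => f ->.
    by case: (ideal2_ideal (Lx a) (prodMy s)).
  by rewrite subn1; apply: IH.
apply: qdim_ext (qdim_point i j nza nzt) => //; last exact: bihomog_subsp.
move=> f _; split=> [[h [u [Kh ->]]]|[h [u [[h' [u' [Kh' ->]] ->]]]]].
  exists h, u; split=> //; exact: ideal_add_sub.
exists h', (prodMy s * u' + u); split=> //.
by rewrite Es mulrDr !mulrA addrA.
Qed.

Section Scheme.
Variables (I J : finType) (a : I -> pt) (b : J -> pt).
Hypotheses (nza : forall i, nzpt (a i)) (nzb : forall j, nzpt (b j)).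
Hypotheses (da : forall i i', i != i' -> ~~ dpeq (a i) (a i')).
Hypotheses (db : forall j j', j != j' -> ~~ dpeq (b j) (b j')).
Implicit Type m : I -> J -> nat.
Local Notation Im := (Im a b).

Lemma Im_bigraded m : bigraded_ideal bideg4 (Im m).
Proof.
split=> [|f i j Hf i' j']; first exact: Im_ideal.
by case: (inpow_bigraded (a i') (b j') (m i' j')) => _; apply; apply: Hf.
Qed.

(* A form of large degree in [x] is a multiple of [G] modulo [L_i0], where [G]
   vanishes to high order on the other vertical lines. *)
Lemma row_saturation m i0 i j f : (\sum_i' \sum_j' m i' j' <= i)%N -> bih i j f ->
  ideal_add (Im m) (Lx (a i0)) f <-> ideal2 (Lx (a i0)) (prodMy (rowseq b m i0)) f.
Proof.
move=> lei Hf; set L := Lx (a i0); set D := prodMy _.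
split=> [[h [u [Ih ->]]]|H].
  have s2 := ideal_subsp (ideal2_ideal L D).
  by apply: subspD => //; [apply: Im_sub_row | apply: ideal2l].
(* The sum of the multiplicities in a row dominates each of them, which puts G D in I_m. *)
pose e i' := (\sum_j' m i' j')%N.
pose G : R := \prod_(i' | i' != i0) Lx (a i') ^+ e i'.
have GD : Im m (G * D).
  move=> i' j'; case: (inpow_ideal (a i') (b j') (m i' j')) => _ _ IM.
  have [-> |ne] := eqVneq i' i0.
    case: (inpow_ideal (a i0) (b j') (m i0 j')) => _ _; apply.
    exact: inpow_dvdM (leqnn _) (dvd_rowseq b m i0 j').
  rewrite mulrC; apply: IM; rewrite /G (bigD1 i') //= mulrC.
  apply: (@inpow_le _ _ _ _ (e i')); first by rewrite /e (bigD1 j') //= leq_addr.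
  have H' g := inpow_mon (a i') (b j') (e i') 0 g; rewrite addn0 expr0 in H'.
  by rewrite -[X in inpow _ _ _ X]mulr1; apply: H'.
have [n [k [nzk len EG]]] : exists n k, [/\ k != 0, (n <= i)%N & psix (a i0) G = k *: lamx (a i0) ^+ n].
  exists (\sum_(i' | i' != i0) e i')%N.
  exists (\prod_(i' | i' != i0) ((a i').2 * (a i0).1 - (a i').1 * (a i0).2) ^+ e i'); split.
  - apply/prodf_neq0 => i' ne; apply: expf_neq0.
    by have := da ne; rewrite dpeq_sym /dpeq /peq subr_eq0 mulrC [X in _ == X]mulrC.
  - by apply: leq_trans lei; rewrite [X in (_ <= X)%N](bigD1 i0) //= leq_addl.
  rewrite /G rmorph_prod /= -prodrXr -scaler_prod; apply: eq_bigr => i' _.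
  by rewrite rmorphXn /= psix_Lx exprZn.
have [g Wg [u Eu]] : exists2 g, shifted 0 (size (rowseq b m i0)) i j g & dvdR L (f - D * g).
  exact: ideal_add_homog (@bih_prodMy _) (dvdR_bigraded (@bih_Lx _)) Hf H.
(* The restriction of [g] to the line is divisible by [lamx (a i0) ^+ i], while that of G is a
   nonzero multiple of the n-th power with n <= i; large x-degree is needed exactly for this. *)
have [w [z Ez]] : ideal2 L G g.
  move: Wg; rewrite /shifted; case: ifP => [_|_ ->]; last by case: (ideal2_ideal L G).
  rewrite subn0 => /(psix_bihomog (a i0)) [v Ev].
  have sK := ideal_subsp (ideal2_ideal L G).
  have [_ _ KM] := ideal2_ideal L G.
  have [t Et] := psix_congr g (nza i0); have [t' Et'] := psix_congr G (nza i0).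
  rewrite -(subrK (psix (a i0) g) g) Et; apply: subspD; [by []|exact: ideal2l|].
  rewrite Ev -(subnK len) exprD mulrAC; apply: KM => //.
  rewrite -[_ ^+ n](scalerK nzk) -EG; apply: subspZ => //.
  rewrite -[psix _ G](subKr G) Et'; apply: subspB => //; last exact: ideal2l.
  by have := ideal2r L G 1; rewrite mulr1.
case: Ez => -[w' Ew] Eg; rewrite Ew in Eg.
exists (G * D * z), (u + D * w'); split.
  by rewrite mulrC; case: (Im_ideal a b m) => _ _; apply.
by rewrite -(subrK (D * g) f) Eu Eg -/L; ring.
Qed.

(** Removing the line of row i for the (k+1)-st time contributes min(j + 1, a_{i,k}). Levels beyond
    the multiplicities contribute 0, so [K] can be any common bound. *)
Definition rowdim m (K : nat) j := (\sum_i \sum_(k < K) minn j.+1 (\sum_j' (m i j' - k)))%N.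

Lemma rowdim_decr m (K : nat) j i0 : (forall i j, m i j <= K)%N ->
  rowdim m K j = (rowdim (decr m i0) K j + minn j.+1 (\sum_j' m i0 j'))%N.
Proof.
move=> mK; rewrite /rowdim (bigD1 i0) //= [in RHS](bigD1 i0) //= addnAC; congr (_ + _)%N; last first.
  apply: eq_bigr => i ne; apply: eq_bigr => k _; congr minn; apply: eq_bigr => j' _.
  by rewrite /decr (negbTE ne).
(* Level [K] contributes nothing; adding it allows level 0 to be split off and the others to be
   shifted down to the levels of the lowered row. *)
have E : (\sum_(k < K.+1) minn j.+1 (\sum_j' (m i0 j' - k)) =
          \sum_(k < K) minn j.+1 (\sum_j' (m i0 j' - k)))%N.
  rewrite big_ord_recr /= [X in (_ + minn _ X)%N]big1 ?minn0 ?addn0 // => j' _.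
  by apply/eqP; rewrite subn_eq0.
rewrite -E big_ord_recl addnC /=; congr (_ + minn _ _)%N.
  apply: eq_bigr => k _; congr minn; apply: eq_bigr => j' _.
  by rewrite /decr eqxx /bump /=; lia.
by apply: eq_bigr => j' _; rewrite subn0.
Qed.

Lemma Im_qdim m (K : nat) : (forall i j, m i j <= K)%N ->
  exists N, forall i j, (N <= i)%N -> qdim (bih i j) (Im m) (rowdim m K j).
Proof.
have [n] := ubnP (\sum_i \sum_j m i j)%N; elim: n m => // n IH m ltn mK.
have [all0|] := boolP [forall i, forall j, m i j == 0%N].
  have m0 i j : m i j = 0%N by have /forallP /(_ i) /forallP /(_ j) /eqP := all0.
  exists 0%N => i j _; rewrite [rowdim _ _ _](_ : _ = 0%N).
    by apply: qdim0 => f _ i' j'; rewrite m0; apply: inpow0.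
  rewrite /rowdim big1 // => i' _; rewrite big1 // => k _.
  by rewrite big1 ?minn0 // => j' _; rewrite m0.
case/forallPn => i0 /forallPn [j0 nz0].
have lt' : (\sum_i' \sum_j decr m i0 i' j < n)%N.
  by have := @sum_decr _ _ m i0 (ex_intro _ j0 nz0); lia.
have mK' i j : (decr m i0 i j <= K)%N.
  by rewrite /decr; case: ifP => _ //; apply: leq_trans (leq_pred _) _.
have [N HN] := IH _ lt' mK'.
(* The successor of the bound for the lowered scheme, which is used in x-degree i - 1; the sum of
   the multiplicities is what [row_saturation] asks for. *)
exists (N.+1 + \sum_i \sum_j m i j)%N => i j lei.
rewrite (rowdim_decr j i0 mK).
apply: (@qdim_mul 1 0 i j (Lx (a i0)) _ (Im (decr m i0))).
- exact: bih_Lx.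
- exact: Im_bigraded.
- by move=> g; apply: Im_colon.
- rewrite /shifted (_ : (1 <= i)%N && (0 <= j)%N = true) ?subn0; last by lia.
  by apply: HN; lia.
have nzs t : t \in rowseq b m i0 -> nzpt t by move=> /mem_rowseq [j' ->].
have := qdim_row i j (nza i0) nzs; rewrite size_rowseq.
apply: qdim_ext => //; last exact: bihomog_subsp.
by move=> f Hf; apply: iff_sym; apply: row_saturation Hf; lia.
Qed.

End Scheme.
End Dims.

(** * Krull dimension and depth *)

Section Krull.
Variables (F : fieldType).
Local Notation R := {mpoly F[4]}.
Local Notation bih := (bihomog bideg4).

Definition bdeg_le e (f : R) :=
  forall m, m \in msupp f -> ((bideg4 m).1 <= e)%N && ((bideg4 m).2 <= e)%N.

Lemma bdeg_leM e e' f g : bdeg_le e f -> bdeg_le e' g -> bdeg_le (e + e') (f * g).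
Proof.
move=> Hf Hg m /msuppM_le /allpairsP [[k l] /= [/Hf /andP [k1 k2] /Hg /andP [l1 l2] ->]].
by rewrite !mnmDE; move: k1 k2 l1 l2; rewrite /bideg4 /=; lia.
Qed.

Lemma bdeg_leX e f k : bdeg_le e f -> bdeg_le (k * e) (f ^+ k).
Proof.
move=> Hf; elim: k => [|k IH]; last by rewrite exprS mulSn; apply: bdeg_leM.
move=> m; rewrite expr0 -mpolyC1 msupp1 inE => /eqP ->.
by rewrite /bideg4 !mnm0E.
Qed.

Lemma bdeg_le_ex (f : R) : exists e, bdeg_le e f.
Proof.
exists (\max_(m <- msupp f) ((bideg4 m).1 + (bideg4 m).2))%N => m mf.
have := @leq_bigmax_seq _ (msupp f) xpredT (fun m => (bideg4 m).1 + (bideg4 m).2)%N m mf isT.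
by move=> le; apply/andP; split; apply: leq_trans le; rewrite ?leq_addr ?leq_addl.
Qed.

Variables (K : R -> Prop) (KI : is_ideal K) (B : nat).
Hypothesis bounded : forall i j, exists2 d, qdim (bih i j) K d & (d <= B)%N.

(** The n^3 monomials in the three elements have bidegrees below N in both coordinates, hence lie
    modulo [K] in a space of dimension at most N^2 B. As N grows linearly in n, a large n forces a
    dependence. *)
Lemma poly_relation (f1 f2 f3 : R) : exists n (q : 'I_n -> 'I_n -> 'I_n -> F),
  (exists a b c, q a b c != 0) /\
  K (\sum_a \sum_b \sum_c q a b c *: (f1 ^+ a * f2 ^+ b * f3 ^+ c)).
Proof.
have sK := ideal_subsp KI.
have [e1 H1] := bdeg_le_ex f1; have [e2 H2] := bdeg_le_ex f2; have [e3 H3] := bdeg_le_ex f3.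
(* [e] bounds the bidegrees of the three elements, and those of their monomials with exponents below
   [n] stay below [N]. Since N <= n (3e + 1), the choice of [n] gives N^2 B < n^3. *)
pose e := (e1 + e2 + e3)%N; pose n := ((3 * e).+1 ^ 2 * B).+1; pose N := (3 * n * e).+1.
have wk e' f : (e' <= e)%N -> bdeg_le e' f -> bdeg_le e f.
  move=> le H m /H /andP [h1 h2].
  by rewrite (leq_trans h1 le) (leq_trans h2 le).
have {H1}H1 : bdeg_le e f1 by apply: wk H1; rewrite /e; lia.
have {H2}H2 : bdeg_le e f2 by apply: wk H2; rewrite /e; lia.
have {H3}H3 : bdeg_le e f3 by apply: wk H3; rewrite /e; lia.
have /fin_all_exists [d Hd] (x : 'I_N * 'I_N) : exists d,
    (exists p : 'I_d -> R, spans (bih x.1 x.2) K p) /\ (d <= B)%N.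
  by have [d [p [_ _ sp]] dB] := bounded x.1 x.2; exists d; split=> //; exists p.
have /fin_all_exists [p Hp] (x : 'I_N * 'I_N) : exists p : 'I_(d x) -> R, spans (bih x.1 x.2) K p.
  by case: (Hd x).
pose T : finType := {x : 'I_N * 'I_N & 'I_(d x)}.
pose S : finType := ('I_n * 'I_n * 'I_n)%type.
pose v (s : S) := f1 ^+ s.1.1 * f2 ^+ s.1.2 * f3 ^+ s.2.
have cardT : (#|T| < #|S|)%N.
  rewrite card_tagged !card_prod !card_ord sumnE big_map big_enum /=.
  apply: (@leq_ltn_trans (N * N * B)%N).
    have -> : (N * N * B = \sum_(x : 'I_N * 'I_N) B)%N.
      by rewrite sum_nat_const card_prod !card_ord.
    by apply: leq_sum => x _; rewrite card_ord; case: (Hd x).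
  have NN : (N <= n * (3 * e).+1)%N by rewrite /N; lia.
  apply: (@leq_ltn_trans (n * n * ((3 * e).+1 ^ 2 * B))%N).
    have := leq_mul (leq_mul NN NN) (leqnn B); congr (_ <= _)%N; ring.
  by rewrite -mulnA -mulnA !ltn_pmul2l // /n.
have [s|q [[s nzs] Ks]] := @span_dep _ _ K S T (fun t => p (tag t) (tagged t)) v sK _ cardT.
  have /(sum_bicomp (N := N)) Ev : forall m, m \in msupp (v s) ->
      ((bideg4 m).1 < N)%N && ((bideg4 m).2 < N)%N.
    move=> m /(bdeg_leM (bdeg_leM (bdeg_leX (k := s.1.1) H1) (bdeg_leX (k := s.1.2) H2))
                    (bdeg_leX (k := s.2) H3)).
    have le : (s.1.1 * e + s.1.2 * e + s.2 * e <= 3 * n * e)%N.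
      rewrite -!mulnDl leq_mul2r; apply/orP; right.
      by have := ltn_ord s.1.1; have := ltn_ord s.1.2; have := ltn_ord s.2; lia.
    by case/andP => h1 h2; rewrite /N !ltnS (leq_trans h1 le) (leq_trans h2 le).
  have /fin_all_exists [c Hc] (x : 'I_N * 'I_N) : exists c : 'I_(d x) -> F,
      K (bicomp bideg4 x.1 x.2 (v s) - \sum_t c t *: p x t).
    by apply: Hp; apply: bicomp_bihomog.
  exists (fun t : T => c (tag t) (tagged t)).
  have -> : \sum_(t : T) c (tag t) (tagged t) *: p (tag t) (tagged t) =
      \sum_x \sum_t c x t *: p x t.
    by rewrite (sig_big_dep xpredT (fun _ => xpredT) (fun x t => c x t *: p x t)).
  rewrite {1}Ev pair_bigA /= -sumrB.
  by apply: subsp_sum.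
exists n, (fun a b c => q (a, b, c)); split.
  by case: s nzs => -[a b] c nz; exists a, b, c.
move: Ks; congr K; rewrite !pair_bigA /=.
by apply: eq_bigr => -[[a b] c] _.
Qed.

(** Regularity cancels the lowest power of x; what remains is congruent to [g a0] modulo x, and x
    lies in [K1]. *)
Lemma lowest_coef (K0 K1 : R -> Prop) x n (g : 'I_n -> R) (a0 : 'I_n) :
  is_ideal K0 -> is_ideal K1 -> (forall f, K0 f -> K1 f) -> K1 x ->
  (forall f, K0 (x * f) -> K0 f) -> (forall a : 'I_n, (a < a0)%N -> g a = 0) ->
  K0 (\sum_(a < n) x ^+ a * g a) -> K1 (g a0).
Proof.
move=> K0I K1I K01 K1x reg g0 Ks.
pose Y := \sum_(a < n | (a0 <= a)%N) x ^+ (a - a0) * g a.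
have E : \sum_(a < n) x ^+ a * g a = x ^+ a0 * Y.
  rewrite /Y mulr_sumr [RHS]big_mkcond; apply: eq_bigr => a _.
  case: leqP => [le|lt]; last by rewrite g0 ?mulr0.
  by rewrite mulrA -exprD subnKC.
have regX k f : K0 (x ^+ k * f) -> K0 f.
  by elim: k => [|k IH]; rewrite ?expr0 ?mul1r // exprS -mulrA => /reg.
have /K01 : K0 Y by apply: (@regX a0); rewrite -E.
have s1 := ideal_subsp K1I; have [_ _ KM] := K1I.
rewrite /Y (bigD1 a0) //= subnn expr0 mul1r => H.
rewrite -[g a0](addrK (\sum_(i < n | (a0 <= i)%N && (i != a0)) x ^+ (i - a0) * g i)).
apply: subspB => //; apply: subsp_sum => // a /andP [le ne].
have -> : (a - a0 = (a - a0).-1.+1)%N.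
  by rewrite prednK // subn_gt0 ltn_neqAle le andbT eq_sym.
by rewrite exprS -mulrA mulrC; apply: KM.
Qed.

Lemma first_nonzero n (P : pred 'I_n) : (exists a, P a) ->
  exists2 a, P a & forall a' : 'I_n, (a' < a)%N -> ~~ P a'.
Proof.
case=> a0 Pa0; case: (arg_minnP (fun a : 'I_n => nat_of_ord a) Pa0) => a Pa mn.
exists a => // a' lt; apply/negP => /mn /=; rewrite leqNgt.
by move/negP; apply.
Qed.

(** A common form for prime chains and regular sequences: each of three steps adjoins an element
    regular for the previous ideal. The relation is stripped down to its lexicographically lowest
    coefficient, a nonzero constant in the last ideal. *)
Lemma no_regular3 (K_ : nat -> R -> Prop) (x : nat -> R) :
  (forall l, (l <= 3)%N -> is_ideal (K_ l)) ->
  (forall f, K f -> K_ 0%N f) ->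
  (forall l, (l < 3)%N -> [/\ forall f, K_ l f -> K_ l.+1 f, K_ l.+1 (x l) &
     forall f, K_ l (x l * f) -> K_ l f]) -> K_ 3%N 1.
Proof.
move=> IK K0 step.
have [n [q [[a [b [c nz]]] Kq]]] := poly_relation (x 0%N) (x 1%N) (x 2%N).
have [{nz b c}a] := @first_nonzero n (fun a => [exists b, exists c, q a b c != 0])
  (ex_intro _ a (introT existsP (ex_intro _ b (introT existsP (ex_intro _ c nz))))).
move=> /existsP Hb mna.
have [{Hb}b] := first_nonzero Hb; move=> /existsP Hc mnb.
have [{Hc}c nz _] := first_nonzero Hc.
have [s01 k1 r0] := step 0%N isT; have [s12 k2 r1] := step 1%N isT.
have [s23 k3 r2] := step 2%N isT.
have H1 : K_ 1%N (\sum_b \sum_c q a b c *: (x 1%N ^+ b * x 2%N ^+ c)).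
  apply: (@lowest_coef _ _ _ _ (fun a => \sum_b \sum_c q a b c *: (x 1%N ^+ b * x 2%N ^+ c)) a
     (IK 0%N isT) (IK 1%N isT) s01 k1 r0).
    move=> a' /mna /existsPn z; rewrite big1 // => b' _; rewrite big1 // => c' _.
    by have /existsPn /(_ c') /negPn /eqP -> := z b'; rewrite scale0r.
  apply: K0; move: Kq; congr K; apply: eq_bigr => a' _.
  rewrite mulr_sumr; apply: eq_bigr => b' _; rewrite mulr_sumr; apply: eq_bigr => c' _.
  by rewrite -scalerAr mulrA.
have H2 : K_ 2%N (\sum_c q a b c *: x 2%N ^+ c).
  apply: (@lowest_coef _ _ _ _ (fun b => \sum_c q a b c *: x 2%N ^+ c) b
     (IK 1%N isT) (IK 2%N isT) s12 k2 r1).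
    move=> b' /mnb /existsPn z; rewrite big1 // => c' _.
    by have /negPn /eqP -> := z c'; rewrite scale0r.
  move: H1; congr (K_ 1%N); apply: eq_bigr => b' _.
  by rewrite mulr_sumr; apply: eq_bigr => c' _; rewrite -scalerAr.
have [c0 nz0 mnc] := @first_nonzero n (fun c => q a b c != 0) (ex_intro _ c nz).
have H3 : K_ 3%N (q a b c0)%:MP.
  apply: (@lowest_coef _ _ _ _ (fun c => (q a b c)%:MP) c0
     (IK 2%N isT) (IK 3%N isT) s23 k3 r2).
    by move=> c' /mnc /negPn /eqP ->; rewrite mpolyC0.
  move: H2; congr (K_ 2%N); apply: eq_bigr => c' _.
  by rewrite mulrC mul_mpolyC.
have [_ _ KM] := IK 3%N isT.
have := KM (q a b c0)^-1%:MP _ H3.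
by rewrite -mpolyCM mulVf // mpolyC1.
Qed.

(** An element of one prime of the chain outside the preceding prime is regular modulo the latter,
    so a chain of length 3 would put 1 in a prime. *)
Lemma prime_chain_le2 d : prime_chain K d -> (d <= 2)%N.
Proof.
case=> C [Cp Cs]; rewrite leqNgt; apply/negP => lt2.
have lt0 : (0 < d)%N by lia.
have lt1 : (1 < d)%N by lia.
have [s0 [u0 [u0C u0n]]] := Cs _ lt0; have [s1 [u1 [u1C u1n]]] := Cs _ lt1.
have [s2 [u2 [u2C u2n]]] := Cs _ lt2.
have [[_ n1 _] _] := Cp 3 lt2; apply: n1.
apply: (@no_regular3 C (fun l => [:: u0; u1; u2]`_l)).
- by move=> l le; have [[]] := Cp l (leq_trans le lt2).
- by case: (Cp 0%N (leq0n _)).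
have reg l u : (l <= d)%N -> ~ C l u -> forall f, C l (u * f) -> C l f.
  by move=> ld nu f; have [[_ _ pr] _] := Cp l ld => /pr [].
by case=> [|[|[|l]]] // _; split=> //; apply: reg => //; lia.
Qed.

Lemma isg_rcons (L : R -> Prop) s p f :
  ideal_sum_gen L (rcons s p) f <-> ideal_add (ideal_sum_gen L s) p f.
Proof.
split=> [[h [Lh [gs]]]|[f1 [u [[h [Lh [gs [sz ->]]]] ->]]]].
  case/lastP: gs => [|gs g]; first by rewrite size_rcons => -[].
  rewrite !size_rcons => -[[sz] ->]; exists (h + \sum_(a < size s) gs`_a * s`_a), g.
  split; first by exists h; split=> //; exists gs.
  rewrite big_ord_recr /= !nth_rcons sz ltnn eqxx -addrA; congr (_ + (_ + _)).
    by apply: eq_bigr => a _; rewrite !nth_rcons sz ltn_ord.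
  exact: mulrC.
exists h; split=> //; exists (rcons gs u); rewrite !size_rcons sz; split=> //.
rewrite big_ord_recr /= !nth_rcons sz ltnn eqxx -addrA; congr (_ + (_ + _)).
  by apply: eq_bigr => a _; rewrite !nth_rcons sz ltn_ord.
exact: mulrC.
Qed.

Lemma isg_nil (L : R -> Prop) f : ideal_sum_gen L [::] f <-> L f.
Proof.
split=> [[h [Lh [gs [_ ->]]]]|Lf]; first by rewrite big_ord0 addr0.
by exists f; split=> //; exists [::]; rewrite big_ord0 addr0.
Qed.

Lemma is_ideal_ext (L L' : R -> Prop) : (forall f, L f <-> L' f) -> is_ideal L -> is_ideal L'.
Proof.
move=> E [L0 LD LM]; split=> [|f g /E Lf /E Lg|r f /E Lf]; apply/E => //; first exact: LD.
exact: LM.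
Qed.

Lemma isg_ideal (L : R -> Prop) s : is_ideal L -> is_ideal (ideal_sum_gen L s).
Proof.
move=> LI; elim/last_ind: s => [|s p IH].
  by apply: is_ideal_ext LI => f; apply: iff_sym; apply: isg_nil.
by apply: is_ideal_ext (ideal_addP p IH) => f; apply: iff_sym; apply: isg_rcons.
Qed.

Lemma isg_cat (L : R -> Prop) s t f : ideal_sum_gen L s f -> ideal_sum_gen L (s ++ t) f.
Proof.
elim/last_ind: t => [|t p IH] H; first by rewrite cats0.
by rewrite -rcons_cat; apply/isg_rcons; apply: ideal_add_sub; apply: IH.
Qed.

Lemma regular_seq_le2 fs : quot_regular_seq K fs -> (size fs <= 2)%N.
Proof.
case=> _ n1 reg; rewrite leqNgt; apply/negP => lt2; apply: n1.
rewrite -(cat_take_drop 3 fs); apply: isg_cat.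
apply: (@no_regular3 (fun l => ideal_sum_gen K (take l fs)) (fun l => fs`_l)).
- by move=> l _; apply: isg_ideal.
- by move=> f Kf; rewrite take0; apply/isg_nil.
move=> l lt3; have ltl : (l < size fs)%N by lia.
have E : take l.+1 fs = rcons (take l fs) fs`_l by rewrite (take_nth 0).
split=> [f Hf||f]; rewrite ?E.
- by apply/isg_rcons; apply: ideal_add_sub.
- apply/isg_rcons.
  by have := ideal_add_gen fs`_l 1 (isg_ideal (take l fs) KI); rewrite mulr1.
by rewrite mulrC; apply: reg.
Qed.

End Krull.

Section Chain.
Variables (F : fieldType) (a b : F * F).
Hypotheses (nza : nzpt a) (nzb : nzpt b).
Local Notation R := {mpoly F[4]}.

Lemma ker_prime (phi : {rmorphism R -> R}) : is_prime_ideal (fun f => phi f = 0).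
Proof.
split; first split.
- exact: rmorph0.
- by move=> f g Hf Hg; rewrite rmorphD Hf Hg addr0.
- by move=> r f Hf; rewrite rmorphM Hf mulr0.
- by rewrite rmorph1 => /eqP; rewrite oner_eq0.
by move=> f g /eqP; rewrite rmorphM mulf_eq0 => /orP [] /eqP; [left|right].
Qed.

(** The primes are kernels of substitutions into a domain: (L_a, M_b), (L_a, y0, y1) and the
    irrelevant ideal. [muy b] and [lamx a] witness the strict inclusions. *)
Lemma point_prime_chain (K : R -> Prop) :
  (forall f, K f -> psiy b (psix a f) = 0) -> prime_chain K 2.
Proof.
move=> K0.
pose phi0 : {rmorphism R -> R} := psiy b \o psix a.
pose chi1 : {rmorphism R -> R} := subR (x0 F) (x1 F) 0 0.
pose chi2 : {rmorphism R -> R} := subR (0 : R) 0 0 0.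
pose phi1 : {rmorphism R -> R} := chi1 \o phi0.
pose phi2 : {rmorphism R -> R} := chi2 \o phi1.
have [[ea _ _ _ _] _] := dualP nza; have [[eb _ _ _ _] _] := dualP nzb.
have e_mu : phi0 (muy b) = muy b.
  rewrite /phi0 /= /muy /lform !(raddfD, rmorphD) /= /psix /psiy !subRE !scalerA -scalerDl.
  by rewrite eb scale1r.
have e_lam : phi0 (lamx a) = lamx a.
  rewrite /phi0 /= /psix {1}/lamx /lform rmorphD /= !subRE !scalerA -scalerDl ea scale1r.
  by rewrite psiy_lformx.
exists (fun l f => if l is l'.+1 then if l' is 0 then phi1 f = 0 else phi2 f = 0 else phi0 f = 0).
have s01 f : phi0 f = 0 -> phi1 f = 0 by rewrite /phi1 /= => ->; rewrite rmorph0.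
have s12 f : phi1 f = 0 -> phi2 f = 0 by rewrite /phi2 /= => ->; rewrite rmorph0.
split=> [l _|l lt2].
  case: l => [|[|l]]; split; try exact: ker_prime.
  - exact: K0.
  - by move=> f /K0 /s01.
  by move=> f /K0 /s01 /s12.
case: l lt2 => [|[|//]] _; split=> //.
  exists (muy b); split; last by rewrite e_mu; apply/eqP; apply: muy_neq0.
  rewrite -[phi1 _]/(chi1 (phi0 _)) e_mu /muy /lform rmorphD /=.
  by rewrite !subRE !scaler0 addr0.
have e1 : phi1 (lamx a) = lamx a.
  by rewrite -[phi1 _]/(chi1 (phi0 _)) e_lam {1}/lamx /lform rmorphD /= !subRE.
exists (lamx a); split; last by rewrite e1; apply/eqP; apply: lamx_neq0.
rewrite -[phi2 _]/(chi2 (phi1 _)) e1 /lamx /lform rmorphD /=.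
by rewrite !subRE !scaler0 addr0.
Qed.

End Chain.

(** * Regular sequences of linear forms *)

Section Irrelevant.
Variables (F : fieldType).
Local Notation R := {mpoly F[4]}.

Lemma irrelevant_ideal : is_ideal (@irrelevant F 4).
Proof.
rewrite /irrelevant; split=> [|f g Hf Hg|r f Hf]; first exact: mcoeff0.
  by rewrite mcoeffD Hf Hg addr0.
by rewrite rmorphM /= Hf mulr0.
Qed.

Lemma irrelevant_var (i : 'I_4) : irrelevant ('X_i : R).
Proof. by rewrite /irrelevant mcoeffX mnm1_eq0. Qed.

Lemma irrelevant_Lx (a : F * F) : irrelevant (Lx a).
Proof.
have s := ideal_subsp irrelevant_ideal.
by apply: (subspB s); apply: (subspZ s); apply: irrelevant_var.
Qed.

Lemma irrelevant_My (b : F * F) : irrelevant (My b).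
Proof.
have s := ideal_subsp irrelevant_ideal.
by apply: (subspB s); apply: (subspZ s); apply: irrelevant_var.
Qed.

Lemma irrelevant_sub (K : R -> Prop) f : is_ideal K -> (forall i, K 'X_i) ->
  irrelevant f -> K f.
Proof.
move=> KI KX If; rewrite -[f]subr0 -(mpolyC0 4 F) -[in X in _ - X]If {If}.
have sK := ideal_subsp KI; move: f; apply: mpoly_var_ind => [c|f g Kf Kg|i f _].
- by rewrite mcoeffC eqxx mulr1 subrr; apply: subsp0.
- by rewrite mcoeffD mpolyCD opprD addrACA; apply: subspD.
rewrite rmorphM /= mcoeffX mnm1_eq0 mul0r mpolyC0 subr0 mulrC.
by case: KI => _ _; apply.
Qed.

(* Modulo [u - c v] each factor of the product is a nonzero multiple of [v]. *)
Lemma product_nilpotent (K : R -> Prop) (u v : R) c (s : seq (F * F)) :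
  is_ideal K -> K (u - c *: v) -> (forall t, t \in s -> t.2 * c != t.1) ->
  K (\prod_(t <- s) (t.2 *: u - t.1 *: v)) ->
  forall p q, (size s <= p + q)%N -> K (u ^+ p * v ^+ q).
Proof.
move=> KI Kuv Hs Ks; have sK := ideal_subsp KI; have [_ _ KM] := KI.
have Kv w : K (w * \prod_(t <- s) (t.2 *: u - t.1 *: v)) -> K (w * v ^+ size s).
  elim: s {Ks} w Hs => [|t s IH] w Hs; first by rewrite big_nil expr0.
  rewrite big_cons => H; rewrite exprS mulrA; apply: IH.
    by move=> t' t's; apply: Hs; rewrite in_cons t's orbT.
  have nz : t.2 * c - t.1 != 0 by rewrite subr_eq0; apply: Hs; apply: mem_head.
  set P := \prod_(t <- s) _ in H *.
  rewrite -[_ * P](scalerK nz); apply: subspZ => //.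
  have -> : (t.2 * c - t.1) *: (w * v * P) =
      w * ((t.2 *: u - t.1 *: v) * P) - (t.2 *: (w * P)) * (u - c *: v).
    rewrite -!mul_mpolyC mpolyCB mpolyCM; ring.
  by apply: subspB => //; apply: KM.
move=> p q; elim: p q => [|p IH] q le.
  rewrite add0n in le; rewrite expr0 mul1r -(subnK le) exprD; apply: KM.
  by rewrite -[_ ^+ _]mul1r; apply: Kv; rewrite mul1r.
have -> : u ^+ p.+1 * v ^+ q =
    (u ^+ p * v ^+ q) * (u - c *: v) + c *: (u ^+ p * v ^+ q.+1).
  by rewrite -!mul_mpolyC !exprS; ring.
apply: subspD => //; first exact: KM.
by apply: subspZ => //; apply: IH; rewrite addnS.
Qed.

End Irrelevant.

Section Reg.
Variables (F : fieldType) (I J : finType) (a : I -> F * F) (b : J -> F * F).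
Hypotheses (nza : forall i, nzpt (a i)) (nzb : forall j, nzpt (b j)).
Hypotheses (da : forall i i', i != i' -> ~~ dpeq (a i) (a i')).
Hypotheses (db : forall j j', j != j' -> ~~ dpeq (b j) (b j')).
Variables (c d : F).
Hypotheses (ac : forall i, ~~ dpeq (a i) (c, 1)) (bd : forall j, ~~ dpeq (b j) (d, 1)).
Variables (m : I -> J -> nat) (i0 : I) (j0 : J).
Hypothesis m0 : (0 < m i0 j0)%N.
Local Notation R := {mpoly F[4]}.
Local Notation bih := (bihomog bideg4).
Local Notation K := (Im a b m).
Local Notation lx := (Lx (c, 1)).
Local Notation ly := (My (d, 1)).
Local Notation K1 := (ideal_add K lx).

Lemma Im_cancelX k f : K (lx ^+ k * f) -> K f.
Proof.
elim: k => [|k IH]; first by rewrite expr0 mul1r.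
by rewrite exprS -mulrA => /(Im_cancel nza nzb ac).
Qed.

(** Dimensions are known only in large x-degree; multiplication by l^N is injective modulo I_Z and
    carries every component into that range without changing j. The bound drops the minimum with j +
    1 from [rowdim]. *)
Lemma Im_bounded : exists B, forall i j, exists2 h, qdim (bih i j) K h & (h <= B)%N.
Proof.
pose M := (\sum_i \sum_j m i j)%N.
have mM i j : (m i j <= M)%N by rewrite /M (bigD1 i) //= (bigD1 j) //=; lia.
have [N HN] := Im_qdim nza nzb da db mM.
exists (\sum_i \sum_(k < M) \sum_j (m i j - k))%N => i j.
have sK := ideal_subsp (Im_ideal a b m).
apply: (qdim_bounded sK) => n q Wq iq.
have [p [_ _ sp]] := HN (N + i)%N j (leq_addr _ _).
apply: (@leq_trans (rowdim m M j)); last first.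
  by apply: leq_sum => i' _; apply: leq_sum => k _; apply: geq_minr.
rewrite -[n]card_ord -[rowdim _ _ _]card_ord.
apply: (indep_le_span (v := fun t => lx ^+ N * q t) sK sp) => [t|e].
  have := bihomogM bideg4D (bihomogXn bideg4D (k := N) (@bih_Lx _ (c, 1))) (Wq t).
  by rewrite muln1 muln0 add0n.
have -> : \sum_t e t *: (lx ^+ N * q t) = lx ^+ N * \sum_t e t *: q t.
  by rewrite mulr_sumr; apply: eq_bigr => t _; rewrite -scalerAr.
by move=> /Im_cancelX; apply: iq.
Qed.

Lemma Im_psixy f : K f -> psiy (b j0) (psix (a i0) f) = 0.
Proof.
move=> /(_ i0 j0) /inpow_psix [g ->].
by rewrite rmorphM rmorphXn /= psiy_My_id -(prednK m0) exprS !mul0r.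
Qed.

Lemma Im_krull : krull_dim_quot K 2.
Proof.
split; first exact: (point_prime_chain (nza i0) (nzb j0) Im_psixy).
have [B HB] := Im_bounded; move=> d'.
exact: (prime_chain_le2 (Im_ideal a b m) HB).
Qed.

Lemma Im_irrelevant f : K f -> irrelevant f.
Proof.
move=> /(_ i0 j0) [g ->]; have s := ideal_subsp (irrelevant_ideal F).
have [_ _ IM] := irrelevant_ideal F.
apply: (subsp_sum s) => -[[|k] /= ltk] _.
  by rewrite subn0 -(prednK m0) exprSr mulrA; apply: IM; apply: irrelevant_My.
by rewrite mulrAC exprSr mulrA; apply: IM; apply: irrelevant_Lx.
Qed.

Lemma regular2_CM : regular2 a b (c, 1) (d, 1) m -> cohen_macaulay_quot K.
Proof.
move=> reg; exists 2%N; split; first exact: Im_krull.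
split; last first.
  have [B HB] := Im_bounded; move=> fs; exact: (regular_seq_le2 (Im_ideal a b m) HB).
exists [:: lx; ly]; split=> //; split.
- by case=> [|[|//]] _; [apply: irrelevant_Lx | apply: irrelevant_My].
- have -> : [:: lx; ly] = rcons (rcons [::] lx) ly by [].
  case/isg_rcons => f [v [/isg_rcons [g [u [/isg_nil Kg ->]]] E]].
  have s := ideal_subsp (irrelevant_ideal F); have [_ _ IM] := irrelevant_ideal F.
  have : irrelevant (1 : R).
    rewrite E; apply: (subspD s); first apply: (subspD s).
    - exact: Im_irrelevant.
    - by rewrite mulrC; apply: IM; apply: irrelevant_Lx.
    by rewrite mulrC; apply: IM; apply: irrelevant_My.
  by move/eqP; rewrite mcoeff1 eqxx oner_eq0.
case=> [|[|//]] _ g /=.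
  by move/isg_nil; rewrite mulrC => /(Im_cancel nza nzb ac) Kg; apply/isg_nil.
have E f : ideal_sum_gen K [:: lx] f <-> K1 f.
  split=> [/(isg_rcons K [::]) [h [u [/isg_nil Kh ->]]]|[h [u [Kh ->]]]].
    by exists h, u.
  by apply/(isg_rcons K [::]); exists h, u; split=> //; apply/isg_nil.
by move/E; rewrite mulrC => /reg H; apply/E.
Qed.

(* [Hom(k, A/l) = Ext^1(k, A) = Hom(k, A/f1)], made explicit. *)
Lemma socle_free f1 f2 : quot_regular_seq K [:: f1; f2] ->
  forall g, (forall i, K1 ('X_i * g)) -> K1 g.
Proof.
case=> irr _ reg g Hg.
have KI := Im_ideal a b m; have sK := ideal_subsp KI; have [_ _ KM] := KI.
have K1I := ideal_addP lx KI; have [k0 kD kM] := K1I.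
have socle f : irrelevant f -> K1 (f * g).
  apply: (irrelevant_sub (K := fun f => K1 (f * g))) => //; split=> [|u v Hu Hv|r u Hu].
  - by rewrite mul0r.
  - by rewrite mulrDl; apply: kD.
  by rewrite -mulrA; apply: kM.
(* f1 g and f2 g are congruent to l h and l g' modulo I_Z; regularity of l then gives the syzygy f2
   h - f1 g' in I_Z. *)
have [k [h [Kk Ek]]] := socle f1 (irr 0%N isT).
have [k' [g' [Kk' Ek']]] := socle f2 (irr 1%N isT).
have H1 : K (f2 * h - f1 * g').
  apply: (Im_cancel nza nzb ac).
  have -> : lx * (f2 * h - f1 * g') = f1 * k' - f2 * k.
    have -> : lx * (f2 * h - f1 * g') = f2 * (lx * h) - f1 * (lx * g') by ring.
    have -> : lx * h = f1 * g - k by rewrite Ek addrC addKr.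
    have -> : lx * g' = f2 * g - k' by rewrite Ek' addrC addKr.
    by ring.
  by apply: (subspB sK); apply: KM.
(* Regularity of f2 modulo f1 gives h = h1 + f1 h' with h1 in I_Z. Hence f1 kills g - l h' modulo
   I_Z, and regularity of f1 puts g in I_Z + (l). *)
have [h1 [h' [Kh1 Eh]]] : ideal_add K f1 h.
  have E f : ideal_sum_gen K [:: f1] f <-> ideal_add K f1 f.
    split=> [/(isg_rcons K [::]) [p [u [/isg_nil Kp ->]]]|[p [u [Kp ->]]]].
      by exists p, u.
    by apply/(isg_rcons K [::]); exists p, u; split=> //; apply/isg_nil.
  apply/E; apply: (reg 1%N isT) => /=; apply/E.
  by exists (f2 * h - f1 * g'), g'; split=> //; rewrite subrK mulrC.
exists (g - lx * h'), h'; rewrite subrK; split=> //.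
apply/isg_nil; apply: (reg 0%N isT) => /=; apply/isg_nil.
have -> : (g - lx * h') * f1 = k + lx * h1.
  by rewrite mulrBl mulrC Ek Eh; ring.
by apply: (subspD sK) => //; apply: KM.
Qed.

Lemma prod_rows : K (\prod_(t <- flatten [seq nseq (\sum_j m i j) (a i) | i <- enum I])
   (t.2 *: x0 F - t.1 *: x1 F)).
Proof.
rewrite big_flatten big_map big_enum /= => i j; rewrite (bigD1 i) //= big_nseq iter_mulr_1.
apply: (@inpow_le _ _ _ _ (\sum_j m i j)); first by rewrite (bigD1 j) //= leq_addr.
rewrite mulrC; have := inpow_mon (a i) (b j) (\sum_j m i j) 0 _.
by rewrite addn0 expr0 => /(_ _) H; rewrite -[X in inpow _ _ _ X]mulr1; apply: H.
Qed.

Lemma prod_cols : K (\prod_(t <- flatten [seq nseq (\sum_i m i j) (b j) | j <- enum J])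
   (t.2 *: y0 F - t.1 *: y1 F)).
Proof.
rewrite big_flatten big_map big_enum /= => i j; rewrite (bigD1 j) //= big_nseq iter_mulr_1.
apply: (@inpow_dvdM _ _ _ a b i j _ (\sum_i m i j)).
  by rewrite (bigD1 i) //= leq_addr.
by eexists.
Qed.

Lemma generic_slope (T : finType) (e : T -> F * F) (n : T -> nat) (x : F) t :
  (forall i, ~~ dpeq (e i) (x, 1)) ->
  t \in flatten [seq nseq (n i) (e i) | i <- enum T] -> t.2 * x != t.1.
Proof.
move=> H /flatten_mapP [i _]; rewrite mem_nseq => /andP [_ /eqP ->].
by have := H i; rewrite /dpeq /peq /= mulr1 eq_sym.
Qed.

Lemma x_nilpotent (L : R -> Prop) : is_ideal L -> (forall f, K f -> L f) -> L lx ->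
  exists N, forall p q, (N <= p + q)%N -> L (x0 F ^+ p * x1 F ^+ q).
Proof.
move=> LI KL Ll; eexists => p q.
apply: (@product_nilpotent _ L _ _ c _ LI); first by rewrite -[x0 F]scale1r.
  2: exact: (KL _ prod_rows).
by move=> t; apply: generic_slope.
Qed.

Lemma y_nilpotent (L : R -> Prop) : is_ideal L -> (forall f, K f -> L f) -> L ly ->
  exists N, forall p q, (N <= p + q)%N -> L (y0 F ^+ p * y1 F ^+ q).
Proof.
move=> LI KL Ll; eexists => p q.
apply: (@product_nilpotent _ L _ _ d _ LI); first by rewrite -[y0 F]scale1r.
  2: exact: (KL _ prod_cols).
by move=> t; apply: generic_slope.
Qed.

(** If l' g lies in I_Z + (l), then monomials of large y-degree kill g modulo that ideal, and those
    of large x-degree already belong to it; so all monomials of large degree kill g. Absence of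
    socle brings this degree down to 0. *)
Lemma CM_regular2 : cohen_macaulay_quot K -> regular2 a b (c, 1) (d, 1) m.
Proof.
case=> n [[ch mx] [[fs [sz reg]] _]] g Hg.
have [ch2 mx2] := Im_krull.
(* The depth equals the Krull dimension, which is known to be 2; hence there is a regular sequence
   of two elements. *)
have En : n = 2%N by apply/eqP; rewrite eqn_leq mx2 // mx.
case: fs sz reg => [|f1 [|f2 [|]]]; rewrite En // => _ /socle_free sf.
have KI := Im_ideal a b m; have K1I := ideal_addP lx KI; have [k0 kD kM] := K1I.
have Ll : K1 lx by have := ideal_add_gen lx 1 KI; rewrite mulr1.
have [N1 H1] := x_nilpotent K1I (fun f => @ideal_add_sub _ K lx f) Ll.
pose L f := K1 (f * g).
have LI : is_ideal L.
  split=> [|u v Hu Hv|r u Hu]; rewrite /L ?mul0r //.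
    by rewrite mulrDl; apply: kD.
  by rewrite -mulrA; apply: kM.
have KL f : K f -> L f.
  by move=> Kf; apply: ideal_add_sub; rewrite mulrC; case: KI => _ _; apply.
have [N2 H2] := y_nilpotent LI KL Hg.
(* [k] measures how far the degree of [w] may fall short of the bound. *)
have main k (w : 'X_{1..4}) : (N1 + N2 <= mdeg w + k)%N -> K1 ('X_[w] * g).
  elim: k w => [|k IH] w.
    rewrite addn0 mono4E => le.
    have : (N1 <= w (inord 0) + w (inord 1))%N || (N2 <= w (inord 2) + w (inord 3))%N.
      suff: mdeg w = (w (inord 0) + w (inord 1) + (w (inord 2) + w (inord 3)))%N by lia.
      rewrite mdegE !big_ord_recl big_ord0 addn0 !addnA.
      by do !congr addn; congr (w _); apply: val_inj; rewrite /= inordK.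
    case/orP => [/H1|/H2] H.
      by rewrite -mulrA mulrC; apply: kM.
    by rewrite -mulrA; apply: kM.
  move=> le; apply: sf => i; rewrite mulrA -mpolyXD; apply: IH.
  by rewrite mdegD mdeg1; lia.
by have := main (N1 + N2)%N 0%MM; rewrite mpolyX0 mul1r; apply; rewrite mdeg0.
Qed.

End Reg.

(** * Artinian reductions and staircases *)

(** Along a decreasing chain the dimensions of the quotients increase, and the spanning family
    bounds them. Beyond an index of maximal dimension, a basis modulo [C l] still spans modulo every
    later ideal, which forces equality. *)
Lemma artinian_of_span (F : fieldType) n (J : {mpoly F[n]} -> Prop) (T : finType)
    (p : T -> {mpoly F[n]}) :
  spans (fun _ => True) J p -> artinian_quot J.
Proof.
move=> sp C HC dec.
have mono l l' f : (l <= l')%N -> C l' f -> C l f.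
  by move/subnK <-; elim: (l' - l)%N => // k IH /dec.
have sC l : subsp (C l) by apply: ideal_subsp; case: (HC l).
pose P k := exists l (q : 'I_k -> {mpoly F[n]}), indep (C l) q.
have [||d [l [q iq]] mx] := @bounded_max P #|T|.
- by exists 0%N, (fun _ => 0) => c _ [].
- move=> k [l [q iq]]; rewrite -[k]card_ord.
  have spC : spans (fun _ => True) (C l) p.
    by move=> f _; have [c Hc] := sp f Logic.I; exists c; apply: (HC l).2.
  exact: (indep_le_span (sC l) spC _ iq).
exists l => l' le f; split; first exact: mono.
have iq' : indep (C l') q by move=> c /(mono _ _ _ le) /iq.
have nomore (r : 'I_d.+1 -> {mpoly F[n]}) : (forall t : 'I_d.+1, True) -> ~ indep (C l') r.
  move=> _ ir; suff: (d.+1 <= d)%N by rewrite ltnn.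
  by apply: mx; exists l', r.
have [c Hc] := @max_indep_spans _ _ (fun _ => True) (C l') d q (sC l') (fun _ => Logic.I) iq' nomore f Logic.I.
move=> Clf.
have /iq c0 : C l (\sum_t c t *: q t).
  by rewrite -[X in C l X](subKr f); apply: (subspB (sC l)) => //; apply: mono Hc.
by move: Hc; rewrite big1 ?subr0 // => t _; rewrite c0 scale0r.
Qed.

Section TwoVariables.
Variable F : fieldType.
Local Notation R := {mpoly F[4]}.
Local Notation S := {mpoly F[2]}.
Local Notation X := ('X_(inord 0) : S).
Local Notation Y := ('X_(inord 1) : S).
Local Notation bih := (bihomog bideg4).
Local Notation bic := (bicomp bideg4).

Lemma bideg2D m m' : bideg2 (m + m')%MM =
  ((bideg2 m).1 + (bideg2 m').1, (bideg2 m).2 + (bideg2 m').2)%N.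
Proof. by rewrite /bideg2 !mnmDE. Qed.

Lemma mono2E (m : 'X_{1..2}) : 'X_[m] = X ^+ (bideg2 m).1 * Y ^+ (bideg2 m).2.
Proof.
rewrite mpolyXE_id !big_ord_recl big_ord0 mulr1 /bideg2.
by congr (_ * _); congr ('X_ _ ^+ m _); apply: val_inj; rewrite /= inordK.
Qed.

Lemma bihomog2_mono i j : bihomog bideg2 i j (X ^+ i * Y ^+ j).
Proof.
have HX : bihomog bideg2 1 0 X.
  by move=> m; rewrite msuppX inE => /eqP ->; rewrite /bideg2 !mnm1E -!val_eqE /= !inordK.
have HY : bihomog bideg2 0 1 Y.
  by move=> m; rewrite msuppX inE => /eqP ->; rewrite /bideg2 !mnm1E -!val_eqE /= !inordK.
have := bihomogM bideg2D (bihomogXn bideg2D (k := i) HX) (bihomogXn bideg2D (k := j) HY).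
by rewrite !muln1 !muln0 addn0 add0n.
Qed.

Lemma bihomog2P i j (f : S) : bihomog bideg2 i j f -> exists c, f = c *: (X ^+ i * Y ^+ j).
Proof.
move=> Hf; exists (\sum_(m <- msupp f) f@_m); rewrite scaler_suml {1}(mpolyE f).
by apply: eq_big_seq => m /Hf mf; rewrite mono2E mf.
Qed.

Lemma qdim_mono (J : S -> Prop) i j d : is_ideal J -> qdim (bihomog bideg2 i j) J d ->
  (d = 0%N /\ J (X ^+ i * Y ^+ j)) \/ (d = 1%N /\ ~ J (X ^+ i * Y ^+ j)).
Proof.
move=> JI qd; have sJ := ideal_subsp JI.
have [Jm|nJ] := classic (J (X ^+ i * Y ^+ j)); [left|right]; split=> //.
  apply: (qdim_uniq sJ qd); apply: qdim0 => f /bihomog2P [c ->]; exact: (subspZ sJ).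
apply: (qdim_uniq sJ qd); apply: qdim1 nJ _ => //; first exact: bihomog2_mono.
by move=> f /bihomog2P [c ->]; exists c; rewrite subrr; apply: (subsp0 sJ).
Qed.

(** Each bigraded component of k[x1,y1] is spanned by one monomial, so the Hilbert function is the
    indicator of the monomials outside J; divisibility gives the staircase shape. *)
Lemma staircase (J : S -> Prop) (H : nat -> nat -> nat) (D := fun i j => DeltaH H i j == 1) :
  is_ideal J -> (forall i j, exists d, quot_dim bideg2 J i j d /\ DeltaH H i j = d%:Z) ->
  [/\ forall i j, DeltaH H i j = (D i j : nat)%:Z,
      forall i j, D i.+1 j -> D i j & forall i j, D i j.+1 -> D i j].
Proof.
move=> JI HJ; have sJ := ideal_subsp JI.
have dich i j : (DeltaH H i j = 0 /\ J (X ^+ i * Y ^+ j)) \/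
                (DeltaH H i j = 1 /\ ~ J (X ^+ i * Y ^+ j)).
  have [d [/(quot_dimP _ _ _ _ sJ) qd ->]] := HJ i j.
  by have [[-> ?]|[-> ?]] := qdim_mono JI qd; [left|right].
have Dn i j : D i j -> ~ J (X ^+ i * Y ^+ j) by rewrite /D; case: (dich i j) => -[-> nJ].
have nD i j : ~ J (X ^+ i * Y ^+ j) -> D i j.
  by rewrite /D; case: (dich i j) => -[-> //].
have [_ _ JM] := JI.
split=> i j.
- by rewrite /D; case: (dich i j) => -[-> _].
- by move=> /Dn n1; apply: nD => Jm; apply: n1; rewrite exprS -mulrA; apply: JM.
by move=> /Dn n1; apply: nD => Jm; apply: n1; rewrite exprS mulrCA; apply: JM.
Qed.

Definition theta : S -> R := mmap (@mpolyC 4 F) (fun i : 'I_2 => [:: x1 F; y1 F]`_i).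
HB.instance Definition _ := GRing.RMorphism.copy theta
  (mmap (@mpolyC 4 F) (fun i : 'I_2 => [:: x1 F; y1 F]`_i)).

Lemma thetaZ : scalable theta.
Proof. by move=> c p; rewrite /theta mmapZ mul_mpolyC. Qed.
HB.instance Definition _ := GRing.isScalable.Build F S R _ theta thetaZ.

Lemma thetaX : theta X = x1 F. Proof. by rewrite /theta mmapX mmap1U inordK. Qed.
Lemma thetaY : theta Y = y1 F. Proof. by rewrite /theta mmapX mmap1U inordK. Qed.

Lemma theta_mono i j : bih i j (theta (X ^+ i * Y ^+ j)).
Proof.
rewrite rmorphM !rmorphXn /= thetaX thetaY.
have := bihomogM bideg4D (bihomogXn bideg4D (k := i) (@bih_x1 F)) (bihomogXn bideg4D (k := j) (@bih_y1 F)).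
by rewrite !muln1 !muln0 addn0 add0n.
Qed.

Lemma theta_bicomp i j p : theta (bicomp bideg2 i j p) = bic i j (theta p).
Proof.
elim/mpolyind: p => [|c m p _ _ IH]; first by rewrite bicomp0 linear0 bicomp0.
rewrite bicompP !linearP bicompP -IH; congr (_ *: _ + _).
rewrite (bicomp_of_bihomog _ _ (@bihomogX _ _ _ m)).
have := @theta_mono (bideg2 m).1 (bideg2 m).2; rewrite -mono2E => Hm.
by rewrite (bicomp_of_bihomog _ _ Hm); case: ifP; rewrite ?linear0.
Qed.

(** Modulo l and l' the variables x0 and y0 become c x1 and d y1; [rho] performs this
    elimination. *)
Lemma theta_surj c d (f : R) : exists p : S, ideal2 (Lx (c, 1)) (My (d, 1)) (f - theta p).
Proof.
pose rho : {rmorphism R -> S} := sub4 (@mpolyC 2 F) (c *: X) X (d *: Y) Y.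
exists (rho f).
have KI := ideal2_ideal (Lx (c, 1)) (My (d, 1)).
have Kx : ideal2 (Lx (c, 1)) (My (d, 1)) (Lx (c, 1)).
  by have := ideal2l (Lx (c, 1)) (My (d, 1)) 1; rewrite mulr1.
have Ky : ideal2 (Lx (c, 1)) (My (d, 1)) (My (d, 1)).
  by have := ideal2r (Lx (c, 1)) (My (d, 1)) 1; rewrite mulr1.
apply: (mor_congr (phi := idfun) (psi := theta \o rho) KI) => [e||||] /=.
- by rewrite /rho /= sub4C /theta mmapC.
- by rewrite /rho /= sub4x0 linearZ /= thetaX -[x0 F]scale1r.
- by rewrite /rho /= sub4x1 thetaX subrr; case: KI.
- by rewrite /rho /= sub4y0 linearZ /= thetaY -[y0 F]scale1r.
- by rewrite /rho /= sub4y1 thetaY subrr; case: KI.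
Qed.

(** The colon of L by h is L itself, so the exact sequence subtracts the value at the shifted
    degree. The inequality records that the truncated subtraction loses nothing. *)
Lemma qdim_quot_step p q h (L : R -> Prop) (Hf : nat -> nat -> nat) i j
    (prev := if (p <= i)%N && (q <= j)%N then Hf (i - p)%N (j - q)%N else 0%N) :
  bih p q h -> bigraded_ideal bideg4 L -> (forall g, L (h * g) -> L g) ->
  (forall i j, qdim (bih i j) L (Hf i j)) ->
  (prev <= Hf i j)%N /\ qdim (bih i j) (ideal_add L h) (Hf i j - prev)%N.
Proof.
move=> Hh LG reg HL; have LI := LG.1; have sL := ideal_subsp LI.
have [d qd _] := qdim_sub sL (ideal_subsp (ideal_addP h LI)) (fun f => @ideal_add_sub _ L h f) (HL i j).
have qprev : qdim (@shifted F 4 bideg4 p q i j) L prev.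
  rewrite /shifted /prev; case: ((p <= i)%N && (q <= j)%N); first exact: HL.
  by apply: qdim0 => f ->; apply: (subsp0 sL).
have regL g : L (h * g) <-> L g.
  by split; [exact: reg | case: LI => _ _; apply].
have E := qdim_uniq sL (HL i j) (qdim_mul Hh LG regL qprev qd).
by rewrite E addKn leq_addr.
Qed.

End TwoVariables.

(** * The artinian reduction by two generic linear forms *)

Section ArtinianReduction.
Variables (F : fieldType) (I J : finType) (a : I -> F * F) (b : J -> F * F).
Hypotheses (nza : forall i, nzpt (a i)) (nzb : forall j, nzpt (b j)).
Variables (c d : F).
Hypotheses (ac : forall i, ~~ dpeq (a i) (c, 1)) (bd : forall j, ~~ dpeq (b j) (d, 1)).
Variables (m : I -> J -> nat) (H : nat -> nat -> nat).
Local Notation R := {mpoly F[4]}.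
Local Notation S := {mpoly F[2]}.
Local Notation bih := (bihomog bideg4).
Local Notation K := (Im a b m).
Local Notation lx := (Lx (c, 1)).
Local Notation ly := (My (d, 1)).
Local Notation K2 := (ideal_add (ideal_add K lx) ly).
Hypothesis HK : forall i j, qdim (bih i j) K (H i j).

Lemma K2_bigraded : bigraded_ideal bideg4 K2.
Proof.
apply: (ideal_add_bigraded (@bih_My _ _)); apply: (ideal_add_bigraded (@bih_Lx _ _)).
exact: Im_bigraded.
Qed.

Lemma ideal2_K2 f : ideal2 lx ly f -> K2 f.
Proof.
case=> _ [v [[u ->] ->]]; exists (lx * u), v; split=> //.
exact: (ideal_add_gen _ _ (Im_ideal a b m)).
Qed.

(** The contraction of I_Z + (l, l') along [theta], so that k[x1,y1] modulo it is R/(I_Z, l, l'). *)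
Definition Jred (p : S) := K2 (theta p).

Lemma Jred_ideal : is_ideal Jred.
Proof.
have [[k0 kD kM] _] := K2_bigraded.
rewrite /Jred; split=> [|f g Hf Hg|r f Hf]; first by rewrite rmorph0.
  by rewrite rmorphD; apply: kD.
by rewrite rmorphM; apply: kM.
Qed.

Lemma Jred_bigraded : bigraded_ideal bideg2 Jred.
Proof.
split=> [|f i j Hf]; first exact: Jred_ideal.
by rewrite /Jred theta_bicomp; case: K2_bigraded => _; apply.
Qed.

Lemma Jred_artinian : artinian_quot Jred.
Proof.
have K2I := K2_bigraded.1; have K1I := ideal_addP lx (Im_ideal a b m).
have KK2 f : K f -> K2 f by move=> Kf; apply: ideal_add_sub; apply: ideal_add_sub.
have Klx : K2 lx by apply: ideal2_K2; have := ideal2l lx ly 1; rewrite mulr1.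
have Kly : K2 ly by apply: ideal2_K2; have := ideal2r lx ly 1; rewrite mulr1.
have [N1 H1] := x_nilpotent ac K2I KK2 Klx.
have [N2 H2] := y_nilpotent bd K2I KK2 Kly.
have sJ := ideal_subsp Jred_ideal; have [_ _ JM] := Jred_ideal.
pose p (t : 'I_N1 * 'I_N2) : S := 'X_(inord 0) ^+ t.1 * 'X_(inord 1) ^+ t.2.
apply: (@artinian_of_span _ _ _ _ p) => f _.
elim/mpolyind: f => [|e w f _ _ [k Hk]].
  by exists (fun _ => 0); rewrite big1 ?subrr ?subr0; [exact: (subsp0 sJ) | move=> t _; rewrite scale0r].
suff [k' Hk'] : exists k' : 'I_N1 * 'I_N2 -> F, Jred ('X_[w] - \sum_t k' t *: p t).
  exists (fun t => e * k' t + k t).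
  have -> : e *: 'X_[w] + f - \sum_t (e * k' t + k t) *: p t =
      e *: ('X_[w] - \sum_t k' t *: p t) + (f - \sum_t k t *: p t).
    rewrite scalerBr scaler_sumr addrACA -opprD -big_split /=; congr (_ - _).
    by apply: eq_bigr => t _; rewrite scalerDl scalerA.
  by apply: (subspD sJ) => //; apply: (subspZ sJ).
rewrite mono2E; set i := (bideg2 w).1; set j := (bideg2 w).2.
have zero : Jred ('X_(inord 0) ^+ i * 'X_(inord 1) ^+ j) ->
    exists k' : 'I_N1 * 'I_N2 -> F,
      Jred ('X_(inord 0) ^+ i * 'X_(inord 1) ^+ j - \sum_t k' t *: p t).
  by move=> Jw; exists (fun _ => 0); rewrite big1 ?subr0 // => t _; rewrite scale0r.
have [lti|gei] := ltnP i N1; last first.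
  apply: zero; rewrite mulrC; apply: JM; rewrite /Jred rmorphXn /= thetaX.
  by have := H1 0%N i gei; rewrite expr0 mul1r.
have [ltj|gej] := ltnP j N2; last first.
  apply: zero; apply: JM; rewrite /Jred rmorphXn /= thetaY.
  by have := H2 0%N j gej; rewrite expr0 mul1r.
exists (fun t => (t == (Ordinal lti, Ordinal ltj))%:R).
rewrite (bigD1 (Ordinal lti, Ordinal ltj)) //= eqxx scale1r big1 ?addr0 ?subrr.
  exact: (subsp0 sJ).
by move=> t /negbTE ->; rewrite scale0r.
Qed.

Lemma regular2_artinian : regular2 a b (c, 1) (d, 1) m ->
  exists J : S -> Prop, [/\ bigraded_ideal bideg2 J, artinian_quot J &
    forall i j, exists e, quot_dim bideg2 J i j e /\ DeltaH H i j = e%:Z].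
Proof.
move=> reg; exists Jred; split; [exact: Jred_bigraded | exact: Jred_artinian |].
have KG := Im_bigraded a b m; have K1G := ideal_add_bigraded (@bih_Lx _ (c, 1)) KG.
have sJ := ideal_subsp Jred_ideal; have s2 := ideal_subsp K2_bigraded.1.
pose H1 i j := (H i j - (if (0 < i)%N && (0 <= j)%N then H (i - 1) (j - 0) else 0))%N.
have st1 i j := qdim_quot_step i j (@bih_Lx _ (c, 1)) KG (fun g => @Im_cancel _ _ _ _ _ nza nzb m (c, 1) g ac) HK.
have st2 i j := qdim_quot_step (Hf := H1) i j (@bih_My _ (d, 1)) K1G reg (fun i j => (st1 i j).2).
move=> i j.
have [le2 q2] := st2 i j.
pose e := (H1 i j - (if (0 <= i)%N && (0 < j)%N then H1 (i - 0) (j - 1) else 0))%N.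
exists e; split; last first.
  (* The inequalities from the steps by l and by l' turn the nested truncated subtractions into
     integer ones. *)
  rewrite /e /DeltaH /H1 /=; have := st1 i j; have := st1 i (j - 1)%N.
  move: le2; rewrite /H1 /= => le2 [le3 _] [le1 _]; move: le1 le2 le3.
  case: i {q2 e} => [|i]; case: j => [|j] /=; rewrite ?subn0 ?subn1 /=; lia.
apply/(quot_dimP _ _ _ _ sJ).
have thW (p : S) : bihomog bideg2 i j p -> bih i j (theta p).
  move=> /bihomogP Ep; apply/bihomogP; by rewrite -theta_bicomp Ep.
have [p0 [_ _ sp0]] := q2.
have [e' qe' _] : exists2 e', qdim (bihomog bideg2 i j) Jred e' & (e' <= e)%N.
  apply: (qdim_bounded sJ) => n q Wq iq.
  rewrite -[n]card_ord -[e]card_ord.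
  apply: (indep_le_span (v := fun t => theta (q t)) s2 sp0) => [t|k]; first exact: thW.
  move=> Hk; apply: iq; rewrite /Jred linear_sum /=; move: Hk; congr K2.
  by apply: eq_bigr => t _; rewrite linearZ.
suff -> : e = e' by [].
apply: (qdim_uniq s2 q2).
refine (@qdim_iso F R S (@theta F) (bih i j) K2 (bihomog bideg2 i j) Jred e'
  s2 _ _ thW _ _ qe') => //; try exact: bihomog_subsp.
move=> f Wf; have [p Hp] := theta_surj c d f.
exists (bicomp bideg2 i j p); first exact: bicomp_bihomog.
have -> : f - theta (bicomp bideg2 i j p) = bicomp bideg4 i j (f - theta p).
  rewrite theta_bicomp addrC -scaleN1r [in RHS]addrC -[in RHS]scaleN1r bicompP.
  by rewrite ((bihomogP _ _ _ _).1 Wf).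
by case: K2_bigraded => _; apply; apply: ideal2_K2.
Qed.

End ArtinianReduction.

(** * Partitions read off from a staircase Hilbert function *)

Section Numeric.

Lemma initial_segment (D : nat -> bool) c N : (forall j, D j.+1 -> D j) ->
  (forall n, (N <= n)%N -> (\sum_(j < n.+1) D j = c)%N) -> forall j, D j = (j < c)%N.
Proof.
move=> dec HD j.
have mono i k : (i <= k)%N -> D k -> D i.
  by move/subnK <-; elim: (k - i)%N => // n IH /dec.
have E := HD (N + j)%N (leq_addr _ _).
(* The sum is split at j: if [D j] holds, all earlier terms are 1; if not, all later ones are 0. *)
have sp : ((N + j).+1 = j + (N + 1))%N by lia.
rewrite sp big_split_ord /= addn1 big_ord_recl /= addn0 in E.
have [Dj|/negbTE nDj] := boolP (D j).
  have Sj : (\sum_(i < j) D i = j)%N.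
    rewrite (eq_bigr (fun _ => 1%N)) ?sum1_card ?card_ord // => i _.
    by rewrite (mono i j) // ltnW.
  by rewrite -E Sj Dj; lia.
have tail0 : (\sum_(i < N) D (j + bump 0 i) = 0)%N.
  rewrite big1 // => i _; apply/eqP; rewrite eqb0; apply/negP => /(mono j) H.
  by rewrite H ?leq_addr in nDj.
rewrite -E nDj tail0 !addn0; apply/esym/negbTE; rewrite -leqNgt.
rewrite -[X in (_ <= X)%N](card_ord j) -sum1_card.
by apply: leq_sum => i _; apply: leq_b1.
Qed.

Lemma sum_minnS s i :
  (\sum_(x <- s) minn i.+1 x = \sum_(x <- s) minn i x + count (leq i.+1) s)%N.
Proof.
elim: s => [|x s IH]; first by rewrite !big_nil.
by rewrite !big_cons IH /=; lia.
Qed.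

Lemma sum_DeltaH H i n : \sum_(j < n.+1) DeltaH H i j =
  (H i n)%:Z - (if (0 < i)%N then (H i.-1 n)%:Z else 0).
Proof.
elim: n => [|n IH].
  by rewrite big_ord_recl big_ord0 /DeltaH /= andbF; case: i => [|i] /=; lia.
by rewrite big_ord_recr IH /DeltaH /= andbT; case: i {IH} => [|i] /=; lia.
Qed.

(** Summing row i of the indicator telescopes to H(i,n) - H(i-1,n); for large n this is the
    difference of the sums of min(i+1,x) and min(i,x), the number of parts x > i. *)
Lemma staircase_col H (D : nat -> nat -> bool) beta i :
  (forall i j, DeltaH H i j = (D i j : nat)%:Z) -> (forall i j, D i j.+1 -> D i j) ->
  (forall i, exists N, forall n, (N <= n)%N -> H i n = (\sum_(x <- beta) minn i.+1 x)%N) ->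
  forall j, D i j = (j < count (leq i.+1) beta)%N.
Proof.
move=> HD dec HH.
have [N HN] := HH i; have [N' HN'] := HH i.-1.
apply: (@initial_segment _ _ (N + N')); first exact: dec.
move=> n len; apply/eqP; rewrite -eqz_nat; apply/eqP.
have -> : (\sum_(j < n.+1) D i j)%N%:Z = \sum_(j < n.+1) DeltaH H i j.
  by rewrite (raddf_sum Posz); apply: eq_bigr => j _; rewrite HD.
rewrite sum_DeltaH HN; last lia.
case: i HN HN' => [|i] /= HN HN'.
  rewrite subr0 sum_minnS big1 // => x _; exact: min0n.
by rewrite HN' ?sum_minnS; lia.
Qed.

Lemma DeltaH_tr H i j : DeltaH (fun i j => H j i) i j = DeltaH H j i.
Proof. by rewrite /DeltaH andbC; case: i j => [|i] [|j] /=; lia. Qed.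

Lemma staircase_conj H (D : nat -> nat -> bool) alpha beta :
  sorted geq beta -> all (leq 1) beta ->
  (forall i j, DeltaH H i j = (D i j : nat)%:Z) ->
  (forall i j, D i.+1 j -> D i j) -> (forall i j, D i j.+1 -> D i j) ->
  (forall j, exists N, forall n, (N <= n)%N -> H n j = (\sum_(x <- alpha) minn j.+1 x)%N) ->
  (forall i, exists N, forall n, (N <= n)%N -> H i n = (\sum_(x <- beta) minn i.+1 x)%N) ->
  conj_part alpha = beta.
Proof.
move=> sb pb HD d1 d2 Ha Hb; apply: eq_conj_part => // -[//|i] [//|j] _ _.
rewrite -(@staircase_col H D beta i HD d2 Hb j).
rewrite -(@staircase_col (fun i j => H j i) (fun i j => D j i) alpha j) //.
  by move=> i' j'; rewrite DeltaH_tr.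
by move=> i' j'; apply: d1.
Qed.

End Numeric.

(** * Exchanging the two factors *)

Section Swap.
Variable F : fieldType.
Local Notation R := {mpoly F[4]}.
Local Notation bih := (bihomog bideg4).

(** An involution that carries the asymptotics in x-degree, applied to the transposed matrix, over
    to the y-degree. *)
Definition tau : R -> R := subR (y0 F) (y1 F) (x0 F) (x1 F).
HB.instance Definition _ := GRing.RMorphism.copy tau (subR (y0 F) (y1 F) (x0 F) (x1 F)).
Lemma tauZ : scalable tau. Proof. by move=> c f; apply: subRZ. Qed.
HB.instance Definition _ := GRing.isScalable.Build F R R _ tau tauZ.

Lemma tauE : (tau (x0 F) = y0 F) * (tau (x1 F) = y1 F) * (tau (y0 F) = x0 F) * (tau (y1 F) = x1 F).
Proof. by rewrite /tau !subRE. Qed.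

Lemma tauK f : tau (tau f) = f.
Proof.
have K0 : is_ideal (fun f : R => f = 0).
  by split=> // [_ _ -> ->|r _ ->]; rewrite ?addr0 ?mulr0.
apply/eqP; rewrite -subr_eq0; apply/eqP.
apply: (mor_congr (phi := tau \o tau) (psi := idfun) K0) => [c||||] /=;
  rewrite ?tauE ?subrr //.
by rewrite /tau !subRC.
Qed.

Lemma tau_Lx a : tau (Lx a) = My a.
Proof. by rewrite /tau /Lx rmorphB /= !subRE. Qed.

Lemma tau_My b : tau (My b) = Lx b.
Proof. by rewrite /tau /My rmorphB /= !subRE. Qed.

Lemma inpow_tau a b k f : inpow a b k f -> inpow b a k (tau f).
Proof.
case=> g ->; rewrite linear_sum /=.
apply: (subsp_sum (ideal_subsp (inpow_ideal b a k))) => l _.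
rewrite !rmorphM !rmorphXn /= tau_Lx tau_My mulrAC.
by have := inpow_mon b a (k - l) l (tau (g l)); rewrite subnK // -ltnS.
Qed.

Lemma bih_tau i j f : bih i j f -> bih j i (tau f).
Proof.
move=> Hf; rewrite (mpolyE f) linear_sum /= big_seq.
apply: (subsp_sum (bihomog_subsp F bideg4 j i)) => m /Hf mf.
rewrite linearZ /=; apply: (subspZ (bihomog_subsp F bideg4 j i)).
rewrite mono4E !rmorphM !rmorphXn /= !tauE mulrC.
have := @bihomogX F 4 bideg4 [multinom nth 0%N [:: m (inord 2); m (inord 3); m (inord 0); m (inord 1)] i | i < 4].
rewrite mono4E /bideg4 !mnmE !inordK //=.
by case: mf => -> ->.
Qed.

Variables (I J : finType) (a : I -> F * F) (b : J -> F * F) (m : I -> J -> nat).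

Lemma Im_tau f : Im a b m (tau f) <-> Im b a (fun j i => m i j) f.
Proof.
split=> H i j; last exact: inpow_tau.
by rewrite -[f]tauK; apply: inpow_tau.
Qed.

Lemma qdim_tau i j d : qdim (bih i j) (Im b a (fun j i => m i j)) d ->
  qdim (bih j i) (Im a b m) d.
Proof.
move=> qd.
refine (@qdim_iso F R R tau (bih j i) (Im a b m) (bih i j) _ d _ _ _ _ _ _ qd).
- exact: ideal_subsp (Im_ideal a b m).
- exact: bihomog_subsp.
- exact: bihomog_subsp.
- by move=> f; apply: bih_tau.
- by move=> f _; apply: Im_tau.
move=> f Wf; exists (tau f); first exact: bih_tau.
have H0 : Im a b m (f - tau (tau f)) by rewrite tauK subrr; case: (Im_ideal a b m).
exact: H0.
Qed.

End Swap.

(** * The scheme [Z] *)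

Section Parts.
Variables (rs qs : seq nat) (M : nat -> nat -> nat).
Let parts := flatten [seq [seq (\sum_(j <- qs) (M i j - k))%N
                      | k <- iota 0 (\max_(j <- qs) M i j)] | i <- rs].

Lemma parts_pos : all (leq 1) parts.
Proof.
apply/allP => x /flatten_mapP [i _ /mapP [k]].
rewrite mem_iota /= add0n => ltk ->; rewrite lt0n; apply/negP => /eqP s0.
suff: (\max_(j <- qs) M i j <= k)%N by rewrite leqNgt ltk.
apply/bigmax_leqP_seq => j jq _; rewrite -subn_eq0.
by move/eqP: s0; rewrite sum_nat_seq_eq0 => /allP /(_ j jq).
Qed.

Lemma row_parts_sort :
  row_parts (fun (i : 'I_(size rs)) (j : 'I_(size qs)) => M (nth 0%N rs i) (nth 0%N qs j))
    (sort geq parts).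
Proof.
exists (\sum_(i <- rs) \max_(j <- qs) M i j)%N => K f leK f0.
rewrite (perm_big _ (permEl (perm_sort _ _))) /= big_flatten big_map (big_nth 0%N) big_mkord.
apply: eq_bigr => i _; rewrite big_map; set i' := nth _ _ _.
have leM : (\max_(j <- qs) M i' j <= K)%N.
  by apply: leq_trans leK; rewrite [X in (_ <= X)%N](big_nth 0%N) big_mkord (bigD1 i) //= leq_addr.
set l := (\max_(j <- qs) M i' j)%N in leM *.
transitivity (\sum_(0 <= k < K) f (\sum_(j <- qs) (M i' j - k)))%N; last first.
  rewrite big_mkord; apply: eq_bigr => k _; congr f.
  by rewrite (big_nth 0%N) big_mkord.
(* Levels from the largest entry on have zero row sums and are discarded by f 0 = 0; they are the
   levels absent from the list. *)
rewrite (big_cat_nat _ leM) //= [X in (_ + X)%N]big1_seq ?addn0.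
  by rewrite /index_iota subn0.
move=> k; rewrite mem_index_iota => /andP [_ /andP [lk _]].
rewrite big1_seq // => j /andP [_ jq]; apply/eqP; rewrite subn_eq0.
by apply: leq_trans lk; apply: (@leq_bigmax_seq _ qs xpredT (M i')).
Qed.

End Parts.

Section Proportional.
Variable F : fieldType.
Implicit Types (a b c : F * F).

Lemma dpeq_refl a : dpeq a a.
Proof. by rewrite /dpeq /peq mulrC. Qed.

Lemma dpeq_scale a a' : nzpt a' -> dpeq a a' -> exists s, a = (s * a'.1, s * a'.2).
Proof.
case: a a' => a1 a2 [b1 b2]; rewrite /nzpt /dpeq /peq /= => nz /eqP E.
have [b20|nz2] := eqVneq b2 0.
  rewrite b20 eqxx orbF in nz; exists (a1 / b1); rewrite b20 mulr0 divfK //.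
  congr pair; apply/eqP; move: E; rewrite b20 mulr0 => /esym /eqP.
  by rewrite mulf_eq0 (negbTE nz) orbF.
by exists (a2 / b2); rewrite divfK // mulrAC -E mulfK.
Qed.

(** The zero vector is proportional to every vector, so the middle one must be nonzero. *)
Lemma dpeq_trans a b c : nzpt b -> dpeq a b -> dpeq b c -> dpeq a c.
Proof.
move=> nz /(dpeq_scale nz) [s ->]; rewrite /dpeq /peq /= => /eqP E.
by rewrite -!mulrA E.
Qed.

Lemma inpow_prop a b a' b' n f : nzpt a' -> nzpt b' -> dpeq a a' -> dpeq b b' ->
  inpow a b n f -> inpow a' b' n f.
Proof.
move=> nza nzb /(dpeq_scale nza) [s Ea] /(dpeq_scale nzb) [u Eb] [g ->].
exists (fun k => s ^+ k * u ^+ (n - k) *: g k); apply: eq_bigr => k _.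
have -> : Lx a = s *: Lx a' by rewrite Ea /Lx /= scalerBr !scalerA.
have -> : My b = u *: My b' by rewrite Eb /My /= scalerBr !scalerA.
by rewrite !exprZn -!mul_mpolyC mpolyCM; ring.
Qed.

End Proportional.

(** At a root of the product plus 1 the product equals -1, so no factor vanishes. The extra factor
    for 0 keeps the polynomial nonconstant when [s] is empty. *)
Lemma closed_field_avoid (F : closedFieldType) (s : seq F) : exists c, c \notin s.
Proof.
pose p : {poly F} := \prod_(x <- 0 :: s) ('X - x%:P) + 1.
have sz : size p = (size s).+2.
  by rewrite size_polyDl size_prod_XsubC // size_poly1.
have /closed_rootP [c rc] : size p != 1%N by rewrite sz.
exists c; apply/negP => cs.
have : root (\prod_(x <- 0 :: s) ('X - x%:P)) c by rewrite root_prod_XsubC in_cons cs orbT.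
move: rc; rewrite /root /p hornerD hornerC => /eqP E /eqP E'.
by move: E; rewrite E' add0r => /eqP; rewrite oner_eq0.
Qed.

Lemma generic_point (F : closedFieldType) (T : finType) (e : T -> F * F) :
  (forall i, nzpt (e i)) -> exists c, forall i, ~~ dpeq (e i) (c, 1).
Proof.
move=> nz; have [c Hc] := closed_field_avoid [seq (e i).1 / (e i).2 | i <- enum T].
exists c => i; rewrite /dpeq /peq /= mulr1; apply/negP => /eqP E.
(* A nonzero point with second coordinate 0 is never proportional to (c, 1), so its quotient by 0 in
   the list is harmless. *)
have [e20|nz2] := eqVneq (e i).2 0.
  by have := nz i; rewrite /nzpt E e20 mul0r eqxx.
case/mapP: Hc; exists i; first by rewrite mem_enum.
by rewrite E mulrC mulKf.
Qed.

(** * From the list of points to a multiplicity matrix *)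

Section Bridge.
Variables (F : fieldType) (Z : seq (fatpt F)).
Hypothesis fpZ : fat_point_scheme Z.

Definition ptx k : F * F := (fa0 (ptZ Z k), fa1 (ptZ Z k)).
Definition pty k : F * F := (fb0 (ptZ Z k), fb1 (ptZ Z k)).
Definition rowpt (i : 'I_(size (Rs Z))) := ptx (nth 0%N (Rs Z) i).
Definition colpt (j : 'I_(size (Qs Z))) := pty (nth 0%N (Qs Z) j).
Definition mult (i : 'I_(size (Rs Z))) (j : 'I_(size (Qs Z))) :=
  mZ Z (nth 0%N (Rs Z) i) (nth 0%N (Qs Z) j).

Lemma nz_pts k : (k < size Z)%N -> [/\ nzpt (ptx k), nzpt (pty k) & (0 < fmult (ptZ Z k))%N].
Proof.
case: fpZ => _ /(all_nthP (dfltP F)) H _ lt.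
by have /and3P [] := H k lt.
Qed.

Lemma mem_Rs k : k \in Rs Z = (k < size Z)%N && all (fun k' => ~~ dpeq (ptx k') (ptx k)) (iota 0 k).
Proof. by rewrite mem_filter mem_iota add0n andbC. Qed.

Lemma mem_Qs k : k \in Qs Z = (k < size Z)%N && all (fun k' => ~~ dpeq (pty k') (pty k)) (iota 0 k).
Proof. by rewrite mem_filter mem_iota add0n andbC. Qed.

Lemma rowpt_nz i : nzpt (rowpt i).
Proof.
have := mem_nth 0%N (ltn_ord i); rewrite mem_Rs => /andP [lt _].
by case: (nz_pts lt).
Qed.

Lemma colpt_nz j : nzpt (colpt j).
Proof.
have := mem_nth 0%N (ltn_ord j); rewrite mem_Qs => /andP [lt _].
by case: (nz_pts lt).
Qed.

Lemma first_indices_distinct (pf : nat -> F * F) (s : seq nat) : uniq s ->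
  (forall k, k \in s -> all (fun k' => ~~ dpeq (pf k') (pf k)) (iota 0 k)) ->
  forall i i' : 'I_(size s), i != i' -> ~~ dpeq (pf (nth 0%N s i)) (pf (nth 0%N s i')).
Proof.
move=> us Hs i i' ne.
have key u v : u \in s -> v \in s -> (u < v)%N -> ~~ dpeq (pf u) (pf v).
  by move=> _ /Hs /allP H lt; apply: H; rewrite mem_iota.
have mi := mem_nth 0%N (ltn_ord i); have mi' := mem_nth 0%N (ltn_ord i').
case: (ltngtP (nth 0%N s i) (nth 0%N s i')) => [|lt|/eqP]; first exact: key.
  by rewrite dpeq_sym; apply: key.
by rewrite nth_uniq // => /eqP E; rewrite -val_eqE /= E eqxx in ne.
Qed.

Lemma rowpt_distinct i i' : i != i' -> ~~ dpeq (rowpt i) (rowpt i').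
Proof.
apply: first_indices_distinct; first by rewrite filter_uniq ?iota_uniq.
by move=> k; rewrite mem_Rs => /andP [].
Qed.

Lemma colpt_distinct j j' : j != j' -> ~~ dpeq (colpt j) (colpt j').
Proof.
apply: first_indices_distinct; first by rewrite filter_uniq ?iota_uniq.
by move=> k; rewrite mem_Qs => /andP [].
Qed.

Lemma first_index (pf : nat -> F * F) k : (forall l, (l <= k)%N -> nzpt (pf l)) ->
  exists2 l, (l <= k)%N && all (fun k' => ~~ dpeq (pf k') (pf l)) (iota 0 l) & dpeq (pf k) (pf l).
Proof.
move=> nz; have ex : exists l, dpeq (pf k) (pf l) by exists k; apply: dpeq_refl.
case: (ex_minnP ex) => l dl mn; exists l => //.
have lek : (l <= k)%N by apply: mn; apply: dpeq_refl.
rewrite lek /=; apply/allP => k'; rewrite mem_iota add0n => /andP [_ lt].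
apply/negP => dk'; suff: (l <= k')%N by rewrite leqNgt lt.
by apply: mn; apply: dpeq_trans (nz l lek) dl _; rewrite dpeq_sym.
Qed.

Lemma row_of k : (k < size Z)%N -> exists i, dpeq (ptx k) (rowpt i).
Proof.
move=> lt; have [l le|l /andP [le fst] dl] := @first_index ptx k.
  by case: (nz_pts (leq_ltn_trans le lt)).
have ml : l \in Rs Z by rewrite mem_Rs (leq_ltn_trans le lt).
have li : (index l (Rs Z) < size (Rs Z))%N by rewrite index_mem.
by exists (Ordinal li); rewrite /rowpt nth_index.
Qed.

Lemma col_of k : (k < size Z)%N -> exists j, dpeq (pty k) (colpt j).
Proof.
move=> lt; have [l le|l /andP [le fst] dl] := @first_index pty k.
  by case: (nz_pts (leq_ltn_trans le lt)).
have ml : l \in Qs Z by rewrite mem_Qs (leq_ltn_trans le lt).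
have li : (index l (Qs Z) < size (Qs Z))%N by rewrite index_mem.
by exists (Ordinal li); rewrite /colpt nth_index.
Qed.

Lemma same_pt k k' : (k < size Z)%N -> (k' < size Z)%N ->
  dpeq (ptx k) (ptx k') -> dpeq (pty k) (pty k') -> k = k'.
Proof.
case: fpZ => _ _ pw.
have key u v : (u < size Z)%N -> (v < size Z)%N -> (u < v)%N ->
    dpeq (ptx u) (ptx v) -> dpeq (pty u) (pty v) -> False.
  move=> lu lv uv dx dy; move/(pairwiseP (dfltP F)): pw => /(_ u v lu lv uv).
  by rewrite /same_P; move: dx dy; rewrite /dpeq /= => -> ->.
move=> lk lk' dx dy; case: (ltngtP k k') => // lt; first by case: (key k k').
by case: (key k' k) => //; rewrite dpeq_sym.
Qed.

(** [mZ] sums over all listed points lying over the given row and column; distinctness of the points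
    leaves just one. *)
Lemma mult_at k i j : (k < size Z)%N -> dpeq (ptx k) (rowpt i) -> dpeq (pty k) (colpt j) ->
  mult i j = fmult (ptZ Z k).
Proof.
move=> lk di dj; rewrite /mult /mZ.
set s := filter _ _.
have ks : k \in s.
  by rewrite mem_filter mem_iota add0n lk leq0n !andbT; apply/andP; split; [exact: di | exact: dj].
have su k' : k' \in s -> k' = k.
  rewrite mem_filter mem_iota add0n => /andP [/andP [d1 d2] lk'].
  apply: same_pt => //.
    by apply: (@dpeq_trans _ (ptx k') (rowpt i) _ (rowpt_nz i) d1); rewrite dpeq_sym.
  by apply: (@dpeq_trans _ (pty k') (colpt j) _ (colpt_nz j) d2); rewrite dpeq_sym.
have us : uniq s by rewrite filter_uniq ?iota_uniq.
suff -> : s = [:: k] by rewrite /= addn0.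
case: s ks su us => [//|x [|y s]] ks su /=; first by rewrite (su x) ?mem_head.
case/andP => + _; rewrite (su x) ?mem_head // (su y) ?mem_head //.
by rewrite !in_cons eqxx orbT.
Qed.

(** A row and a column that meet in no point of Z have multiplicity 0 and impose no condition;
    elsewhere the representatives differ from the coordinates of the point by scalars, which do not
    change the point ideal. *)
Lemma IZ_Im f : IZ Z f <-> Im rowpt colpt mult f.
Proof.
split=> [H i j|H k lk].
  case E: [seq k <- iota 0 (size Z) | peq1 Z k (nth 0%N (Rs Z) i) && peq2 Z k (nth 0%N (Qs Z) j)] => [|k s].
    by rewrite /mult /mZ E; apply: inpow0.
  have := mem_head k s; rewrite -E mem_filter mem_iota add0n => /andP [/andP [d1 d2] lk].
  rewrite (mult_at lk d1 d2).
  exact: (@inpow_prop _ (ptx k) (pty k) _ _ _ _ (rowpt_nz i) (colpt_nz j) d1 d2 (H k lk)).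
have [i di] := row_of lk; have [j dj] := col_of lk.
have [nx ny _] := nz_pts lk.
have Hij : inpow (rowpt i) (colpt j) (fmult (ptZ Z k)) f.
  by rewrite -(mult_at lk di dj); apply: H.
rewrite dpeq_sym in di; rewrite dpeq_sym in dj.
exact: (@inpow_prop _ _ _ (ptx k) (pty k) _ _ nx ny di dj Hij).
Qed.

Lemma mult_pos : exists i j, (0 < mult i j)%N.
Proof.
case: fpZ => lk _ _; have [i di] := row_of lk; have [j dj] := col_of lk.
by exists i, j; rewrite (mult_at lk di dj); case: (nz_pts lk).
Qed.

Lemma SZ_nested : SZ_totally_ordered Z <-> nested mult.
Proof.
split=> [H i i' h h'|H i i' h h' mi mi'].
  have mi := mem_nth 0%N (ltn_ord i); have mi' := mem_nth 0%N (ltn_ord i').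
  by case: (H _ _ h h' mi mi') => le; [left|right] => j; apply: le; apply: mem_nth.
have li : (index i (Rs Z) < size (Rs Z))%N by rewrite index_mem.
have li' : (index i' (Rs Z) < size (Rs Z))%N by rewrite index_mem.
case: (H (Ordinal li) (Ordinal li') h h') => le; [left|right] => j mj.
  have lj : (index j (Qs Z) < size (Qs Z))%N by rewrite index_mem.
  by have := le (Ordinal lj); rewrite /mult /= !nth_index.
have lj : (index j (Qs Z) < size (Qs Z))%N by rewrite index_mem.
by have := le (Ordinal lj); rewrite /mult /= !nth_index.
Qed.

Lemma row_parts_alpha : row_parts mult (alphaZ Z).
Proof. exact: (row_parts_sort (Rs Z) (Qs Z) (mZ Z)). Qed.

Lemma row_parts_beta : row_parts (fun j i => mult i j) (betaZ Z).
Proof. exact: (row_parts_sort (Qs Z) (Rs Z) (fun j i => mZ Z i j)). Qed.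

Lemma betaZ_sorted : sorted geq (betaZ Z).
Proof. by apply: sort_sorted => u v; apply: leq_total. Qed.

Lemma betaZ_pos : all (leq 1) (betaZ Z).
Proof. by rewrite /betaZ all_sort; apply: (parts_pos (Qs Z) (Rs Z) (fun j i => mZ Z i j)). Qed.

End Bridge.

Section Asymptotics.
Variables (F : fieldType) (I J : finType) (a : I -> F * F) (b : J -> F * F).
Hypotheses (nza : forall i, nzpt (a i)) (nzb : forall j, nzpt (b j)).
Hypotheses (da : forall i i', i != i' -> ~~ dpeq (a i) (a i')).
Hypotheses (db : forall j j', j != j' -> ~~ dpeq (b j) (b j')).
Variables (m : I -> J -> nat) (alpha : seq nat).

Lemma Im_qdim_parts : row_parts m alpha ->
  forall j, exists N, forall n, (N <= n)%N ->
    qdim (bihomog bideg4 n j) (Im a b m) (\sum_(x <- alpha) minn j.+1 x).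
Proof.
move=> [K0 HK0] j; pose K := (K0 + \sum_i \sum_j m i j)%N.
have mK i' j' : (m i' j' <= K)%N by rewrite /K (bigD1 i') //= (bigD1 j') //=; lia.
have [N HN] := Im_qdim nza nzb da db mK.
exists N => n le; rewrite (HK0 K) ?leq_addr ?minn0 //; exact: HN.
Qed.

End Asymptotics.

Theorem theorem4p8 (F : closedFieldType) (Z : seq (fatpt F))
    (H : nat -> nat -> nat) :
  fat_point_scheme Z ->
  (forall i j, quot_dim bideg4 (IZ Z) i j (H i j)) ->
  (cohen_macaulay_quot (IZ Z) <->
     exists J : {mpoly F[2]} -> Prop,
       [/\ bigraded_ideal bideg2 J, artinian_quot J &
           forall i j, exists d, quot_dim bideg2 J i j d /\ DeltaH H i j = d%:Z]) /\
  (cohen_macaulay_quot (IZ Z) <-> conj_part (alphaZ Z) = betaZ Z) /\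
  (cohen_macaulay_quot (IZ Z) <-> SZ_totally_ordered Z).
Proof.
move=> fpZ.
have -> : IZ Z = Im (@rowpt F Z) (@colpt F Z) (@mult F Z).
  apply: functional_extensionality => f; apply: propositional_extensionality.
  exact: IZ_Im.
set a := @rowpt F Z; set b := @colpt F Z; set m := @mult F Z => HH.
have nza : forall i, nzpt (a i) := rowpt_nz fpZ.
have nzb : forall j, nzpt (b j) := colpt_nz fpZ.
have da : forall i i', i != i' -> ~~ dpeq (a i) (a i') := @rowpt_distinct F Z.
have db : forall j j', j != j' -> ~~ dpeq (b j) (b j') := @colpt_distinct F Z.
have [i0 [j0 m0]] := mult_pos fpZ.
have [c ac] := generic_point nza; have [d bd] := generic_point nzb.
have sK := ideal_subsp (Im_ideal a b m).
have {}HH i j : qdim (bihomog bideg4 i j) (Im a b m) (H i j).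
  exact/(quot_dimP _ _ _ _ sK).
pose ii := exists J : {mpoly F[2]} -> Prop,
  [/\ bigraded_ideal bideg2 J, artinian_quot J &
      forall i j, exists d, quot_dim bideg2 J i j d /\ DeltaH H i j = d%:Z].
have H12 : cohen_macaulay_quot (Im a b m) -> ii.
  move=> /(CM_regular2 nza nzb da db ac bd m0).
  exact: regular2_artinian.
have H23 : ii -> conj_part (alphaZ Z) = betaZ Z.
  case=> J [[JI _] _ HJ]; have [HD d1 d2] := staircase JI HJ.
  apply: (staircase_conj (betaZ_sorted Z) (betaZ_pos Z) HD d1 d2) => [j|i].
    have [N HN] := Im_qdim_parts nza nzb da db (row_parts_alpha Z) j.
    by exists N => n /HN; apply: (qdim_uniq sK).
  (* [betaZ Z] comes from the transposed matrix, and [qdim_tau] carries the dimensions back. *)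
  have [N HN] := Im_qdim_parts nzb nza db da (row_parts_beta Z) i.
  by exists N => n /HN /qdim_tau; apply: (qdim_uniq sK).
have H34 : conj_part (alphaZ Z) = betaZ Z -> SZ_totally_ordered Z.
  move=> ab; apply/SZ_nested.
  exact: (conj_part_nested (row_parts_alpha Z) (row_parts_beta Z) ab).
have H41 : SZ_totally_ordered Z -> cohen_macaulay_quot (Im a b m).
  move=> /SZ_nested /(nested_regular2 nza nzb da db ac bd).
  exact: (regular2_CM nza nzb da db ac m0).
(* The four implications form a cycle through (i), (ii), (iii), (iv). *)
by rewrite -/ii; tauto.
Qed.
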